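(* Let $M \in \mathbb{Q}^{3\times3}$ have a non-real eigenvalue $\lambda$ (eigenvalues $\lambda,\overline{\lambda},\rho$ with $\rho$ real) such that $\gamma=\lambda/|\lambda|$ is not a root of unity, and let $s\in\mathbb{Q}^3$. There is an absolute constant $c$ such that for every LTL formula $\varphi$ over atomic semialgebraic sets $T_1,\dots,T_m$, $$d(\varphi)\ge\frac{1}{2^{2^{(\|\mathcal{I}_b\|+D(\varphi))^{c}}}}.$$ In particular, $d(\varphi)\ge 1/2^{2^{\|\mathcal{I}\|^{c}}}$, where $\|\mathcal{I}\|=\|M\|+\|s\|+\|\varphi\|$.
   Context: $\mathbb{T}$ is the unit circle. Atomic sets are $T=\{x\in\mathbb{R}^3:p(x)\sim0\}$, $p\in\mathbb{Z}[x_1,x_2,x_3]$, ${\sim}\in\{>,\ge\}$. LTL formulas: $\varphi ::= T \mid \varphi\wedge\varphi \mid \varphi\vee\varphi \mid \varphi\,\mathbf{U}\,\varphi \mid \varphi\,\mathbf{R}\,\varphi \mid \mathbf{X}\varphi$, on the orbit $\langle s,Ms,\ldots\rangle$ (atom $T$ holds at $n$ iff $M^ns\in T$); $\mathcal{Z}(\varphi)=\{n\ge0:\langle M^ns,M^{n+1}s,\ldots\rangle\models\varphi\}$. For each $\varphi$, $J_\varphi\subseteq\mathbb{T}$ is the unique finite union of open arcs such that for all sufficiently large $n$, $n\in\mathcal{Z}(\varphi)$ iff $\gamma^n\in J_\varphi$; $d(\varphi)$ is the smallest arc length of a component (maximal open arc) of $J_\varphi$. $D(\varphi)$ is the maximum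 nesting depth of temporal operators, atoms having depth $0$. $\|\mathcal{I}_b\|=\|M\|+\|s\|+\sum_i\|T_i\|$, where $\|M\|,\|s\|$ are bit lengths of the rational entries and $\|T_i\|$ is the bit length of the coefficient list (including zeros) of the polynomial defining $T_i$; $\|\varphi\|$ is the size of the encoding of $\varphi$.
   Formalization: The finite union of open arcs describing Z(φ) eventually is not unique (finitely many points may be deleted) and may fail to exist when ρ<0; J_φ is taken to be the largest such union, and the bounds are stated for every φ for which J_φ exists. *)

(* Defs.v *)
(* The notations of mpoly clash with those of MathComp-Analysis. *)
From HB Require Import structures.
From mathcomp Require Import all_boot all_order all_algebra.
From mathcomp Require Import complex.
From mathcomp Require Import -(notations) mpoly.
From mathcomp Require Import all_classical all_reals all_analysis.

Set Implicit Arguments.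
Unset Strict Implicit.
Unset Printing Implicit Defensive.

Import Order.TTheory GRing.Theory Num.Theory.

Local Open Scope classical_set_scope.
Local Open Scope ring_scope.

Definition nat_bits (n : nat) : nat := (trunc_log 2 n).+1.

(* The extra bit holds the sign. *)
Definition int_bits (z : int) : nat := (nat_bits `|z|%N).+1.

Definition rat_bits (q : rat) : nat := (int_bits (numq q) + int_bits (denq q))%N.

Definition mx_bits m n (A : 'M[rat]_(m, n)) : nat :=
  (\sum_i \sum_j rat_bits (A i j))%N.

(* [msize p] is the total degree plus one (and 0 if p = 0), so the sum ranges
   over all monomials of total degree at most deg p, including those whose
   coefficient in p is zero; the zero polynomial has the coefficient list [:: 0]. *)
Definition mpoly_bits (p : mpoly 3 int) : nat :=
  (\sum_(m : bmultinom 3 (mpoly.msize p).-1.+1)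
     int_bits (mcoeff (bmnm m) p))%N.

(* The atomic set {x | p(x) > 0} if [strict], and {x | p(x) >= 0} otherwise. *)
Record atom := Atom { atom_poly : mpoly 3 int; strict : bool }.

Definition atom_bits (T : atom) : nat := mpoly_bits (atom_poly T).

Inductive ltl (m : nat) : Type :=
| Prp of 'I_m
| And of ltl m & ltl m
| Or of ltl m & ltl m
| Until of ltl m & ltl m
| Release of ltl m & ltl m
| Next of ltl m.

Fixpoint depth m (phi : ltl m) : nat :=
  match phi with
  | Prp _ => 0
  | And f g | Or f g => maxn (depth f) (depth g)
  | Until f g | Release f g => (maxn (depth f) (depth g)).+1
  | Next f => (depth f).+1
  end.

(* Every occurrence of an atom is written out in full: its coefficient list and
   one bit for the comparison symbol. *)
Fixpoint ltl_size m (T : 'I_m -> atom) (phi : ltl m) : nat :=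
  match phi with
  | Prp i => (atom_bits (T i)).+1
  | And f g | Or f g | Until f g | Release f g =>
      (ltl_size T f + ltl_size T g).+1
  | Next f => (ltl_size T f).+1
  end.

Section Semantics.
Variable R : realType.

Definition poly_at (p : mpoly 3 int) (x : 'cV[R]_3) : R :=
  mmap (intmul 1) (fun i => x i ord0) p.

Definition atom_set (T : atom) : set 'cV[R]_3 :=
  [set x | if strict T then 0 < poly_at (atom_poly T) x
           else 0 <= poly_at (atom_poly T) x].

Fixpoint models m (T : 'I_m -> atom) (phi : ltl m) (w : nat -> 'cV[R]_3) : Prop :=
  let suffix k := fun n => w (k + n)%N in
  match phi with
  | Prp i => w 0%N \in atom_set (T i)
  | And f g => models T f w /\ models T g w
  | Or f g => models T f w \/ models T g w
  | Until f g => exists k, models T g (suffix k) /\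
      forall j, (j < k)%N -> models T f (suffix j)
  | Release f g => forall k, models T g (suffix k) \/
      exists2 j, (j < k)%N & models T f (suffix j)
  | Next f => models T f (suffix 1%N)
  end.

Definition lds_orbit (M : 'M[rat]_3) (s : 'cV[rat]_3) (n : nat) : 'cV[R]_3 :=
  map_mx ratr M ^+ n *m map_mx ratr s.

Definition Zset (M : 'M[rat]_3) (s : 'cV[rat]_3) m (T : 'I_m -> atom)
    (phi : ltl m) : set nat :=
  [set n | models T phi (fun k => lds_orbit M s (n + k))].

Definition unit_circle : set R[i] := [set z | `|z| = 1].

Definition open_arc (a b : R) : set R[i] :=
  [set Complex (cos t) (sin t) | t in `]a, b[].

(* A is an open arc of length L. The whole circle has to be listed apart: with
   b = a + 2 pi, [open_arc a b] omits one point. *)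
Definition is_arc (A : set R[i]) (L : R) : Prop :=
  (exists a b, [/\ a < b, b <= a + 2 * pi, A = open_arc a b & L = b - a]) \/
  (A = unit_circle /\ L = 2 * pi).

Definition finite_union_of_arcs (J : set R[i]) : Prop :=
  exists (k : nat) (A : 'I_k -> set R[i]),
    (forall i, exists L, is_arc (A i) L) /\ J = \bigcup_i A i.

Definition eventually_describes (Z : set nat) (gamma : R[i]) (J : set R[i]) : Prop :=
  exists N : nat, forall n : nat, (N <= n)%N -> (Z n <-> J (gamma ^+ n)).

(* When gamma is not a root of unity, a finite union of open arcs describing Z
   is determined only up to removing finitely many points: each point of the
   circle is gamma ^+ n for at most one n. "The" set is the largest one, i.e.
   arcs are not cut at points that membership in Z cannot detect. *)
Definition is_Jset (Z : set nat) (gamma : R[i]) (J : set R[i]) : Prop :=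
  [/\ finite_union_of_arcs J, eventually_describes Z gamma J &
      forall J', finite_union_of_arcs J' -> eventually_describes Z gamma J' ->
        J' `<=` J].

Lemma is_Jset_unique (Z : set nat) (gamma : R[i]) (J1 J2 : set R[i]) :
  is_Jset Z gamma J1 -> is_Jset Z gamma J2 -> J1 = J2.
Proof.
move=> [u1 e1 m1] [u2 e2 m2]; apply/seteqP; split; first exact: m2.
exact: m1.
Qed.

Definition arc_component (J A : set R[i]) (L : R) : Prop :=
  [/\ is_arc A L, A `<=` J &
      forall B L', is_arc B L' -> A `<=` B -> B `<=` J -> B = A].

(* +oo if J is empty, i.e. has no component. *)
Definition min_arc_length (J : set R[i]) : \bar R :=
  ereal_inf [set L%:E | L in [set L | exists A, arc_component J A L]].

End Semantics.

(* Main.v *)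
Require Import Defs.
From HB Require Import structures.
From mathcomp Require Import all_boot all_order all_algebra.
From mathcomp Require Import complex.
From mathcomp Require Import -(notations) mpoly.
From mathcomp Require Import all_classical all_reals all_analysis.
From mathcomp Require Import zify ring lra.

Set Implicit Arguments.
Unset Strict Implicit.
Unset Printing Implicit Defensive.

Import Order.TTheory GRing.Theory Num.Theory.
Import numFieldNormedType.Exports.

Local Open Scope classical_set_scope.
Local Open Scope ring_scope.

(* The modulus 1 number gamma = lambda / |lambda| is algebraic and not a root
   of unity, so Baker's method bounds |gamma ^ k - alpha| from below for
   algebraic alpha, by an inverse power of k whose exponent is polynomial in the
   heights of gamma and alpha and in log log k. The auxiliary function has
   polynomial coefficients, and all numbers are handled through the integer
   matrices by which they act on a basis of a number field.

   Expanding p (M ^ n s) in the eigenvalues and grouping the terms by modulus,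
   the group of largest modulus w that is not identically zero is w ^ n times a
   real trigonometric polynomial in the argument of gamma ^ n. Baker's bound
   shows that it eventually dominates, so an atom can only change its truth value
   when gamma ^ n crosses one of the finitely many unimodular zeros z (for a fixed
   parity of n, because of the sign of the real eigenvalue). By induction on phi,
   up to time shifts bounded by K, the truth value of phi changes only at points
   gamma ^ (- j) z with j <= K: by a quantitative recurrence of the rotation, a
   witness of an until or a counterexample to a release can be looked for in a
   window of length polynomial in the inverse of the smallest gap between the
   points for K. Baker's bound makes this gap at least K ^ (- A), whence log K is
   multiplied by O(A ^ 2) at each temporal operator. The components of J end at
   points of this form. *)

(** * Moduli and interpolation of complex polynomials *)

(** Baker's bound is used in two different ways. J ignores finitely many times, so the thresholds
    after which a dominant term wins, or after which no power of gamma is a cut, need no estimate: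
    there a crude bound, whose exponent may grow like a power of log k and whose constant may depend
    on z, is enough. The gaps between cuts do enter the final estimate, and they need one explicit
    exponent A valid at every depth. If A grew like a power of log K, each temporal operator would
    raise log K to a higher power, and the nesting would cost one exponential too many. The
    dependence on log log k alone breaks this circle: log K stays below (40 A^2)^(D+1), whose own
    logarithm is polynomial in the input size and the depth. So A can be fixed before the induction
    as a power of a polynomially bounded weight W, and all D operators together multiply log K by
    (40 A^2)^D, which is singly exponential. *)

Section ComplexModulus.
Variable R : rcfType.
Implicit Types z w : R[i].

(** The norm of [R[i]] takes its values in [R[i]]; [nm] is the same number in the ordered field
    [R]. *)
Definition nm z : R := ComplexField.Normc.normc z.

Lemma nmE z : `|z| = (nm z)%:C%C.
Proof. by case: z => a b; rewrite normc_def. Qed.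

Lemma nm_ge0 z : 0 <= nm z.
Proof. by rewrite -ler0c -nmE normr_ge0. Qed.

Lemma nm0 : nm 0 = 0. Proof. by apply: complexI; rewrite -nmE normr0. Qed.
Lemma nm1 : nm 1 = 1. Proof. by apply: complexI; rewrite -nmE normr1. Qed.

Lemma nmM z w : nm (z * w) = nm z * nm w.
Proof. by apply: complexI; rewrite rmorphM /= -!nmE normrM. Qed.

Lemma nmN z : nm (- z) = nm z.
Proof. by apply: complexI; rewrite -!nmE normrN. Qed.

Lemma nmBC z w : nm (z - w) = nm (w - z).
Proof. by rewrite -nmN opprB. Qed.

Lemma nmD z w : nm (z + w) <= nm z + nm w.
Proof. by rewrite -lecR rmorphD /= -!nmE ler_normD. Qed.

Lemma nmB z w : nm (z - w) <= nm z + nm w.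
Proof. by rewrite -(nmN w) nmD. Qed.

Lemma nm_eq0 z : (nm z == 0) = (z == 0).
Proof. by rewrite -(inj_eq (@complexI R)) -nmE normr_eq0. Qed.

Lemma nm_gt0 z : (0 < nm z) = (z != 0).
Proof. by rewrite lt_def nm_ge0 andbT nm_eq0. Qed.

Lemma nmX z n : nm (z ^+ n) = nm z ^+ n.
Proof. by apply: complexI; rewrite rmorphXn /= -!nmE normrX. Qed.

Lemma nmV z : nm z^-1 = (nm z)^-1.
Proof. by apply: complexI; rewrite fmorphV /= -!nmE normfV. Qed.

Lemma nm_int (k : int) : nm k%:~R = `|k|%:~R.
Proof. by apply: complexI; rewrite -nmE -intr_norm rmorph_int. Qed.

Lemma nm_nat (k : nat) : nm k%:R = k%:R.
Proof. by rewrite -[k%:R]/(k%:Z%:~R) nm_int. Qed.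

Lemma nm_real (x : R) : nm x%:C%C = `|x|.
Proof. by rewrite /nm /= expr0n /= addr0 sqrtr_sqr. Qed.

Lemma nm_i : nm ('i%C : R[i]) = 1.
Proof. by rewrite /nm /= expr0n expr1n add0r sqrtr1. Qed.

Lemma Re_le_nm z : `|complex.Re z| <= nm z.
Proof. by rewrite -lecR -nmE; apply: normc_ge_Re. Qed.

Lemma Im_le_nm z : `|complex.Im z| <= nm z.
Proof.
case: z => a b; have := Re_le_nm (b +i* (- a))%C.
by rewrite /nm /= sqrrN addrC.
Qed.

Lemma nm_sum I (r : seq I) (P : pred I) (F : I -> R[i]) :
  nm (\sum_(i <- r | P i) F i) <= \sum_(i <- r | P i) nm (F i).
Proof.
elim/big_rec2: _ => [|i y1 y2 _ le_y]; first by rewrite nm0.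
by rewrite (le_trans (nmD _ _)) // lerD2l.
Qed.

Lemma nm_prod I (r : seq I) (P : pred I) (F : I -> R[i]) :
  nm (\prod_(i <- r | P i) F i) = \prod_(i <- r | P i) nm (F i).
Proof. by elim/big_rec2: _ => [|i y1 y2 _ <-]; rewrite ?nm1 ?nmM. Qed.

End ComplexModulus.
Arguments nm : simpl never.

Section Interpolation.
Variable R : rcfType.
Implicit Types (G : {poly R[i]}) (rho : R).

(** A coefficient norm that dominates the supremum on the disc of radius [rho]; in the interpolation
    it takes the place of the maximum modulus principle. *)
Definition wnorm rho G : R := \sum_(i < size G) nm G`_i * rho ^+ i.

Lemma wnormE rho G n : (size G <= n)%N ->
  wnorm rho G = \sum_(i < n) nm G`_i * rho ^+ i.
Proof.
move=> len; rewrite /wnorm (big_ord_widen n (fun i => nm G`_i * rho ^+ i)) //.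
rewrite big_mkcond /=; apply: eq_bigr => i _; case: ltnP => // lei.
by rewrite nth_default // nm0 mul0r.
Qed.

Lemma horner_le_wnorm rho G z : nm z <= rho -> nm G.[z] <= wnorm rho G.
Proof.
move=> lez; rewrite horner_coef (le_trans (nm_sum _ _ _)) //.
apply: ler_sum => i _; rewrite nmM nmX ler_wpM2l ?nm_ge0 //.
by rewrite lerXn2r ?nnegrE ?nm_ge0 // (le_trans _ lez) ?nm_ge0.
Qed.

Lemma wnormD rho G H : 0 <= rho -> wnorm rho (G + H) <= wnorm rho G + wnorm rho H.
Proof.
move=> r0; pose n := maxn (size G) (size H).
rewrite (wnormE rho (size_polyD G H)) (wnormE rho (leq_maxl (size G) (size H))).
rewrite (wnormE rho (leq_maxr (size G) (size H))) -big_split /=.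
by apply: ler_sum => i _; rewrite coefD -mulrDl ler_wpM2r ?exprn_ge0 ?nmD.
Qed.

Lemma wnormZ rho c G : wnorm rho (c *: G) = nm c * wnorm rho G.
Proof.
rewrite (wnormE rho (size_scale_leq c G)) mulr_sumr.
by apply: eq_bigr => i _; rewrite coefZ nmM mulrA.
Qed.

Lemma wnormXn rho n : wnorm rho 'X^n = rho ^+ n.
Proof.
rewrite /wnorm size_polyXn big_ord_recr /= big1 ?add0r => [|i _].
  by rewrite coefXn eqxx nm1 mul1r.
by rewrite coefXn /= ltn_eqF // nm0 mul0r.
Qed.

Lemma wnorm0 rho : wnorm rho 0 = 0.
Proof. by rewrite /wnorm size_poly0 big_ord0. Qed.

Lemma wnorm_sum rho I (r : seq I) (P : pred I) (F : I -> {poly R[i]}) : 0 <= rho ->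
  wnorm rho (\sum_(i <- r | P i) F i) <= \sum_(i <- r | P i) wnorm rho (F i).
Proof.
move=> r0; elim/big_rec2: _ => [|i y1 y2 _ le_y]; first by rewrite wnorm0.
by rewrite (le_trans (wnormD _ _ r0)) // lerD2l.
Qed.

(** The quotient of [G - G.[a]] by X - a, written out term by term so that its weighted norm can be
    read off. *)
Definition quo (a : R[i]) G : {poly R[i]} :=
  \sum_(i < size G) G`_i *: \sum_(j < i) a ^+ j *: 'X^(i.-1 - j).

Lemma quoP a G : ('X - a%:P) * quo a G = G - (G.[a])%:P.
Proof.
have {2}-> : G = \sum_(i < size G) G`_i *: 'X^i by rewrite -[LHS]coefK poly_def.
rewrite /quo mulr_sumr horner_coef rmorph_sum /= -sumrB.
apply: eq_bigr => i _; rewrite -!mul_polyC polyCM polyC_exp.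
rewrite -mulrBr mulrCA; congr (_ * _).
rewrite subrXX; congr (_ * _); apply: eq_bigr => j _.
by rewrite -mul_polyC polyC_exp mulrC.
Qed.

(** The quotient of the i-th power contributes a geometric sum, at most (rho^i - X^i) / (rho -
    X). *)
Lemma wnorm_quo rho X (a : R[i]) G : nm a <= X -> X < rho -> 0 <= X ->
  wnorm rho (quo a G) <= wnorm rho G / (rho - X).
Proof.
move=> lea ltX X0; have r0 : 0 <= rho by lra.
have d0 : 0 < rho - X by lra.
rewrite (le_trans (wnorm_sum _ _ _ r0)) // [wnorm rho G]/wnorm mulr_suml.
apply: ler_sum => i _; rewrite wnormZ -mulrA ler_wpM2l ?nm_ge0 //.
rewrite (le_trans (wnorm_sum _ _ _ r0)) //.
rewrite ler_pdivlMr // mulrC.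
under eq_bigr => j _ do rewrite wnormZ wnormXn nmX.
apply: (@le_trans _ _ ((rho - X) * \sum_(j < i) rho ^+ (i.-1 - j) * X ^+ j)).
  rewrite ler_wpM2l //; first by rewrite ltW.
  apply: ler_sum => j _; rewrite mulrC ler_wpM2l ?exprn_ge0 //.
  by rewrite lerXn2r ?nnegrE ?nm_ge0.
rewrite -subrXX gerBl exprn_ge0 //.
Qed.



Lemma quoE a G : G = quo a G * 'X + (G.[a])%:P - a *: quo a G.
Proof.
have := quoP a G; rewrite mulrBl [_%:P * _]mul_polyC mulrC => E.
by rewrite addrAC E subrK.
Qed.

(** Solved for its last term, this yields the divided derivatives of the quotient at y one after the
    other; at y = a it merely shifts the order by one. *)
Lemma nderivn_quo a G n y :
  (G^`N(n.+1)).[y] = ((quo a G)^`N(n)).[y] + (y - a) * ((quo a G)^`N(n.+1)).[y].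
Proof.
rewrite [in LHS](quoE a G) nderivnB nderivnZ nderivnMXaddC.
by rewrite !(hornerE, hornerMX); ring.
Qed.

(** A node listed m times stands for the divided derivatives of orders 0 to m - 1 at that node. *)
Definition small_data (eta : R) G (ys : seq R[i]) :=
  forall y n, (n < count_mem y ys)%N -> nm (G^`N(n)).[y] <= eta.

(** At a node other than a, at distance at least 1, each order adds one eta to the previous bound,
    so order n costs (n + 2) eta, with n < Y. At a itself, order n of the quotient is order n + 1 of
    G, provided by the copy of a that is removed. *)
Lemma small_data_quo eta G a ys (Y : nat) : 0 <= eta ->
  (forall y, y \in ys -> y != a -> 1 <= nm (y - a)) ->
  (forall y, (count_mem y ys <= Y)%N) ->
  small_data eta G (a :: ys) -> small_data ((2 * Y)%:R * eta) (quo a G) ys.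
Proof.
move=> eta0 sep mul dat y n ltn.
have yin : y \in ys by rewrite -has_pred1 has_count (leq_ltn_trans _ ltn).
have ltY : (n < Y)%N := leq_trans ltn (mul y).
suff : nm ((quo a G)^`N(n)).[y] <= n.+2%:R * eta.
  move/le_trans; apply; rewrite ler_wpM2r // ler_nat; lia.
have [eya|neya] := eqVneq y a.
  have := nderivn_quo a G n a; rewrite subrr mul0r addr0 eya => <-.
  have /le_trans -> // : nm (G^`N(n.+1)).[a] <= eta.
    by apply: dat; rewrite /= eqxx add1n ltnS -eya.
  by rewrite ler_peMl // ler1n.
have d1 := sep y yin neya.
have dG m : (m <= n)%N -> nm (G^`N(m)).[y] <= eta.
  by move=> lem; apply: dat; rewrite /= ltn_addl // (leq_ltn_trans lem).
have red z : nm z <= nm ((y - a) * z) by rewrite nmM ler_peMl ?nm_ge0.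
elim: {-2}n (leqnn n) => [|m IHm] lem.
  rewrite (le_trans (red _)) //.
  have -> : (y - a) * ((quo a G)^`N(0)).[y] = G.[y] - G.[a].
    have := congr1 (horner^~ y) (quoP a G).
    by rewrite nderivn0 !hornerE.
  rewrite (le_trans (nmB _ _)) // mulrDl mul1r lerD //.
    by have := dG 0%N isT; rewrite nderivn0.
  by have := dat a 0%N; rewrite nderivn0; apply; rewrite /= eqxx.
rewrite (le_trans (red _)) //.
have -> : (y - a) * ((quo a G)^`N(m.+1)).[y] =
          (G^`N(m.+1)).[y] - ((quo a G)^`N(m)).[y].
  by rewrite (nderivn_quo a G m y) addrAC subrr add0r.
rewrite (le_trans (nmB _ _)) // -[m.+3%:R]natr1 mulrDl mul1r addrC lerD ?dG //.
by apply: IHm; apply: ltnW.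
Qed.

(* Newton interpolation: each node y is divided out by [quo]; the interpolating
   part is controlled by the data, the last quotient by the weighted norm. *)
Lemma interpolation eta G ys (Y : nat) (X rho : R) x :
  0 <= eta -> 1 <= X -> X < rho -> (0 < Y)%N ->
  (forall y z, y \in ys -> z \in ys -> y != z -> 1 <= nm (y - z)) ->
  (forall y, (count_mem y ys <= Y)%N) ->
  (forall y, y \in ys -> nm y <= X /\ nm (x - y) <= X) -> nm x <= X ->
  small_data eta G ys ->
  nm G.[x] <= eta * (size ys)%:R * ((2 * Y)%:R * X) ^+ size ys
              + (X / (rho - X)) ^+ size ys * wnorm rho G.
Proof.
move=> eta0 X1 ltX Y0 + + + lex.
have d0 : 0 < rho - X by lra.
have YX1 : 1 <= (2 * Y)%:R * X.
  by rewrite mulr_ege1 // ler1n; lia.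
elim: ys eta G eta0 => [|a ys IH] eta G eta0 sep mul bd dat /=.
  rewrite mulr0 mul0r add0r expr0 mul1r horner_le_wnorm //; lra.
have mul' y : (count_mem y ys <= Y)%N by rewrite (leq_trans _ (mul y)) //= leq_addl.
have [lea lexa] : nm a <= X /\ nm (x - a) <= X by apply: bd; rewrite mem_head.
have dat' : small_data ((2 * Y)%:R * eta) (quo a G) ys.
  apply: small_data_quo => // y yin; apply: sep; rewrite ?mem_head //.
  by rewrite in_cons yin orbT.
have {}IH := IH _ (quo a G) _ _ mul' _ dat'.
have : nm (quo a G).[x] <= (2 * Y)%:R * eta * (size ys)%:R * ((2 * Y)%:R * X) ^+ size ys
     + (X / (rho - X)) ^+ size ys * wnorm rho (quo a G).
  apply: IH.
  - by rewrite mulr_ge0.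
  - by move=> y z yin zin; apply: sep; rewrite in_cons ?yin ?zin orbT.
  - by move=> y yin; apply: bd; rewrite in_cons yin orbT.
move=> le1.
have ->: G.[x] = G.[a] + (x - a) * (quo a G).[x].
  by have := congr1 (horner^~ x) (quoP a G); rewrite !hornerE => ->; ring.
rewrite (le_trans (nmD _ _)) // nmM.
have leG : nm G.[a] <= eta.
  by have := dat a 0%N; rewrite nderivn0; apply; rewrite /= eqxx.
set K := (2 * Y)%:R * X in YX1 le1 *; set m := size ys in le1 *.
have Km : 1 <= K ^+ m.+1 by rewrite exprn_ege1.
apply: (@le_trans _ _ (eta * K ^+ m.+1 + X * ((2 * Y)%:R * eta * m%:R * K ^+ m
     + (X / (rho - X)) ^+ m * (wnorm rho G / (rho - X))))); last first.
  rewrite -natr1 !exprS le_eqVlt; apply/orP; left; apply/eqP.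
  by rewrite -/m /K; field; rewrite gt_eqF.
apply: lerD; first by rewrite (le_trans leG) // ler_peMr.
rewrite ler_pM ?nm_ge0 // (le_trans le1) // lerD2l ler_wpM2l ?exprn_ge0 ?divr_ge0 //.
- lra.
- lra.
- by apply: wnorm_quo => //; lra.
Qed.

End Interpolation.

(** * Linear algebra for the auxiliary function *)

(** Pigeonhole: there are (B + 1)^#J vectors with coordinates in [0, B], at most B^2 + 1 values per
    equation, and (B + 1)^2 > B^2 + 1. Having twice as many unknowns as equations keeps B linear in
    A. *)
Lemma siegel (J E : finType) (a : E -> J -> int) (A : nat) :
  (0 < #|E|)%N -> (2 * #|E| <= #|J|)%N -> (0 < A)%N ->
  (forall e j, `|a e j| <= A%:Z) ->
  exists p : J -> int,
    [/\ exists j, p j != 0, forall j, `|p j| <= (2 * #|J| * A)%N%:Z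
      & forall e, \sum_j a e j * p j = 0].
Proof.
move=> E0 EJ A0 bda; set n := #|J|; pose B := (2 * n * A)%N.
(* The image of a vector lies between -C and C, and 2 C = B^2; hence the shift by C. *)
pose C := (n * A * B)%N.
have bnd (p : {ffun J -> 'I_B.+1}) e : `|\sum_j a e j * (p j)%:Z| <= C%:Z.
  rewrite (le_trans (ler_norm_sum _ _ _)) //.
  apply: (@le_trans _ _ (\sum_(j : J) (A * B)%N%:Z)).
    apply: ler_sum => j _; rewrite normrM PoszM ler_pM //.
    by rewrite ger0_norm // lez_nat -ltnS.
  rewrite sumr_const -mulr_natr natz -PoszM lez_nat /C -/n; lia.
pose val (p : {ffun J -> 'I_B.+1}) e : nat := absz (\sum_j a e j * (p j)%:Z + C%:Z).
have valE p e : (val p e)%:Z = \sum_j a e j * (p j)%:Z + C%:Z.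
  by have := bnd p e; rewrite /val; lia.
have ltval p e : (val p e < (B ^ 2).+1)%N.
  rewrite ltnS; have := bnd p e; have := valE p e.
  have -> : (B ^ 2 = 2 * C)%N by rewrite /C /B; lia.
  lia.
pose g (p : {ffun J -> 'I_B.+1}) : {ffun E -> 'I_(B ^ 2).+1} :=
  [ffun e => Ordinal (ltval p e)].
have /injectivePn [p [q nepq eqg]] : ~~ injectiveb g.
  apply/negP => /injectiveP /leq_card.
  rewrite !card_ffun !card_ord leqNgt => /negP; apply.
  apply: (@leq_trans ((B.+1 ^ 2) ^ #|E|)).
    by rewrite ltn_exp2r // /B; nia.
  by rewrite -expnM leq_pexp2l.
exists (fun j => (p j)%:Z - (q j)%:Z); split.
- have [j nej] : exists j, p j != q j.
    apply/existsP; move: nepq; apply: contraR => /existsPn H.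
    by apply/eqP/ffunP => j; apply/eqP; have := H j; rewrite negbK.
  exists j; by rewrite subr_eq0 eqz_nat val_eqE.
- by move=> j; have := ltn_ord (p j); have := ltn_ord (q j); rewrite /B; lia.
- move=> e; under eq_bigr do rewrite mulrBr.
  rewrite sumrB; apply/eqP; rewrite subr_eq0 -(inj_eq (addIr C%:Z)) -!valE.
  have := congr1 (fun h : {ffun E -> 'I_(B ^ 2).+1} => nat_of_ord (h e)) eqg.
  by rewrite !ffunE /= => ->.
Qed.

Section ExponentialPolynomials.
Variable F : numFieldType.
Implicit Types (Q : {poly F}) (b : F).

(** The operator X d/dX: it multiplies the coefficient of X^s by s, and so produces the factors s^j
    of exponential polynomials. *)
Definition euler Q : {poly F} := 'X * Q^`().

Lemma coef_iter_euler Q j s : (iter j euler Q)`_s = Q`_s * s%:R ^+ j.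
Proof.
elim: j => [|j IH] /=; first by rewrite mulr1.
rewrite {1}/euler coefXM coef_deriv; case: s IH => [|s] IH /=.
  by rewrite expr0n mulr0.
by rewrite IH exprSr mulrA mulr_natr.
Qed.

Lemma horner_iter_euler Q j b n : (size Q <= n)%N ->
  (iter j euler Q).[b] = \sum_(s < n) Q`_s * (s%:R ^+ j * b ^+ s).
Proof.
move=> le; rewrite (@horner_coef_wide _ n); last first.
  apply/leq_sizeP => i lei; rewrite coef_iter_euler.
  by rewrite (leq_sizeP _ _ le) // mul0r.
by apply: eq_bigr => s _; rewrite coef_iter_euler mulrA.
Qed.

(** Each application uses up one factor X - b. The value of the cofactor at b is tracked because for
    m = 0 it must be seen not to vanish. *)
Lemma iter_euler_root b j m Q : exists Q1,
  iter j euler (('X - b%:P) ^+ (j + m) * Q) = ('X - b%:P) ^+ m * Q1 /\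
  Q1.[b] = ((j + m) ^_ j)%:R * b ^+ j * Q.[b].
Proof.
elim: j Q => [|j IH] Q; first by exists Q; rewrite ffactn0 mulr1 mul1r.
pose Q2 := 'X * ((j.+1 + m)%:R * Q + ('X - b%:P) * Q^`()).
have [Q1 [E1 v1]] := IH Q2; exists Q1; split.
  rewrite iterSr -E1; congr (iter j euler _).
  rewrite /euler /Q2 derivM deriv_exp derivB derivX derivC subr0 mul1r addSn /= exprS -mulr_natl.
  ring.
rewrite v1 /Q2 !hornerE subrr mul0r addr0 addSn ffactSS natrM exprS.
have -> : ((j + m).+1%:R : {poly F}).[b] = (j + m).+1%:R by rewrite -polyC_natr hornerC.
rewrite /=; ring.
Qed.

(** The relations for the various s are combined with the coefficients of a polynomial Q of degree
    below n #K. It vanishes to order n at the other bases and to order j0 at [beta k0], where j0 is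
    the largest index with a nonzero coefficient; only the term (j0, k0) survives. *)
Lemma exp_poly_vanish (K : finType) (beta : K -> F) n (a : 'I_n -> K -> F) :
  injective beta -> (forall k, beta k != 0) ->
  (forall s, (s < n * #|K|)%N ->
     \sum_k \sum_j a j k * s%:R ^+ j * beta k ^+ s = 0) ->
  forall j k, a j k = 0.
Proof.
move=> injb b0 van j1 k0; apply/eqP; rewrite -[_ == _]negbK; apply/negP => a1.
have [j0 a0 maxj] :=
  @arg_maxnP _ j1 (fun j : 'I_n => a j k0 != 0) (fun j : 'I_n => nat_of_ord j) a1.
pose Q := ('X - (beta k0)%:P) ^+ j0 * \prod_(k | k != k0) ('X - (beta k)%:P) ^+ n.
have sQ : (size Q <= n * #|K|)%N.
  have -> : Q = \prod_k ('X - (beta k)%:P) ^+ (if k == k0 then nat_of_ord j0 else n).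
    rewrite (bigD1 k0) //= eqxx; congr (_ * _).
    by apply: eq_bigr => k /negPf->.
  rewrite size_prod => [|k _]; last by rewrite expf_neq0 ?polyXsubC_eq0.
  under eq_bigr do rewrite size_exp_XsubC.
  rewrite (bigD1 k0) //= eqxx (eq_bigr (fun=> n.+1)) => [|k /negPf-> //].
  rewrite sum_nat_const; have -> : #|[pred k | k != k0]| = #|K|.-1.
    by rewrite -(cardC1 k0).
  have := ltn_ord j0; have : (0 < #|K|)%N by apply/card_gt0P; exists k0.
  rewrite [X in (_ - X)%N]eq_cardT // -cardE; case: #|K| => // c _ ltj /=; nia.
have : \sum_(s < n * #|K|) Q`_s * (\sum_k \sum_j a j k * s%:R ^+ j * beta k ^+ s) = 0.
  by rewrite big1 // => s _; rewrite van ?mulr0.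
have -> : \sum_(s < n * #|K|) Q`_s * (\sum_k \sum_j a j k * s%:R ^+ j * beta k ^+ s)
        = \sum_k \sum_j a j k * (iter j euler Q).[beta k].
  under eq_bigr => s _ do rewrite mulr_sumr.
  rewrite exchange_big /=; apply: eq_bigr => k _.
  under eq_bigr => s _ do rewrite mulr_sumr.
  rewrite exchange_big /=; apply: eq_bigr => j _.
  rewrite (horner_iter_euler _ _ sQ) mulr_sumr; apply: eq_bigr => s _; ring.
rewrite (bigD1 k0) //= [X in _ + X]big1 ?addr0 => [|k nek].
  rewrite (bigD1 j0) //= [X in _ + X]big1 ?addr0 => [|j nej].
    have [Q1 [E1 v1]] := iter_euler_root (beta k0) j0 0
      (\prod_(k | k != k0) ('X - (beta k)%:P) ^+ n).
    rewrite addn0 -/Q in E1; rewrite E1 mul1r v1 addn0 ffactnn => /eqP.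
    rewrite !mulf_eq0 (negPf a0) pnatr_eq0 (gtn_eqF (fact_gt0 _)) /= expf_eq0 (negPf (b0 _)) andbF.
    rewrite horner_prod; apply/negP/prodf_neq0 => k nek.
    by rewrite !hornerE expf_neq0 // subr_eq0 (inj_eq injb) eq_sym.
  have [ltj|gtj|/val_inj eqj] := ltngtP j j0; last by rewrite eqj eqxx in nej.
    have [Q1 [E1 v1]] := iter_euler_root (beta k0) j (j0 - j)
      (\prod_(k | k != k0) ('X - (beta k)%:P) ^+ n).
    rewrite subnKC ?(ltnW ltj) // -/Q in E1; rewrite E1 !hornerE subrr /=.
    by rewrite expr0n subn_eq0 leqNgt ltj /= mulr0 mul0r.
  have [/eqP->|aj] := boolP (a j k0 == 0); first by rewrite mul0r.
  by have := maxj j aj; rewrite /geq /= leqNgt gtj.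
rewrite big1 // => j _.
pose Q2 := ('X - (beta k0)%:P) ^+ j0 * \prod_(l | (l != k0) && (l != k)) ('X - (beta l)%:P) ^+ n.
have [Q1 [E1 v1]] := iter_euler_root (beta k) j (n - j) Q2.
have EQ : Q = ('X - (beta k)%:P) ^+ (j + (n - j)) * Q2.
  by rewrite subnKC ?(ltnW (ltn_ord j)) // /Q (bigD1 k) //= mulrCA.
by rewrite EQ E1 !hornerE subrr /= expr0n subn_eq0 leqNgt ltn_ord /= mulr0 mul0r.
Qed.

(** Vandermonde, with Q the unnormalised Lagrange polynomial of the node [v i]. *)
Lemma power_sums_vanish L (v : 'I_L -> F) (p : 'I_L -> F) : injective v ->
  (forall t, (t < L)%N -> \sum_i p i * v i ^+ t = 0) -> forall i, p i = 0.
Proof.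
move=> injv van i; pose Q := \prod_(j | j != i) ('X - (v j)%:P).
have sQ : size Q = L.
  rewrite size_prod => [|k _]; last by rewrite polyXsubC_eq0.
  under eq_bigr do rewrite size_XsubC.
  rewrite sum_nat_const; have -> : #|[pred k | k != i]| = L.-1.
    exact: etrans (cardC1 i) (congr1 predn (card_ord L)).
  by have := ltn_ord i; lia.
have : \sum_(t < L) Q`_t * (\sum_j p j * v j ^+ t) = 0.
  by rewrite big1 // => t _; rewrite van ?mulr0.
have -> : \sum_(t < L) Q`_t * (\sum_j p j * v j ^+ t) = \sum_j p j * Q.[v j].
  under eq_bigr => s _ do rewrite mulr_sumr.
  rewrite exchange_big /=; apply: eq_bigr => k _.
  rewrite horner_coef sQ mulr_sumr; apply: eq_bigr => s _; ring.
rewrite (bigD1 i) //= [X in _ + X]big1 ?addr0 => [|j nej]; last first.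
  rewrite /Q horner_prod (bigD1 j) //= hornerXsubC subrr mul0r; exact: mulr0.
move/eqP; rewrite mulf_eq0 => /orP [/eqP //|].
rewrite horner_prod => /prodf_eq0 [j nej].
by rewrite !hornerE subr_eq0 (inj_eq injv) eq_sym (negPf nej).
Qed.

End ExponentialPolynomials.

(** * Heights through integer matrices *)

Section IntegerMatrices.
Variable I : finType.
Implicit Types A B : I -> I -> int.

Definition imul A B : I -> I -> int := fun i j => \sum_k A i k * B k j.
Definition ione : I -> I -> int := fun i j => (i == j)%:R.
Definition ipow A n := iter n (imul A) ione.

(** Sizes are measured by exponents of 2, so that products add them and every height is a natural
    number. *)
Definition ible A h := forall i j, `|A i j| <= (2 ^ h)%N%:Z.

Lemma ible_mono A h1 h2 : (h1 <= h2)%N -> ible A h1 -> ible A h2.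
Proof.
by move=> le bA i j; rewrite (le_trans (bA i j)) // lez_nat leq_exp2l.
Qed.

Lemma ible_sum (J : finType) (F : J -> int) h N :
  (#|J| <= 2 ^ N)%N -> (forall j, `|F j| <= (2 ^ h)%N%:Z) ->
  `|\sum_j F j| <= (2 ^ (N + h))%N%:Z.
Proof.
move=> leN bF; rewrite (le_trans (ler_norm_sum _ _ _)) //.
apply: (@le_trans _ _ (\sum_(j : J) (2 ^ h)%N%:Z)); first exact: ler_sum.
rewrite sumr_const -mulr_natr natz -PoszM lez_nat expnD mulnC leq_mul2r.
by rewrite leN orbT.
Qed.

Lemma normzM_le (a b : int) h1 h2 : `|a| <= (2 ^ h1)%N%:Z -> `|b| <= (2 ^ h2)%N%:Z ->
  `|a * b| <= (2 ^ (h1 + h2))%N%:Z.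
Proof. by move=> la lb; rewrite normrM expnD PoszM ler_pM. Qed.

Lemma card_le_exp : (#|I| <= 2 ^ #|I|)%N.
Proof. by apply: ltnW; apply: ltn_expl. Qed.

Lemma ible_mul A B h1 h2 : ible A h1 -> ible B h2 -> ible (imul A B) (#|I| + (h1 + h2)).
Proof.
move=> bA bB i j; apply: ible_sum; first exact: card_le_exp.
by move=> k; apply: normzM_le.
Qed.

Lemma ible_one h : ible ione h.
Proof. by move=> i j; rewrite /ione; case: (_ == _); rewrite lez_nat // expn_gt0. Qed.

Lemma ible_pow A h n : ible A h -> ible (ipow A n) (n * (#|I| + h)).
Proof.
move=> bA; elim: n => [|n IH]; first exact: ible_one.
by apply: ible_mono (ible_mul bA IH); rewrite mulSn addnA.
Qed.

End IntegerMatrices.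

Section Representation.
Variable R : rcfType.
Variable I : finType.
Variable e : I -> R[i].
Implicit Types (A : I -> I -> int) (x y z : R[i]) (h : nat).

(** e is an eigenvector of A for x. One vector e serves for all elements of the field, so sums and
    products of numbers become those of matrices. *)
Definition acts A x := forall i, x * e i = \sum_j (A i j)%:~R * e j.

Lemma acts_mul A B x y : acts A x -> acts B y -> acts (imul A B) (x * y).
Proof.
move=> aA aB i; rewrite mulrAC aA mulr_suml.
under eq_bigr => j _ do rewrite -mulrA [e j * y]mulrC aB mulr_sumr.
rewrite exchange_big /=; apply: eq_bigr => k _; rewrite /imul rmorph_sum /= mulr_suml.
by apply: eq_bigr => j _; rewrite mulrA rmorphM.
Qed.

Lemma acts_one : acts (@ione I) 1.
Proof.
move=> i; rewrite mul1r (bigD1 i) //= /ione eqxx mul1r big1 ?addr0 // => j nej.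
by rewrite eq_sym (negPf nej) mul0r.
Qed.

Lemma acts_pow A x n : acts A x -> acts (ipow A n) (x ^+ n).
Proof.
by move=> aA; elim: n => [|n IH]; [exact: acts_one | rewrite exprS; apply: acts_mul].
Qed.

Lemma acts_scale A x (d : int) : acts A x -> acts (fun i j => d * A i j) (d%:~R * x).
Proof.
move=> aA i; rewrite -mulrA aA mulr_sumr; apply: eq_bigr => j _.
by rewrite rmorphM mulrA.
Qed.

Lemma acts_sum (J : finType) (A : J -> I -> I -> int) (x : J -> R[i]) :
  (forall j, acts (A j) (x j)) -> acts (fun i k => \sum_j A j i k) (\sum_j x j).
Proof.
move=> aA i; rewrite mulr_suml.
under eq_bigr do rewrite aA.
rewrite exchange_big /=; apply: eq_bigr => k _.
by rewrite rmorph_sum /= mulr_suml.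
Qed.

(* x is an element of the number field generated by the vector e, of height
   controlled by h. *)
Definition rep h x := exists d : int, exists A,
  [/\ d != 0, `|d| <= (2 ^ h)%N%:Z, ible A h & acts A (d%:~R * x)].

Lemma rep_mono h1 h2 x : (h1 <= h2)%N -> rep h1 x -> rep h2 x.
Proof.
move=> le [d [A [d0 bd bA aA]]]; exists d, A; split=> //; last exact: ible_mono bA.
by rewrite (le_trans bd) // lez_nat leq_exp2l.
Qed.

Lemma rep_mul h1 h2 x y : rep h1 x -> rep h2 y -> rep (#|I| + (h1 + h2)) (x * y).
Proof.
move=> [d1 [A1 [d10 bd1 bA1 aA1]]] [d2 [A2 [d20 bd2 bA2 aA2]]].
exists (d1 * d2), (imul A1 A2); split.
- by rewrite mulf_neq0.
- by rewrite (le_trans (normzM_le bd1 bd2)) // lez_nat leq_exp2l // leq_addl.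
- exact: ible_mul.
- by rewrite rmorphM mulrACA; apply: acts_mul.
Qed.

Lemma rep_int h (k : int) : `|k| <= (2 ^ h)%N%:Z -> rep h k%:~R.
Proof.
move=> bk; exists 1, (fun i j => k * ione i j); split=> //.
- by rewrite normr1 lez_nat expn_gt0.
- by move=> i j; have := normzM_le bk (@ible_one I 0 i j); rewrite addn0.
- by have := acts_scale k acts_one; rewrite mulr1 mul1r.
Qed.

Lemma rep_one h : rep h 1.
Proof. by apply: (rep_int (k := 1)); rewrite normr1 lez_nat expn_gt0. Qed.

Lemma rep_zero h : rep h 0.
Proof. by apply: (rep_int (k := 0)); rewrite normr0. Qed.

Lemma rep_exp h x n : rep h x -> rep (n * (#|I| + h)) (x ^+ n).
Proof.
move=> rx; elim: n => [|n IH]; first exact: rep_one.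
by rewrite exprS; apply: rep_mono (rep_mul rx IH); rewrite mulSn addnA.
Qed.

Lemma rep_opp h x : rep h x -> rep h (- x).
Proof.
move=> [d [A [d0 bd bA aA]]]; exists d, (fun i j => - A i j); split=> //.
- by move=> i j; rewrite normrN.
- move=> i; rewrite mulrN mulNr aA -sumrN; apply: eq_bigr => j _.
  by rewrite rmorphN mulNr.
Qed.

Lemma prod_norm_le (J : finType) (P : pred J) (d : J -> int) h :
  (forall j, `|d j| <= (2 ^ h)%N%:Z) -> `|\prod_(j | P j) d j| <= (2 ^ (#|J| * h))%N%:Z.
Proof.
move=> bd; rewrite normr_prod; apply: (@le_trans _ _ (\prod_(j | P j) (2 ^ h)%N%:Z)).
  by apply: ler_prod => j _; rewrite normr_ge0 bd.
rewrite prodr_const -rmorphXn /= natrXE lez_nat -expnM leq_exp2l // mulnC.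
by rewrite leq_mul2r max_card orbT.
Qed.

(** The product of all denominators is a common one, and each term is multiplied by the denominators
    of the others: hence the factor [#|J|]. The successor pays for the number of terms. *)
Lemma rep_sum (J : finType) h (x : J -> R[i]) :
  (forall j, rep h (x j)) -> rep (#|J| * h.+1) (\sum_j x j).
Proof.
move=> /fin_all_exists [d] /fin_all_exists [A H].
have bd j : `|d j| <= (2 ^ h)%N%:Z by case: (H j).
have le1 : (#|J| * h <= #|J| * h.+1)%N by rewrite leq_mul2l leqnSn orbT.
pose D := \prod_j d j; pose D' j := \prod_(k | k != j) d k.
have DE j : D = D' j * d j by rewrite /D (bigD1 j) //= mulrC.
exists D, (fun i k => \sum_j D' j * A j i k); split.
- by apply/prodf_neq0 => j _; case: (H j).
- by rewrite (le_trans (prod_norm_le _ bd)) // lez_nat leq_exp2l.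
- move=> i k; rewrite mulnS; apply: ible_sum; first exact: card_le_exp.
  move=> j; case: (pickP (mem J)) => [j1 _|J0]; last by have := J0 j.
  have [d0 bdj bA _] := H j.
  have -> : (#|J| * h = #|J|.-1 * h + h)%N.
    rewrite -mulSnr prednK //; apply/card_gt0P; by exists j.
  apply: normzM_le; last exact: bA.
  rewrite normr_prod; apply: (@le_trans _ _ (\prod_(k | k != j) (2 ^ h)%N%:Z)).
    by apply: ler_prod => l _; rewrite normr_ge0 bd.
  rewrite prodr_const -rmorphXn /= natrXE lez_nat mulnC expnM leq_eqVlt; apply/orP; left.
  by apply/eqP; congr (_ ^ _)%N; exact: cardC1.
- rewrite mulr_sumr; apply: (@acts_sum _ (fun j i k => D' j * A j i k)) => j.
  have [_ _ _ aA] := H j.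
  by rewrite (DE j) rmorphM -mulrA; apply: acts_scale.
Qed.

Lemma rep_add h1 h2 x y : rep h1 x -> rep h2 y -> rep (2 * (h1 + h2).+1) (x + y).
Proof.
move=> rx ry; have -> : x + y = \sum_(b : bool) (if b then x else y).
  by rewrite big_bool.
rewrite -card_bool; apply: rep_sum => -[].
  by apply: rep_mono rx; rewrite leq_addr.
by apply: rep_mono ry; rewrite leq_addl.
Qed.

Lemma rep_sub h1 h2 x y : rep h1 x -> rep h2 y -> rep (2 * (h1 + h2).+1) (x - y).
Proof. by move=> rx ry; apply: rep_add => //; apply: rep_opp. Qed.

Lemma rep_prod (J : finType) h (x : J -> R[i]) :
  (forall j, rep h (x j)) -> rep (#|J| * (#|I| + h)) (\prod_j x j).
Proof.
move=> rx; rewrite cardE -[\prod_j x j](big_enum _ _ predT) /=.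
elim: (enum J) => [|j s IH]; first by rewrite big_nil; apply: rep_one.
by rewrite big_cons; apply: rep_mono (rep_mul (rx j) IH); rewrite mulSn addnA.
Qed.

Hypothesis e0 : exists i, e i != 0.

(** At a coordinate of e of maximal modulus, an eigenvalue is bounded by a row sum of the matrix;
    the denominator has modulus at least 1. *)
Lemma rep_le h x : rep h x -> nm x <= 2 ^+ (#|I| + h).
Proof.
move=> [d [A [d0 bd bA aA]]].
have [i0 ei0] := e0.
pose M := \big[Order.max/0]_i nm (e i).
have leM i : nm (e i) <= M by rewrite /M (bigD1 i) //= le_max lexx.
have M0 : 0 < M by rewrite (lt_le_trans _ (leM i0)) // nm_gt0.
have [i _ eqM] : exists2 i, true & M = nm (e i).
  have := @eq_bigmax _ _ _ 0 i0 predT (fun i => nm (e i)) isT (fun i _ => nm_ge0 _).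
  by case=> i _ Ei; exists i.
have /(congr1 (@nm R)) := aA i; rewrite !nmM nm_int => E.
have le1 : nm x * M <= 2 ^+ (#|I| + h) * M.
  apply: (@le_trans _ _ (`|d|%:~R * nm x * nm (e i))).
    rewrite -eqM ler_wpM2r ?(ltW M0) // ler_peMl ?nm_ge0 //.
    by rewrite (_ : 1 = 1%:~R) // ler_int -gtz0_ge1 normr_gt0.
  rewrite E (le_trans (nm_sum _ _ _)) //.
  apply: (@le_trans _ _ (\sum_(j : I) 2 ^+ h * M)).
    apply: ler_sum => j _; rewrite nmM nm_int ler_pM ?nm_ge0 ?ler0z //.
    by have := bA i j; rewrite -(ler_int R) -pmulrn natrX.
  rewrite sumr_const -[_ *+ #|_|]mulr_natl exprD -[X in _ <= X]mulrA.
  by rewrite ler_wpM2r ?mulr_ge0 ?exprn_ge0 ?(ltW M0) // -natrX ler_nat card_le_exp.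
by rewrite ler_pM2r in le1.
Qed.

Definition hinv N h := (4 * N * (N + h) + 4 * N + h + 3)%N.

(* A short integer relation between the powers of d x, found by the pigeonhole
   principle, gives the inverse. *)
Lemma rep_inv h x : x != 0 -> rep h x -> rep (hinv #|I| h) x^-1.
Proof.
move=> x0 [d [A [d0 bd bA aA]]]; set N := #|I|.
have [i0 ei0] := e0.
have N0 : (0 < N)%N by apply/card_gt0P; exists i0.
set y := d%:~R * x in aA.
have y0 : y != 0 by rewrite mulf_neq0 // intr_eq0.
have bpow (k : 'I_(2 * N)) i j : `|ipow A k i j| <= (2 ^ (2 * N * (N + h)))%N%:Z.
  apply: ible_mono (ible_pow k bA) i j; rewrite leq_mul2r; apply/orP; right.
  exact: ltnW.
have [||||p [[k1 pk1] bp rel]] := @siegel 'I_(2 * N) I (fun j k => ipow A k i0 j)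
   (2 ^ (2 * N * (N + h))).
- exact: N0.
- by rewrite card_ord.
- by rewrite expn_gt0.
- by move=> j k; apply: bpow.
rewrite card_ord in bp.
pose P := (2 * N + 2 + 2 * N * (N + h))%N.
have {}bp k : `|p k| <= (2 ^ P)%N%:Z.
  rewrite (le_trans (bp k)) // lez_nat /P expnD leq_mul2r; apply/orP; right.
  have := ltn_expl (2 * N) (isT : 1 < 2)%N; rewrite expnD; lia.
have py : \sum_k (p k)%:~R * y ^+ k = 0.
  apply/eqP; rewrite -(mulIr_eq0 _ (mulIf ei0)) mulr_suml; apply/eqP; rewrite /=.
  under eq_bigr => k _ do rewrite -mulrA (acts_pow k aA) mulr_sumr.
  rewrite exchange_big big1 //= => j _.
  under eq_bigr => k _ do rewrite mulrA -rmorphM /= mulrC.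
  by rewrite -mulr_sumr -rmorph_sum /= (eq_bigr _ (fun k _ => mulrC _ _)) rel mulr0.
(* Divided by y^(k0 + 1), with k0 the lowest index of a nonzero coefficient, the relation writes p
   k0 / y as an integer polynomial in y, up to sign the one with matrix [S]. *)
have [k0 pk0 mink0] := @arg_minnP _ k1 (fun k => p k != 0) (fun k : 'I__ => nat_of_ord k) pk1.
have yinv : (p k0)%:~R / y = - \sum_(k : 'I_(2 * N) | (k0 < k)%N) (p k)%:~R * y ^+ (k - k0.+1).
  have : \sum_(k : 'I_(2 * N) | (k0 <= k)%N) (p k)%:~R * y ^+ (k - k0) = 0.
    apply: (mulIf (expf_neq0 k0 y0)); rewrite mul0r -[RHS]py mulr_suml.
    rewrite [RHS](bigID (fun k : 'I_(2 * N) => k0 <= k)%N) /= [X in _ + X]big1 ?addr0.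
      by apply: eq_bigr => k le; rewrite -mulrA -exprD subnK.
    move=> k; rewrite -ltnNge => ltk.
    have [->|pk] := eqVneq (p k) 0; first by rewrite mul0r.
    by have := mink0 k pk; rewrite /= leqNgt ltk.
  rewrite (bigD1 k0) //= subnn expr0 mulr1 => /eqP; rewrite addr_eq0 => /eqP ->.
  rewrite mulNr mulr_suml; congr (- _); apply: eq_big => k.
    by rewrite ltn_neqAle andbC eq_sym.
  case/andP => le ne; have lt : (k0 < k)%N by rewrite ltn_neqAle le andbT eq_sym.
  by rewrite -mulrA; congr (_ * _); rewrite -(subnSK lt) exprSr mulfK.
pose q (k : 'I_(2 * N)) := if (k0 < k)%N then p k else 0.
pose S i j := \sum_(k < 2 * N) q k * ipow A (k - k0.+1) i j.
exists (p k0), (fun i j => (- d) * S i j); split=> //.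
- by rewrite (le_trans (bp k0)) // lez_nat leq_exp2l // /P /hinv -/N; nia.
- have H : (h + (2 * N + (P + 2 * N * (N + h))) <= hinv N h)%N.
    by rewrite /P /hinv; nia.
  apply: (ible_mono H) => i j; apply: normzM_le; first by rewrite normrN.
  apply: ible_sum => [|k]; first by rewrite card_ord ltnW // ltn_expl.
  rewrite /q; case: ifP => _; last by rewrite mul0r normr0.
  apply: normzM_le => //.
  apply: ible_mono (ible_pow _ bA) i j; rewrite -/N leq_mul2r; apply/orP; right.
  by rewrite (leq_trans (leq_subr _ _)) // ltnW.
- have -> : (p k0)%:~R * x^-1 =
            (- d)%:~R * \sum_(k < 2 * N) (q k)%:~R * y ^+ (k - k0.+1).
    have -> : x^-1 = d%:~R / y by rewrite /y invfM mulrA divff ?mul1r // intr_eq0.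
    rewrite mulrCA yinv rmorphN mulNr mulrN; congr (- (_ * _)).
    rewrite big_mkcond; apply: eq_bigr => k _; rewrite /q; case: ifP => // _.
    by rewrite mul0r.
  apply: acts_scale; apply: (acts_sum (A := fun k i j => q k * ipow A (k - k0.+1) i j)).
  by move=> k; apply: acts_scale; apply: acts_pow.
Qed.

Lemma rep_ge h x : x != 0 -> rep h x -> (2 ^+ (#|I| + hinv #|I| h))^-1 <= nm x.
Proof.
move=> x0 rx; have := rep_le (rep_inv x0 rx); rewrite nmV => le.
by rewrite -[nm x]invrK lef_pV2 ?posrE ?invr_gt0 ?nm_gt0 ?exprn_gt0.
Qed.

End Representation.

(** * Baker's method *)

Section Circle.
Variable R : realType.
Implicit Types (t x y : R) (z w : R[i]).

Lemma nm_le_ReIm z : nm z <= `|complex.Re z| + `|complex.Im z|.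
Proof.
by rewrite [in nm z](complexE z) (le_trans (nmD _ _)) // nmM !nm_real nm_i mul1r.
Qed.

Definition cis t : R[i] := Complex (cos t) (sin t).

Lemma cis0 : cis 0 = 1. Proof. by rewrite /cis cos0 sin0. Qed.

Lemma cisD x y : cis (x + y) = cis x * cis y.
Proof. by rewrite /cis cosD sinD; apply/eqP; rewrite eq_complex /= !eqxx addrC mulrC eqxx. Qed.

Lemma cis_neq0 t : cis t != 0.
Proof.
apply/eqP => -[c0 s0]; have := cos2Dsin2 t.
by rewrite c0 s0 expr0n addr0 => /eqP; rewrite eq_sym oner_eq0.
Qed.

Lemma cisN t : cis (- t) = (cis t)^-1.
Proof. by apply: (mulfI (cis_neq0 t)); rewrite -cisD subrr cis0 mulfV ?cis_neq0. Qed.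

Lemma cisB x y : cis (x - y) = cis x / cis y.
Proof. by rewrite cisD cisN. Qed.

Lemma cis_conj t : ((cis t)^*)%C = cis (- t).
Proof. by rewrite /cis cosN sinN. Qed.

Lemma nm_cis t : nm (cis t) = 1.
Proof. by rewrite /nm /= cos2Dsin2 sqrtr1. Qed.

Lemma cisMn t n : cis (n%:R * t) = cis t ^+ n.
Proof.
elim: n => [|n IH]; first by rewrite mul0r cis0.
by rewrite -natr1 mulrDl mul1r cisD IH exprSr.
Qed.

Lemma cis2pi : cis (2 * pi) = 1.
Proof. by rewrite /cis mulr_natl cos2pi sin2pi. Qed.

Lemma cis2piz (m : int) : cis (2 * pi * m%:~R) = 1.
Proof.
case: (intP m) => [|n|n]; first by rewrite mulr0 cis0.
  by rewrite mulrC (cisMn _ n.+1) cis2pi expr1n.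
by rewrite rmorphN mulrN cisN mulrC (cisMn _ n.+1) cis2pi expr1n invr1.
Qed.

Lemma cisD2pi t (m : int) : cis (t + 2 * pi * m%:~R) = cis t.
Proof. by rewrite cisD cis2piz mulr1. Qed.

Lemma cis_surj z : nm z = 1 -> exists2 t, 0 <= t <= 2 * pi & z = cis t.
Proof.
case: z => a b /(congr1 (fun x => x ^+ 2)); rewrite /nm /= expr1n.
rewrite sqr_sqrtr ?addr_ge0 ?sqr_ge0 // => E.
have a1 : -1 <= a <= 1 by apply/andP; split; nra.
have pi0 := @pi_ge0 R; have ac0 := acos_ge0 a1; have acp := acos_lepi a1.
have E2 : Num.sqrt (1 - a ^+ 2) = `|b| by rewrite -sqrtr_sqr; congr Num.sqrt; lra.
have [b0|b0] := leP 0 b.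
  exists (acos a); first by rewrite ac0 /=; lra.
  by rewrite /cis acosK ?in_itv //= sin_acos // E2 ger0_norm.
exists (2 * pi - acos a); first by apply/andP; split; lra.
rewrite addrC mulr_natl /cis (cosD2pi (- acos a)) (sinD2pi (- acos a)).
by rewrite cosN sinN acosK ?in_itv //= sin_acos // E2 ltr0_norm // opprK.
Qed.

(** The mean value theorem is applied to each coordinate separately, whence the constant 2. *)
Lemma MVT_cis x y : nm (cis x - cis y) <= 2 * `|x - y|.
Proof.
have key (f df : R -> R) : (forall x, is_derive x 1 f (df x)) -> (forall x, `|df x| <= 1) ->
    forall x y, `|f x - f y| <= `|x - y|.
  move=> dF bd; suff H u v : u < v -> `|f u - f v| <= `|u - v|.
    move=> u v; have [/H //|/H|->] := ltgtP u v; last by rewrite !subrr.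
    by rewrite distrC [`|v - u|]distrC.
  move=> lt; have [|c _ E] := @MVT _ f df u v lt (fun x _ => dF x).
    apply: continuous_subspaceT => w.
    by apply: differentiable_continuous; apply/derivable1_diffP; apply: ex_derive.
  rewrite distrC E normrM [`|u - v|]distrC ler_piMl //.
have hc := key cos (fun t => - sin t) (@is_derive_cos R) _ x y.
have hs := key sin cos (@is_derive_sin R) (@cos_max R) x y.
have {}hc : `|cos x - cos y| <= `|x - y| by apply: hc => t; rewrite normrN sin_max.
rewrite (le_trans (nm_le_ReIm _)) //= ; lra.
Qed.

(** The angle is t = asin (sin t0). Its cosine is at least 1/2, hence so is the derivative of the
    sine between 0 and t, and |t| is at most 2 |sin t|. *)
Lemma cis_near1 z : nm z = 1 -> nm (z - 1) <= 2^-1 ->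
  exists2 t, z = cis t & `|t| <= 2 * nm (z - 1).
Proof.
move=> z1 d1; have [t0 _ zE] := cis_surj z1.
have s1 : -1 <= sin t0 <= 1 by rewrite sin_geN1 sin_le1.
have re : `|cos t0 - 1| <= nm (z - 1) by have := Re_le_nm (z - 1); rewrite [in complex.Re _]zE.
have im : `|sin t0| <= nm (z - 1).
  by have := Im_le_nm (z - 1); rewrite [in complex.Im _]zE /= subr0.
have c1 : 2^-1 <= cos t0.
  by have := le_trans re d1; rewrite ler_norml => /andP[]; lra.
exists (asin (sin t0)).
  rewrite {1}zE /cis asinK ?in_itv //= cos_asin // -cos2sin2 sqrtr_sqr ger0_norm //; lra.
set t := asin (sin t0).
have st : sin t = sin t0 by rewrite asinK ?in_itv.
have ct : cos t = cos t0.
  by rewrite cos_asin // -cos2sin2 sqrtr_sqr ger0_norm //; lra.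
have tpi : - (pi / 2) <= t <= pi / 2 by rewrite asin_geNpi2 // asin_lepi2.
have pi2 := @pi_ge2 R.
rewrite (le_trans _ (ler_wpM2l _ im)) // -st.
wlog t0' : t {st} ct tpi / 0 < t.
  move=> H; have [lt0|lt0|->] := ltgtP t 0; last by rewrite normr0 mulr_ge0.
    by rewrite -normrN -[`|sin t|]normrN -sinN; apply: H; rewrite ?cosN //; lra.
  exact: H.
have [|c cin E] := @MVT _ sin cos 0 t t0' (fun x _ => is_derive_sin x).
  apply: continuous_subspaceT; exact: continuous_sin.
rewrite sin0 !subr0 in E; rewrite E normrM mulrA ler_peMl // ger0_norm.
  suff : cos t <= cos c by lra.
  move: cin; rewrite in_itv /= => /andP[c0 ct'].
  apply: ltW; rewrite ltr_cos ?in_itv //=; lra.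
by apply: cos_ge0_pihalf; move: cin; rewrite in_itv /= => /andP[]; lra.
Qed.

(** A Taylor polynomial of e^(i omega x). Truncation makes the interpolation estimate for
    polynomials applicable; M goes to infinity with all other data fixed, so convergence without a
    rate is enough. *)
Definition expT (omega : R) M : {poly R[i]} :=
  \poly_(j < M) (('i%C * omega%:C%C) ^+ j / j`!%:R).

Lemma expi j : ('i%C : R[i]) ^+ j =
  Complex ((~~ odd j)%:R * (-1) ^+ j./2) ((odd j)%:R * (-1) ^+ j.-1./2).
Proof.
elim: j => [|j IH]; first by rewrite expr0 /= mul1r mul0r.
rewrite exprS IH; apply/eqP; rewrite eq_complex /=.
have [n ->] : exists n, j = (n.*2 + odd j)%N by exists j./2; rewrite addnC odd_double_half.
case: (odd j); rewrite /= ?addn1 ?addn0 /= !odd_double /= ?doubleK ?uphalf_double.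
  by rewrite !(mul0r, mul1r, sub0r, add0r) exprS mulN1r !eqxx.
by rewrite !(mul0r, mul1r, sub0r, add0r, oppr0) !eqxx.
Qed.

Lemma expT_coeff x j : ('i%C * x%:C%C) ^+ j / j`!%:R = Complex (cos_coeff x j) (sin_coeff x j).
Proof.
rewrite exprMn expi -rmorphXn /=.
have -> : (j`!%:R : R[i])^-1 = (j`!%:R^-1)%:C%C by rewrite fmorphV rmorph_nat.
apply/eqP; rewrite eq_complex /= !(mulr0, subr0, addr0, add0r, mul0r).
by rewrite !eqxx.
Qed.

Lemma horner_expT omega M x : (expT omega M).[x%:C%C] =
  Complex (series (cos_coeff (omega * x)) M) (series (sin_coeff (omega * x)) M).
Proof.
rewrite horner_poly !seriesEord /=.
under eq_bigr => j _ do rewrite mulrAC -exprMn -mulrA -rmorphM expT_coeff.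
elim: M => [|M IH]; first by rewrite !big_ord0.
by rewrite !big_ord_recr /= IH.
Qed.

Lemma expT_cvg omega x (d : R) : 0 < d -> exists M0, forall M, (M0 <= M)%N ->
  nm ((expT omega M).[x%:C%C] - cis (omega * x)) <= d.
Proof.
move=> d0; have d2 : 0 < d / 2 by lra.
have := @is_cvg_series_cos_coeff R (omega * x); rewrite -[X in X -> _]/(cvgn _).
move=> /cvgrPdist_le /(_ _ d2) [N1 _ H1].
have := @is_cvg_series_sin_coeff R (omega * x).
move=> /cvgrPdist_le /(_ _ d2) [N2 _ H2].
exists (maxn N1 N2) => M; rewrite geq_max => /andP[l1 l2].
rewrite horner_expT nmBC.
have Ec : limn (series (cos_coeff (omega * x))) = cos (omega * x) by rewrite unlock.
have Es : limn (series (sin_coeff (omega * x))) = sin (omega * x) by rewrite unlock.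
have h1 := H1 M l1; have h2 := H2 M l2; rewrite /= Ec in h1; rewrite /= Es in h2.
rewrite (le_trans (nm_le_ReIm _)) //=; lra.
Qed.

Lemma nderivn_expT omega M n : (expT omega M)^`N(n) =
  (('i%C * omega%:C%C) ^+ n / n`!%:R) *: expT omega (M - n).
Proof.
apply/polyP => i; rewrite coef_nderivn coefZ !coef_poly.
have -> : (n + i < M)%N = (i < M - n)%N by rewrite ltn_subRL.
case: ifP => _; last by rewrite mul0rn mulr0.
have E := bin_fact (leq_addr i n); rewrite addKn in E.
rewrite exprD -E !natrM -mulr_natr.
field; rewrite ?pnatr_eq0 -?lt0n ?fact_gt0 ?bin_gt0 ?leq_addr //=.
Qed.

Lemma expR_le4 n : expR n%:R <= 4 ^+ n :> R.
Proof.
rewrite -[n%:R]mulr1 expRM_natl lerXn2r ?nnegrE ?expR_ge0 //.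
have h : 2^-1 <= expR (- 2^-1) :> R by rewrite (le_trans _ (expR_ge1Dx _)) //; lra.
have : expR 2^-1 <= 2 :> R.
  by rewrite -[expR _]invrK -expRN -[X in _ <= X]invrK lef_pV2 ?posrE ?expR_gt0.
move=> h2; have -> : 1 = 2^-1 + 2^-1 :> R by lra.
have := @expR_ge0 R 2^-1; rewrite expRD; nra.
Qed.

(** The weighted norm is a partial sum of the series of exp (|omega| rho), so the bound is uniform
    in M. *)
Lemma wnorm_expT rho omega M n : 0 <= rho -> `|omega| * rho <= n%:R ->
  wnorm rho (expT omega M) <= 4 ^+ n.
Proof.
move=> r0 le; rewrite (le_trans _ (expR_le4 n)) //.
rewrite (wnormE _ (size_poly _ _)).
have : \sum_(i < M) nm (expT omega M)`_i * rho ^+ i = series (exp_coeff (`|omega| * rho)) M.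
  rewrite seriesEord /=; apply: eq_bigr => i _.
  rewrite coef_poly ltn_ord nmM nmX nmM nmV nm_real nm_nat /exp_coeff /=.
  by rewrite nm_i mul1r exprMn mulrAC.
move=> ->; rewrite (@le_trans _ _ (expR (`|omega| * rho))) ?ler_expR //.
apply: nondecreasing_cvgn_le; last exact: is_cvg_series_exp_coeff.
apply/nondecreasing_seqP => k; rewrite !seriesEord /= big_ord_recr /= lerDl.
by rewrite exp_coeff_ge0 // mulr_ge0.
Qed.

End Circle.

(** * Leibniz rules, binomials and limits *)

Section PolynomialLemmas.
Variable R : rcfType.
Implicit Types q : {poly R[i]}.

Lemma nderivn_XnM m q n : ('X^m * q)^`N(n) =
  \sum_(i < n.+1) ('X^(m - i) * q^`N(n - i)) *+ 'C(m, i).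
Proof.
elim: m n => [|m IH] n.
  rewrite mul1r big_ord_recl /= !subn0 bin0 mulr1n expr0 mul1r big1 ?addr0 => [|i _].
    exact: erefl.
  by rewrite mulr0n.
have -> : 'X^(m.+1) * q = ('X^m * q) * 'X + 0%:P by rewrite polyC0 addr0 exprSr mulrAC.
case: n => [|n].
  rewrite big_ord_recl big_ord0 !nderivn0 /= polyC0 !addr0 subn0 bin0 mulr1n.
  by rewrite exprSr mulrAC.
rewrite nderivnMXaddC !IH [X in _ + X * 'X]big_ord_recl [in RHS]big_ord_recl /=.
rewrite mulrDl addrCA; congr (_ + _).
  by rewrite !subn0 !bin0 exprSr mulrAC.
rewrite mulr_suml -big_split; apply: eq_bigr => i _ /=.
rewrite /bump /= !add1n binS mulrnDr !subSS addrC; congr (_ + _).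
have [lt|ge] := ltnP i m; last by rewrite bin_small // !mulr0n mul0r.
by rewrite mulrnAl mulrAC -exprSr subnSK.
Qed.

Lemma wnorm_XnM rho m q : 0 <= rho -> wnorm rho ('X^m * q) <= rho ^+ m * wnorm rho q.
Proof.
move=> r0; rewrite mulrC [X in wnorm rho (X * _)](_ : q = \sum_(i < size q) q`_i *: 'X^i); last first.
  by rewrite -poly_def coefK.
rewrite mulr_suml (le_trans (wnorm_sum _ _ _ r0)) // mulr_sumr.
apply: ler_sum => i _; rewrite -scalerAl -exprD wnormZ wnormXn exprD.
by rewrite [rho ^+ i * _]mulrC mulrCA.
Qed.

Lemma nm_subX (x y : R[i]) n : nm x = 1 -> nm y = 1 -> nm (x ^+ n - y ^+ n) <= n%:R * nm (x - y).
Proof.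
move=> x1 y1; rewrite subrXX nmM mulrC ler_wpM2r ?nm_ge0 //.
rewrite (le_trans (nm_sum _ _ _)) //.
rewrite (eq_bigr (fun=> 1)) => [|i _]; last by rewrite nmM !nmX x1 y1 !expr1n mulr1.
by rewrite sumr_const card_ord.
Qed.

End PolynomialLemmas.

(** Composition of Hasse derivatives of a power: order a after order m is ['C(m + a, a)] times order
    m + a. *)
Lemma bin_split n m a : ('C(n, m) * 'C(n - m, a) = 'C(n, m + a) * 'C(m + a, a))%N.
Proof.
have [le|gt] := leqP (m + a) n; last first.
  rewrite [in RHS]bin_small // mul0n; have [lm|gm] := leqP m n; last by rewrite bin_small.
  by rewrite ['C(n - m, a)]bin_small ?muln0 // ltn_subLR.
have lem : (m <= n)%N by rewrite (leq_trans _ le) // leq_addr.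
have lea : (a <= n - m)%N by rewrite leq_subRL.
apply/eqP; rewrite -(eqn_pmul2r (fact_gt0 m)) -(eqn_pmul2r (fact_gt0 a)).
rewrite -(eqn_pmul2r (fact_gt0 (n - m - a))); apply/eqP.
have E1 := bin_fact lem; have E2 := bin_fact lea; have E3 := bin_fact le.
have E4 := bin_fact (leq_addl m a); rewrite addnK in E4.
rewrite -subnDA in E2 *.
transitivity (n`!)%N.
  by rewrite -E1 -E2; ring.
by rewrite -E3 -E4; ring.
Qed.

Lemma count_flatten_nseq (T : eqType) (zs : seq T) Y y : uniq zs ->
  (count_mem y (flatten [seq nseq Y z | z <- zs]) = (y \in zs) * Y)%N.
Proof.
elim: zs => //= z zs IH /andP[nz uz]; rewrite count_cat count_nseq IH // in_cons [y == z]eq_sym /=.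
by have [<-|_] := eqVneq z y; rewrite //= (negPf nz) mul0n addn0.
Qed.

Section Limits.
Variable R : rcfType.
Implicit Types (a : nat -> R[i]) (l : R[i]).

Definition tends a l := forall d : R, 0 < d ->
  exists M0, forall M, (M0 <= M)%N -> nm (a M - l) <= d.

Lemma tends_scale c a l : tends a l -> tends (fun M => c * a M) (c * l).
Proof.
move=> ta d d0; have d1 : 0 < d / (nm c + 1) by rewrite divr_gt0 // ltr_wpDl ?nm_ge0.
have [M0 H] := ta _ d1; exists M0 => M /H le; rewrite -mulrBr nmM.
have c1 : 0 < nm c + 1 by rewrite ltr_wpDl ?nm_ge0.
rewrite ler_pdivlMr // in le; have := nm_ge0 c; have := nm_ge0 (a M - l); nra.
Qed.

Lemma tends_sum (J : finType) (a : J -> nat -> R[i]) (l : J -> R[i]) : (forall j, tends (a j) (l j)) ->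
  tends (fun M => \sum_j a j M) (\sum_j l j).
Proof.
move=> ta d d0; have d1 : 0 < d / #|J|.+1%:R by rewrite divr_gt0.
have /fin_all_exists [M0 H] : forall j, exists M0, forall M, (M0 <= M)%N ->
   nm (a j M - l j) <= d / #|J|.+1%:R by move=> j; apply: ta.
exists (\max_j M0 j)%N => M leM; rewrite -sumrB (le_trans (nm_sum _ _ _)) //.
apply: (@le_trans _ _ (\sum_(j : J) d / #|J|.+1%:R)).
  by apply: ler_sum => j _; apply: H; rewrite (leq_trans _ leM) // leq_bigmax.
rewrite sumr_const -[_ *+ _]mulr_natr mulrAC ler_pdivrMr // ler_wpM2l ?(ltW d0) //.
by rewrite ler_nat leqW.
Qed.

Lemma tends_shift a l k : tends a l -> tends (fun M => a (M - k)%N) l.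
Proof.
move=> ta d /ta [M0 H]; exists (M0 + k)%N => M le; apply: H; lia.
Qed.

Lemma tends_eq a (b : nat -> R[i]) l : (forall M, a M = b M) -> tends a l -> tends b l.
Proof. by move=> E ta d /ta [M0 H]; exists M0 => M /H; rewrite E. Qed.

Lemma tends_conv a l l2 : l = l2 -> tends a l -> tends a l2.
Proof. by move=> ->. Qed.
End Limits.

(** * The auxiliary function and its extrapolation *)

Section AuxiliaryFunction.
Variables (R : realType) (r : nat) (K : finType) (L0 : nat).
Variables (beta : K -> R[i]) (u : 'I_r -> K -> int) (c : 'I_r -> R).
Variables (eps : R) (l W : nat).
Let omega k : R := \sum_i c i * (u i k)%:~R.
Hypotheses (r2 : (r <= 2)%N) (eps0 : 0 < eps).
Hypotheses (beta1 : forall k, nm (beta k) = 1).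
Hypotheses (u_le : forall i k, `|u i k| <= (2 ^ l)%N%:Z).
Hypotheses (c_le : forall i, `|c i| <= 8).
Hypotheses (omega_le : forall k, `|omega k| <= W%:R).
Hypotheses (betaE : forall k, nm (beta k - cis (omega k)) <= eps).

Variables (p : 'I_L0 * K -> int) (P nu : nat).
Hypotheses (p_le : forall j, `|p j| <= (2 ^ P)%N%:Z).
Hypotheses (nu_le : (#|{: 'I_L0 * K}| <= 2 ^ nu)%N).

Definition monomial_u (t : 'I_r -> nat) k : int := \prod_i u i k ^+ t i.
(** The Hasse derivative of order t0 of x^j0 at x = s. *)
Definition hasse t0 (j0 : nat) s : nat := ('C(j0, t0) * s ^ (j0 - t0))%N.
(** The arithmetic object. Consider the sum of p x^j exp (i (c_1 u_1 x_1 + ... + c_r u_r x_r)),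
    derived t0 times in x (as a Hasse derivative) and t_i times in x_i, without the constants i c_i,
    at x = x_1 = ... = s. In place of exp (i omega) stands the algebraic number [beta]. *)
Definition auxf t0 t s : R[i] :=
  \sum_j (p j * (hasse t0 j.1 s)%:Z * monomial_u t j.2)%:~R * beta j.2 ^+ s.
(** The analytic counterpart of [auxf], with the true exponentials. The weight w is a monomial in u,
    possibly times a power of omega. *)
Definition auxg t0 (w : K -> R[i]) s : R[i] :=
  \sum_j (p j * (hasse t0 j.1 s)%:Z)%:~R * w j.2 * cis (omega j.2 * s%:R).
Definition auxG t0 (t : 'I_r -> nat) M : {poly R[i]} :=
  \sum_(j : 'I_L0 * K) ((p j * 'C(j.1, t0)%:Z)%:~R * (monomial_u t j.2)%:~R) *:
     ('X^(j.1 - t0) * expT (omega j.2) M).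
Definition tdeg (t : 'I_r -> nat) := (\sum_i t i)%N.
Definition addt (t : 'I_r -> nat) (i : 'I_r) : 'I_r -> nat :=
  fun i' => (t i' + (i' == i))%N.

Lemma tdeg_addt t i : tdeg (addt t i) = (tdeg t).+1.
Proof.
rewrite /tdeg big_split /= addnC -add1n; congr (_ + _)%N.
by rewrite (bigD1 i) //= eqxx big1 ?addn0 // => i' /negPf->.
Qed.

Lemma monomial_u_addt t i k : monomial_u (addt t i) k = monomial_u t k * u i k.
Proof.
rewrite /monomial_u (eq_bigr _ (fun i' _ => exprD _ _ _)) big_split /=; congr (_ * _).
by rewrite (bigD1 i) //= eqxx expr1 big1 ?mulr1 // => i' /negPf->.
Qed.

Lemma monomial_u_le t k : `|monomial_u t k| <= (2 ^ (l * tdeg t))%N%:Z.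
Proof.
rewrite /monomial_u normr_prod (@le_trans _ _ (\prod_i (2 ^ (l * t i))%N%:Z)) //.
  apply: ler_prod => i _; rewrite normr_ge0 normrX /= expnM -natrXE rmorphXn /=.
  by rewrite lerXn2r ?nnegrE.
rewrite /tdeg big_distrr /= le_eqVlt; apply/orP; left; apply/eqP.
by elim/big_rec2: _ => // i y1 y2 _ ->; rewrite expnD.
Qed.

Lemma hasse_le t0 (j0 : 'I_L0) s sg : (s <= 2 ^ sg)%N -> (hasse t0 j0 s <= 2 ^ (L0 * (1 + sg)))%N.
Proof.
move=> les; rewrite /hasse mulnDr muln1 expnD leq_mul //.
  apply: (@leq_trans (2 ^ j0)); last by rewrite leq_exp2l // ltnW.
  have [le|lt] := leqP t0 j0; last by rewrite bin_small.
  by rewrite -[2%N]/(1 + 1)%N expnDn (bigD1 (inord t0)) //= inordK // !exp1n !muln1 leq_addr.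
apply: (@leq_trans ((2 ^ sg) ^ (j0 - t0))); first by case: (j0 - t0)%N => // n; rewrite leq_exp2r.
rewrite -expnM leq_exp2l // mulnC leq_mul2r; apply/orP; right.
by rewrite (leq_trans (leq_subr _ _)) // ltnW.
Qed.

(** This is where eps enters: exchanging [beta ^+ s] for the exponential costs at most s eps. *)
Lemma auxfg t0 t s sg Tt : (s <= 2 ^ sg)%N -> (tdeg t <= Tt)%N ->
  nm (auxf t0 t s - auxg t0 (fun k => (monomial_u t k)%:~R) s) <=
  2 ^+ (nu + P + L0 * (1 + sg) + l * Tt + sg) * eps.
Proof.
move=> les let_; rewrite /auxf /auxg -sumrB (le_trans (nm_sum _ _ _)) //.
pose B : R := 2 ^+ (P + L0 * (1 + sg) + l * Tt + sg) * eps.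
apply: (@le_trans _ _ (\sum_(j : 'I_L0 * K) B)); last first.
  rewrite sumr_const -[_ *+ _]mulr_natl /B mulrA -!addnA [in leRHS]exprD.
  rewrite ler_wpM2r ?(ltW eps0) // ler_wpM2r ?exprn_ge0 // -natrX ler_nat.
  exact: nu_le.
apply: ler_sum => j _; rewrite -rmorphM -mulrBr nmM nm_int /B.
rewrite exprD -[X in _ <= X]mulrA ler_pM ?nm_ge0 ?ler0z //.
  rewrite [2 ^+ _](_ : _ = (2 ^ (P + L0 * (1 + sg) + l * Tt))%N%:Z%:~R); last by rewrite -pmulrn natrX.
  rewrite ler_int; apply: normzM_le.
    by apply: normzM_le => //; rewrite ger0_norm // lez_nat hasse_le.
  by rewrite (le_trans (monomial_u_le _ _)) // lez_nat leq_exp2l // leq_mul2l let_ orbT.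
rewrite [omega _ * _]mulrC cisMn (le_trans (nm_subX _ _ _)) ?nm_cis //.
by rewrite ler_pM ?nm_ge0 // -natrX ler_nat.
Qed.


(** Since omega is the sum of the c_i u_i, a factor omega is traded for one more order of
    derivation, with at most 2 terms and |c_i| at most 8: hence 16 per factor. *)
Lemma auxg_small eta Tt S :
  (forall t0 t s, (t0 + tdeg t < Tt)%N -> (s < S)%N ->
     nm (auxg t0 (fun k => (monomial_u t k)%:~R) s) <= eta) ->
  forall b t0 t s, (t0 + tdeg t + b < Tt)%N -> (s < S)%N ->
     nm (auxg t0 (fun k => (monomial_u t k)%:~R * (omega k)%:C%C ^+ b) s) <= 16 ^+ b * eta.
Proof.
move=> H; elim=> [|b IH] t0 t s ltT ltS.
  rewrite mul1r; have := H t0 t s; rewrite addn0 in ltT => /(_ ltT ltS).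
  by congr (nm _ <= _); apply: eq_bigr => j _; rewrite expr0 mulr1.
have -> : auxg t0 (fun k => (monomial_u t k)%:~R * (omega k)%:C%C ^+ b.+1) s =
   \sum_i (c i)%:C%C * auxg t0 (fun k => (monomial_u (addt t i) k)%:~R * (omega k)%:C%C ^+ b) s.
  rewrite /auxg; under [RHS]eq_bigr => i _ do rewrite mulr_sumr.
  rewrite exchange_big /=; apply: eq_bigr => j _.
  rewrite exprS {1}/omega rmorph_sum /= !(mulr_suml, mulr_sumr).
  apply: eq_bigr => i _; rewrite monomial_u_addt !rmorphM /= rmorph_int; ring.
rewrite (le_trans (nm_sum _ _ _)) //.
have eta_ge : 0 <= 16 ^+ b * eta.
  by rewrite (le_trans _ (IH t0 t s _ ltS)) ?nm_ge0 //; lia.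
apply: (@le_trans _ _ (\sum_(i < r) 8 * (16 ^+ b * eta))).
  apply: ler_sum => i _; rewrite nmM ler_pM ?nm_ge0 ?nm_real //.
  by apply: IH => //; rewrite tdeg_addt; lia.
rewrite sumr_const card_ord -[_ *+ r]mulr_natl exprS -mulrA.
have : (r%:R : R) <= 2 by rewrite ler_nat.
move: eta_ge; set z := 16 ^+ b * eta; set q : R := r%:R; nra.
Qed.

(** Leibniz's rule for x^j e^(i omega x), whose exponential factor yields powers of i omega. The
    limit is a combination of the quantities bounded in [auxg_small]. *)
Lemma auxG_tends t0 t n s :
  tends (fun M => ((auxG t0 t M)^`N(n)).[s%:R])
    (\sum_(a < n.+1) ('C(t0 + a, a)%:R * ('i%C ^+ (n - a) / (n - a)`!%:R)) *
       auxg (t0 + a) (fun k => (monomial_u t k)%:~R * (omega k)%:C%C ^+ (n - a)) s).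
Proof.
pose co (j : 'I_L0 * K) (a : 'I_n.+1) : R[i] :=
  (p j * 'C(j.1, t0)%:Z)%:~R * (monomial_u t j.2)%:~R *
  (s%:R ^+ (j.1 - t0 - a) * (('i%C * (omega j.2)%:C%C) ^+ (n - a) / (n - a)`!%:R))
   * 'C(j.1 - t0, a)%:R.
apply: (@tends_eq _ (fun M => \sum_j \sum_a co j a *
    (expT (omega j.2) (M - (n - a))).[(s%:R : R)%:C%C])).
  move=> M; rewrite /auxG linear_sum horner_sum; apply: eq_bigr => j _.
  rewrite /= nderivnZ hornerZ nderivn_XnM horner_sum mulr_sumr; apply: eq_bigr => a _.
  rewrite hornerMn hornerM hornerXn nderivn_expT hornerZ rmorph_nat /co -mulr_natr.
  ring.
apply: (@tends_conv _ _ (\sum_j \sum_a co j a * cis (omega j.2 * s%:R))); last first.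
  apply: tends_sum => j; apply: tends_sum => a; apply: tends_scale.
  apply: (@tends_shift _ (fun M => (expT (omega j.2) M).[(s%:R : R)%:C%C])).
  by move=> d d0; apply: expT_cvg.
rewrite exchange_big /=; apply: eq_bigr => a _.
rewrite /auxg mulr_sumr; apply: eq_bigr => j _.
rewrite /co /hasse exprMn subnDA.
have E := bin_split j.1 t0 a.
have {}E : ('C(j.1, t0)%:R * 'C(j.1 - t0, a)%:R : R[i]) =
           'C(j.1, t0 + a)%:R * 'C(t0 + a, a)%:R by rewrite -!natrM E.
have E1 : forall m : nat, (m%:Z)%:~R = m%:R :> R[i] by [].
rewrite PoszM !intrM !E1 natrX.
move: E; set A := _%:R; set B := _%:R; set A' := _%:R; set B' := _%:R => E.
set s' := s%:R ^+ _; set F := (_`!)%:R^-1.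
transitivity ((A * B) * ((p j)%:~R * (monomial_u t j.2)%:~R * s' * ('i%C ^+ (n - a) * (omega j.2)%:C%C ^+ (n - a) * F) * cis (omega j.2 * s%:R))); first ring.
by rewrite E; ring.
Qed.

Lemma wnorm_auxG t0 t M S1 sg Tt : (S1 <= 2 ^ sg)%N -> (tdeg t <= Tt)%N ->
  wnorm (3 * S1%:R) (auxG t0 t M) <= 2 ^+ (nu + P + L0 * (3 + sg) + l * Tt + 6 * W * S1).
Proof.
move=> les leT; have r0 : 0 <= 3 * S1%:R :> R by rewrite mulr_ge0.
rewrite (le_trans (wnorm_sum _ _ _ r0)) //.
pose B : R := 2 ^+ (P + L0 * (3 + sg) + l * Tt + 6 * W * S1).
apply: (@le_trans _ _ (\sum_(j : 'I_L0 * K) B)); last first.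
  rewrite sumr_const -[_ *+ _]mulr_natl /B -!addnA [in leRHS]exprD.
  rewrite ler_wpM2r ?exprn_ge0 // -natrX ler_nat; exact: nu_le.
apply: ler_sum => j _; rewrite wnormZ -rmorphM nm_int.
apply: (@le_trans _ _ (`|p j * 'C(j.1, t0)%:Z * monomial_u t j.2|%:~R *
   ((3 * S1)%:R ^+ (j.1 - t0) * 4 ^+ (3 * W * S1)))).
  rewrite ler_wpM2l ?ler0z // (le_trans (wnorm_XnM _ _ r0)) // natrM.
  rewrite ler_wpM2l ?exprn_ge0 // wnorm_expT //.
  have -> : (3 * W * S1 = W * (3 * S1))%N by lia.
  by rewrite !natrM ler_wpM2r.
have -> : 4 ^+ (3 * W * S1) = 2 ^+ (6 * W * S1) :> R.
  have -> : (4 : R) = 2 ^+ 2 by lra.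
  by rewrite -exprM; congr (_ ^+ _); lia.
rewrite mulrA /B [in leRHS]exprD ler_wpM2r ?exprn_ge0 //.
have -> : `|p j * 'C(j.1, t0)%:Z * monomial_u t j.2|%:~R * (3 * S1)%:R ^+ (j.1 - t0) =
     (`|p j * (hasse t0 j.1 (3 * S1))%:Z * monomial_u t j.2|%:~R : R).
  rewrite !normrM /hasse PoszM normrM [`|(_ ^ _)%N%:Z|]ger0_norm // !intrM.
  by rewrite -[((_ ^ _)%N%:Z)%:~R]/((_ ^ _)%N%:R) natrX; ring.
rewrite [2 ^+ _](_ : _ = (2 ^ (P + L0 * (3 + sg) + l * Tt))%N%:Z%:~R); last by rewrite -pmulrn natrX.
rewrite ler_int; apply: normzM_le.
  apply: normzM_le => //; rewrite ger0_norm // lez_nat.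
  have -> : (3 + sg = 1 + (sg + 2))%N by lia.
  by apply: hasse_le; rewrite expnD; lia.
by rewrite (le_trans (monomial_u_le _ _)) // lez_nat leq_exp2l // leq_mul2l leT orbT.
Qed.

Definition bnd_f sg Tt := (nu + P + L0 * (1 + sg) + l * Tt + sg)%N.

(* The extrapolation step: auxf vanishes to high order at the integers below S,
   and [auxG], the truncated Taylor polynomial of its analytic interpolation,
   carries this information to the integers below S1. *)
Lemma stage t0 t S S1 Y sg Tt tau s1 :
  (0 < S)%N -> (S <= S1)%N -> (S1 <= 2 ^ sg)%N -> (0 < Y)%N -> (Y <= 2 ^ tau)%N ->
  (t0 + tdeg t + Y <= Tt)%N -> (s1 < S1)%N ->
  (forall t0' t' s, (t0' + tdeg t' < Tt)%N -> (s < S)%N -> auxf t0' t' s = 0) ->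
  nm (auxf t0 t s1) <=
    2 ^+ (bnd_f sg Tt + 6 * Tt + 2 + (2 + tau + sg) * (Y * S)) * eps +
    2 ^+ (nu + P + L0 * (3 + sg) + l * Tt + 6 * W * S1) / 2 ^+ (Y * S).
Proof.
move=> S0 leS leS1 Y0 leY leT lts1 van.
set eta0 : R := 2 ^+ bnd_f sg Tt * eps.
have eta00 : 0 < eta0 by rewrite mulr_gt0 ?exprn_gt0.
have leTt : (tdeg t <= Tt)%N by lia.
have gsm t0' t' s : (t0' + tdeg t' < Tt)%N -> (s < S)%N ->
     nm (auxg t0' (fun k => (monomial_u t' k)%:~R) s) <= eta0.
  move=> lt lts; have := @auxfg t0' t' s sg Tt.
  rewrite (van t0' t' s) // sub0r nmN; apply; last lia.
  by rewrite (leq_trans (ltnW lts)) // (leq_trans leS).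
have gom := auxg_small gsm.
have dlim n s : (n < Y)%N -> (s < S)%N ->
  nm (\sum_(a < n.+1) ('C(t0 + a, a)%:R * ('i%C ^+ (n - a) / (n - a)`!%:R)) *
       auxg (t0 + a) (fun k => (monomial_u t k)%:~R * (omega k)%:C%C ^+ (n - a)) s)
  <= 2 ^+ (6 * Tt) * eta0.
  move=> ltn lts; rewrite (le_trans (nm_sum _ _ _)) //.
  apply: (@le_trans _ _ (\sum_(a < n.+1) 2 ^+ (5 * Tt) * eta0)); last first.
    rewrite sumr_const card_ord -[_ *+ _]mulr_natl mulrA ler_wpM2r ?(ltW eta00) //.
    have -> : (6 * Tt = Tt + 5 * Tt)%N by lia.
    rewrite exprD ler_wpM2r ?exprn_ge0 // -natrX ler_nat.
    by rewrite (leq_trans _ (ltnW (ltn_expl Tt (isT : 1 < 2)%N))) //; lia.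
  apply: ler_sum => a _; have lea : (a <= n)%N by rewrite -ltnS.
  rewrite !nmM nmX nm_i expr1n mul1r nm_nat nmV nm_nat.
  have h1 : nm (auxg (t0 + a) (fun k => (monomial_u t k)%:~R * (omega k)%:C%C ^+ (n - a)) s)
     <= 2 ^+ (4 * Tt) * eta0.
    rewrite (le_trans (gom (n - a)%N _ _ _ _ lts)) //; first lia.
    rewrite ler_wpM2r ?(ltW eta00) //.
    have -> : (16 : R) = 2 ^+ 4 by lra.
    by rewrite -exprM ler_weXn2l //; [lra | lia].
  have h2 : ('C(t0 + a, a)%:R / (n - a)`!%:R : R) <= 2 ^+ Tt.
    rewrite ler_pdivrMr ?ltr0n ?fact_gt0 //.
    apply: (@le_trans _ _ (2 ^+ Tt)); last by rewrite ler_peMr ?exprn_ge0 ?ler1n ?fact_gt0.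
    rewrite -natrX ler_nat (@leq_trans (2 ^ (t0 + a))) //; last by rewrite leq_exp2l //; lia.
    by rewrite -[2%N]/(1 + 1)%N expnDn (bigD1 (inord a)) //= inordK ?ltnS ?leq_addl // !exp1n !muln1 leq_addr.
  have -> : (5 * Tt = Tt + 4 * Tt)%N by lia.
  by rewrite exprD -[X in _ <= X]mulrA ler_pM ?nm_ge0 // divr_ge0.
(* One truncation order serves for the finitely many nodes and orders and for the new point s1. *)
have [M [HM1 HM2]] : exists M, (forall n s, (n < Y)%N -> (s < S)%N ->
    nm ((auxG t0 t M)^`N(n)).[s%:R] <= 2 ^+ (6 * Tt + 1) * eta0) /\
    nm ((auxG t0 t M).[s1%:R] - auxg t0 (fun k => (monomial_u t k)%:~R) s1) <= eta0.
  have H : forall j : 'I_Y * 'I_S, exists M0, forall M, (M0 <= M)%N ->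
     nm ((auxG t0 t M)^`N(j.1)).[(j.2 : nat)%:R] <= 2 ^+ (6 * Tt + 1) * eta0.
    case=> [[n ltn] [s lts]] /=.
    have d0 : 0 < 2 ^+ (6 * Tt) * eta0 by rewrite mulr_gt0 ?exprn_gt0.
    have [M0 HM] := @auxG_tends t0 t n s _ d0; exists M0 => M leM.
    have := dlim n s ltn lts; move: (HM M leM).
    set x := _.[_]; set y := \sum_(a < _) _ => h1 h2.
    have -> : x = (x - y) + y by rewrite subrK.
    rewrite (le_trans (nmD _ _)) // exprD expr1; lra.
  have [M0 HM0] := fin_all_exists H.
  have [M1 HM1] := @auxG_tends t0 t 0 s1 _ eta00.
  exists (maxn (\max_j M0 j) M1); split.
    move=> n s ltn lts; apply: (HM0 (Ordinal ltn, Ordinal lts)).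
    by rewrite (leq_trans _ (leq_maxl _ _)) // leq_bigmax.
  have := HM1 _ (leq_maxr (\max_j M0 j) M1).
  rewrite big_ord_recl big_ord0 addr0 /= addn0 bin0 expr0 fact0 !mul1r invr1 mul1r nderivn0.
  congr (nm (_ - _) <= _); apply: eq_bigr => j _.
  by rewrite subn0 expr0 mulr1.
pose zs : seq R[i] := [seq s%:R | s <- iota 0 S].
have uzs : uniq zs.
  rewrite map_inj_uniq ?iota_uniq // => a b /eqP; rewrite eqr_nat => /eqP //.
pose ys := flatten [seq nseq Y z | z <- zs].
have ysP y : y \in ys -> exists2 s, (s < S)%N & y = s%:R.
  case/flattenP => x /mapP [z /mapP [s sin ->] ->]; rewrite mem_nseq => /andP[_ /eqP->].
  by exists s => //; move: sin; rewrite mem_iota.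
have sys : size ys = (Y * S)%N.
  rewrite size_flatten /shape -map_comp (eq_map (g := fun=> Y)) => [|z]; last by rewrite /= size_nseq.
  have E z' : sumn [seq Y | _ <- z'] = (Y * @size R[i] z')%N.
    by elim: z' => [|? ? IH] /=; rewrite ?muln0 // IH mulnS.
  by rewrite E size_map size_iota.
have nmsub (a b : nat) : nm (a%:R - b%:R : R[i]) = `|a%:Z - b%:Z|%:~R.
  by rewrite -nm_int rmorphB.
have lenat (a b : nat) : (a < S1)%N -> (b < S1)%N -> nm (a%:R - b%:R : R[i]) <= S1%:R.
  move=> la lb; rewrite nmsub -[S1%:R]/((S1%:Z)%:~R) ler_int; lia.
have S11 : 1 <= S1%:R :> R by rewrite ler1n; lia.
(* With nodes of modulus at most S1 and radius 3 S1, each of the Y S nodes gains the factor X / (rho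
   - X) = 1/2. *)
have := @interpolation R (2 ^+ (6 * Tt + 1) * eta0) (auxG t0 t M) ys Y S1%:R (3 * S1%:R) s1%:R.
have -> : (S1%:R / (3 * S1%:R - S1%:R) : R) = 2^-1 by field; lra.
rewrite sys => /(_ _ _ _ Y0) H.
have {}H : nm (auxG t0 t M).[s1%:R] <=
    2 ^+ (6 * Tt + 1) * eta0 * (Y * S)%:R * ((2 * Y)%:R * S1%:R) ^+ (Y * S)
    + 2^-1 ^+ (Y * S) * wnorm (3 * S1%:R) (auxG t0 t M).
  apply: H.
  - by rewrite mulr_ge0 ?exprn_ge0 // ltW.
  - exact: S11.
  - lra.
  - move=> y z /ysP [a lta ->] /ysP [b ltb ->]; rewrite eqr_nat nmsub => ne.
    by rewrite -[1]/((1%:Z)%:~R) ler_int; lia.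
  - by move=> y; rewrite count_flatten_nseq //; case: (_ \in _); rewrite ?mul1n ?mul0n.
  - move=> y /ysP [a lta ->]; rewrite nm_nat ler_nat; split; first lia.
    by apply: lenat => //; lia.
  - by rewrite nm_nat ler_nat ltnW.
  - move=> y n; rewrite count_flatten_nseq //; case: mapP => [[s]|_]; last by rewrite mul0n.
    by rewrite mem_iota mul1n /= => lts -> ltn; apply: HM1.
have fg : nm (auxf t0 t s1 - auxg t0 (fun k => (monomial_u t k)%:~R) s1) <= eta0.
  by apply: auxfg => //; rewrite (leq_trans (ltnW lts1)).
set G1 := (auxG t0 t M).[s1%:R] in H HM2; set g1 := auxg _ _ _ in fg HM2.
have -> : auxf t0 t s1 = (auxf t0 t s1 - g1) - (G1 - g1) + G1 by ring.
rewrite (le_trans (nmD _ _)) // (le_trans (lerD (nmB _ _) H)) //.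
rewrite addrA lerD //; last first.
  rewrite mulrC -exprVn ler_wpM2r ?exprn_ge0 ?invr_ge0 // wnorm_auxG //.
rewrite (le_trans (lerD (lerD fg HM2) (lexx _))) //.
have -> : 2 ^+ (bnd_f sg Tt + 6 * Tt + 2 + (2 + tau + sg) * (Y * S)) * eps =
   eta0 * (2 * 2 ^+ (6 * Tt + 1 + (2 + tau + sg) * (Y * S))).
  rewrite /eta0 -exprS mulrAC -exprD; congr (2 ^+ _ * _); lia.
have -> : eta0 + eta0 + 2 ^+ (6 * Tt + 1) * eta0 * (Y * S)%:R * ((2 * Y)%:R * S1%:R) ^+ (Y * S)
  = eta0 * (2 + 2 ^+ (6 * Tt + 1) * ((Y * S)%:R * ((2 * Y)%:R * S1%:R) ^+ (Y * S))) by ring.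
rewrite ler_wpM2l ?(ltW eta00) //.
have h2 : (2 : R) <= 2 ^+ (6 * Tt + 1 + (2 + tau + sg) * (Y * S)).
  by rewrite -{1}[2]expr1 ler_weXn2l //; [lra | lia].
have h3 : 2 ^+ (6 * Tt + 1) * ((Y * S)%:R * ((2 * Y)%:R * S1%:R) ^+ (Y * S)) <=
   2 ^+ (6 * Tt + 1 + (2 + tau + sg) * (Y * S)) :> R.
  rewrite [in leRHS]exprD ler_wpM2l ?exprn_ge0 //.
  have -> : ((2 + tau + sg) * (Y * S) = Y * S + (1 + tau + sg) * (Y * S))%N by lia.
  rewrite [in leRHS]exprD ler_pM ?exprn_ge0 ?mulr_ge0 //.
    by rewrite -natrX ler_nat ltnW // ltn_expl.
  rewrite [in leRHS]exprM -natrM lerXn2r ?nnegrE ?exprn_ge0 // -natrX ler_nat !expnD expn1.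
  by rewrite leq_mul // leq_mul.
lra.
Qed.

End AuxiliaryFunction.

(** * Choice of the parameters *)

(** Stage j has S0 y^j points with y^8 orders at each. Both the interpolation gain 2^-(y^8 S0 y^j)
    and the assumed smallness 2^-(y^28 S0) of eps must beat the arithmetic lower bound 2^-(N + hinv
    N a), a being the height of the new value. T = 20 y^8 allows 19 stages to spend y^8 orders each
    and leaves y^8. The exponent 28 is 8 + 18 from the last stage and 2 more for a factor of size
    O(y) and the constants. *)
Lemma parameters (N g W l y S0 s0 j d c : nat) :
  (1000 <= d)%N -> c = (16 * 1000)%N -> (d * (d * d) * N ^ 2 * s0.+1 <= y)%N -> (0 < N)%N -> (0 < l)%N ->
  (4000 * N * l <= S0)%N -> (100 * N * (g + N) <= y ^ 7)%N -> (W <= 32 * y ^ 6)%N ->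
  (j < 19)%N ->
  let L0 := (c * N * y ^ 6 * S0)%N in
  let T := (20 * y ^ 8)%N in
  let sg := (s0 + 19 * y)%N in
  let nu := (L0 + 18 * y)%N in
  let P := (1 + nu + L0 * (1 + sg) + 2 * l * T + (g + N) * S0)%N in
  let a := (nu + P + L0 * (1 + sg) + l * T + (g + N) * (S0 * y ^ j.+1))%N in
  (N + hinv N a + 2 + (nu + P + L0 * (3 + sg) + l * T + 6 * W * (S0 * y ^ j.+1))
     <= y ^ 8 * (S0 * y ^ j) /\
   N + hinv N a + 2 + ((nu + P + L0 * (1 + sg) + l * T + sg) + 6 * T + 2
      + (2 + 8 * y + sg) * (y ^ 8 * (S0 * y ^ j))) <= y ^ 28 * S0)%N.
Proof.
have aux1 (u v : nat) : (v <= 20 * u -> 999 < u -> 2 + 8 * u + v <= 29 * u)%N by lia.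
have aux2 (u : nat) : (999 < u -> 300 + 60 * u <= u * u)%N by nia.
have aux3 (h a0 w q lf s t x yq z u : nat) : (0 < u -> h + (a0 + w) <= q -> lf <= a0 ->
   s <= 20 * u -> t <= q * 200 -> x <= 29 * yq -> u <= q -> a0 <= q ->
   300 * q + 60 * yq <= z -> h + (lf + s + t + 2 + x) <= z)%N.
  by lia.
move=> Hd Hc Hy N0 l0 HS Hg HW ltj L0 T sg nu P a.
have [c2 c2E c2d] : exists2 c2, (960 * 1000 <= c2)%N & (d * d = c2)%N.
  by exists (d * d)%N => //; nia.
have d0 : (0 < d)%N by lia.
have c20 : (0 < c2)%N by lia.
rewrite c2d in Hy.
have y0 : (d <= y)%N.
  by apply: leq_trans Hy; rewrite -!mulnA leq_pmulr // !muln_gt0 ?expn_gt0 ?N0 ?c20.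
have y1 : (1000 <= y)%N by apply: leq_trans y0.
have c2y : (c2 <= y)%N.
  by apply: leq_trans Hy; rewrite mulnAC [(d * c2)%N]mulnC -!mulnA leq_pmulr // !muln_gt0 ?expn_gt0 ?N0 ?d0.
have s0y : (s0.+1 <= y)%N.
  by apply: leq_trans Hy; rewrite leq_pmull // !muln_gt0 ?expn_gt0 ?N0 ?c20 ?d0.
have NNy : (N * N <= y)%N.
  apply: leq_trans Hy; rewrite expnS expn1 mulnAC leq_pmull // !muln_gt0.
  by rewrite c20 d0.
set z := (y ^ 6)%N; set Q := (y ^ 8 * S0)%N.
have zE : (y ^ 8 = z * (y * y))%N by rewrite /z !expnS; ring.
have z7 : (y ^ 7 = z * y)%N by rewrite /z !expnS; ring.
have z0 : (y <= z)%N by rewrite /z expnS leq_pmulr // expn_gt0; lia.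
have S00 : (0 < S0)%N.
  by apply: leq_trans HS; rewrite !muln_gt0 N0 l0.
have F1 : (c2 * (N * N) * (10 + 2 * s0 + 38 * y) <= y * y)%N.
  have : (c2 * (N * N) * (10 + 2 * s0 + 38 * y) <= c2 * (N * N) * (d * s0.+1 * y))%N.
    rewrite leq_mul2l; apply/orP; right.
    apply: (@leq_trans (50 * s0.+1 * y)); first nia.
    by rewrite !leq_mul //; lia.
  move/leq_trans; apply.
  apply: (@leq_trans ((d * c2 * N ^ 2 * s0.+1) * y)); last by rewrite leq_mul2r Hy orbT.
  by rewrite leq_eqVlt; apply/orP; left; apply/eqP; rewrite expnS expn1; ring.
have F1' : (10 * (6 * N * (L0 * (10 + 2 * sg))) <= Q)%N.
  have -> : (10 * (6 * N * (L0 * (10 + 2 * sg))) = z * S0 * ((60 * c) * (N * N) * (10 + 2 * s0 + 38 * y)))%N.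
    by rewrite /L0 /sg -/z; ring.
  have -> : Q = (z * S0 * (y * y))%N by rewrite /Q zE; ring.
  rewrite leq_mul2l; apply/orP; right; apply: leq_trans F1.
  rewrite !leq_mul2r; apply/orP; right; apply/orP; right; rewrite Hc; lia.
have F2 : (10 * (6 * N * (3 * l * T)) <= Q)%N.
  have -> : (10 * (6 * N * (3 * l * T)) = y ^ 8 * (3600 * N * l))%N by rewrite /T; ring.
  by rewrite /Q leq_mul2l; apply/orP; right; apply: leq_trans HS; rewrite !leq_mul.
have F3 : (10 * (6 * N * ((g + N) * S0)) <= Q)%N.
  have -> : (10 * (6 * N * ((g + N) * S0)) = (60 * N * (g + N)) * S0)%N by ring.
  rewrite /Q leq_mul2r; apply/orP; right.
  apply: (@leq_trans (y ^ 7)); last by rewrite leq_exp2l //; lia.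
  by apply: leq_trans Hg; rewrite !leq_mul.
have zzQ : (y * y * y <= Q)%N.
  rewrite /Q zE; apply: (@leq_trans (z * (y * y))); last by rewrite leq_pmulr.
  by rewrite -[(y * y * y)%N]mulnA leq_mul2r z0 orbT.
have F4 : (10 * (6 * N * (36 * y + 1) + 20 * (N * N)) <= Q)%N.
  apply: leq_trans zzQ.
  have Ny : (N <= y)%N by apply: leq_trans NNy; rewrite leq_pmulr.
  have NNyy : (N * y <= y * y)%N by rewrite leq_mul2r Ny orbT.
  have yyy : (c2 * (y * y) <= y * y * y)%N by rewrite mulnC leq_mul2l c2y orbT.
  have yyc : (4000 * (y * y) <= c2 * (y * y))%N by rewrite leq_mul2r; apply/orP; right; lia.
  have ylt : (y <= y * y)%N by rewrite leq_pmulr //; lia.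
  rewrite [(6 * N * (36 * y + 1))%N](_ : _ = 216 * (N * y) + 6 * N)%N; last by ring.
  lia.
set A0 := (nu + P + L0 * (3 + sg) + l * T)%N.
have A0le : (A0 <= L0 * (10 + 2 * sg) + (36 * y + 1) + 3 * l * T + (g + N) * S0)%N.
  by rewrite /A0 /P /nu; lia.
have F5 : (10 * (6 * N * A0 + 20 * (N * N)) <= 4 * Q)%N.
  have : (6 * N * A0 <= 6 * N * (L0 * (10 + 2 * sg)) + 6 * N * (36 * y + 1) + 6 * N * (3 * l * T) + 6 * N * ((g + N) * S0))%N.
    by rewrite -!mulnDr leq_mul2l A0le orbT.
  lia.
set Sj := (S0 * y ^ j)%N; have SjE : (S0 * y ^ j.+1 = y * Sj)%N by rewrite /Sj expnS; ring.
have QSj : (Q <= y ^ 8 * Sj)%N.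
  by rewrite /Q /Sj leq_mul2l leq_pmulr ?orbT // expn_gt0; lia.
have F6 : (20 * ((5 * N * (g + N) + 6 * W) * (y * Sj)) <= 2 * (y ^ 8 * Sj))%N.
  have -> : (20 * ((5 * N * (g + N) + 6 * W) * (y * Sj)) = (20 * (5 * N * (g + N) + 6 * W)) * y * Sj)%N by ring.
  rewrite [in leqRHS]mulnA leq_mul2r; apply/orP; right.
  have -> : (2 * y ^ 8 = 2 * (z * y) * y)%N by rewrite zE; ring.
  rewrite leq_mul2r; apply/orP; right; rewrite -z7 mulnDr.
  have : (20 * (6 * W) <= y ^ 7)%N.
    rewrite z7; apply: (@leq_trans (z * 4000)); first by rewrite /z; lia.
    by rewrite leq_mul2l; apply/orP; right; lia.
  lia.
have aE : (a <= A0 + (g + N) * (y * Sj))%N by rewrite /a /A0 SjE; lia.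
have hE : (N + hinv N a + 2 <= 5 * N * A0 + 5 * N * ((g + N) * (y * Sj)) + 20 * (N * N))%N.
  have : (N * a <= N * (A0 + (g + N) * (y * Sj)))%N by rewrite leq_mul2l aE orbT.
  have NA : (a <= N * a)%N by rewrite leq_pmull.
  have NN : (N <= N * N)%N by rewrite leq_pmull.
  have -> : hinv N a = (4 * (N * N) + 4 * (N * a) + 4 * N + a + 3)%N by rewrite /hinv; ring.
  have -> : (5 * N * A0 + 5 * N * ((g + N) * (y * Sj)) = 5 * (N * (A0 + (g + N) * (y * Sj))))%N by ring.
  lia.
have G1 : (N + hinv N a + 2 + (A0 + 6 * W * (y * Sj)) <= y ^ 8 * Sj)%N.
  have : (A0 <= N * A0)%N by rewrite leq_pmull.
  have : (5 * N * ((g + N) * (y * Sj)) + 6 * W * (y * Sj) = (5 * N * (g + N) + 6 * W) * (y * Sj))%N by ring.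
  lia.
split; first by rewrite SjE.
have F7 : (y ^ 8 * Sj <= y ^ 26 * S0)%N.
  rewrite /Sj mulnCA -expnD mulnC leq_mul2r leq_exp2l; lia.
have A0Q : (A0 <= y ^ 26 * S0)%N.
  by apply: leq_trans F7; lia.
have TQ : (6 * T <= y ^ 26 * S0 * 200)%N.
  have Y8 : (y ^ 8 <= y ^ 26 * S0)%N.
    apply: (@leq_trans (y ^ 26)); first by rewrite leq_exp2l; lia.
    by rewrite leq_pmulr.
  rewrite /T; move: Y8; move: (y ^ 8)%N (y ^ 26 * S0)%N => x8 x26; clear; lia.
have sgy : (sg <= 20 * y)%N by rewrite /sg; lia.
have B1 : ((2 + 8 * y + sg) * (y ^ 8 * Sj) <= 29 * y * (y ^ 26 * S0))%N.
  by apply: leq_mul => //; apply: aux1.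
have y1' : (1 < y)%N by apply: leq_trans y1.
have yQ : (y <= y ^ 26 * S0)%N.
  rewrite -[X in (X <= _)%N]muln1; apply: leq_mul => //.
  by rewrite -{1}[y]expn1 leq_exp2l.
have -> : (y ^ 28 * S0 = y * y * (y ^ 26 * S0))%N.
  by rewrite mulnA [(y ^ 28)%N]expnS [(y ^ 27)%N]expnS mulnA.
set q := (y ^ 26 * S0)%N in F7 A0Q TQ B1 yQ *.
have yy : (300 * q + 60 * (y * q) <= y * y * q)%N.
  by rewrite mulnA -mulnDl leq_mul2r; apply/orP; right; apply: aux2.
have LA : (nu + P + L0 * (1 + sg) + l * T <= A0)%N.
  by rewrite /A0 leq_add2r leq_add2l leq_mul2l leq_add2r orbT.
have E29 : (29 * y * q = 29 * (y * q))%N by rewrite mulnA.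
rewrite E29 in B1.
have F8 := leq_trans G1 F7.
exact: (aux3 _ _ _ _ _ _ _ _ _ _ _ (ltnW y1') F8 LA sgy TQ B1 yQ A0Q yy).
Qed.

(** Each of the two terms of the upper bound is at most a quarter of the lower bound. *)
Lemma pow2_contra (R : realFieldType) (a z1 v z2 w : nat) (x eps : R) :
  (2 ^+ a)^-1 <= x -> x <= 2 ^+ z1 * eps + 2 ^+ z2 / 2 ^+ w ->
  (a + 2 + z2 <= w)%N -> (a + 2 + z1 <= v)%N -> eps <= (2 ^+ v)^-1 -> False.
Proof.
move=> le1 le2 lew lev leeps.
have p2 n : 0 < (2 ^+ n : R) by rewrite exprn_gt0.
have key n m : (a + 2 + n <= m)%N -> 2 ^+ n / 2 ^+ m <= (2 ^+ a)^-1 / 4 :> R.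
  move=> le; rewrite ler_pdivrMr // -(subnK le) !exprD.
  have -> : (2 ^+ a)^-1 / 4 * (2 ^+ (m - (a + 2 + n)) * (2 ^+ a * 2 ^+ 2 * 2 ^+ n))
     = 2 ^+ (m - (a + 2 + n)) * 2 ^+ n * ((2 ^+ a)^-1 * 2 ^+ a) :> R by field; rewrite gt_eqF.
  rewrite mulVf ?gt_eqF // mulr1 ler_peMl ?(ltW (p2 _)) //.
  by rewrite -natrX ler1n expn_gt0.
have h1 := key _ _ lew; have h2 := key _ _ lev.
have h3 : 2 ^+ z1 * eps <= 2 ^+ z1 / 2 ^+ v by rewrite ler_wpM2l ?(ltW (p2 _)).
have h4 : 0 < (2 ^+ a)^-1 :> R by rewrite invr_gt0.
lra.
Qed.

Section Baker.
Variables (R : realType) (I : finType) (e : I -> R[i]).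
Variables (r : nat) (K' : finType) (y : nat).
Let L := (y ^ 6)%N.
(** Several frequencies share one base: in the applications the second component counts multiples of
    2 pi, which [cis] does not see but the integers [u i0] do. *)
Let K : finType := (K' * 'I_L)%type.
Variables (beta : K' -> R[i]) (B : K' -> I -> I -> int) (D : int) (g : nat).
Variables (u : 'I_r -> K -> int) (c : 'I_r -> R) (i0 : 'I_r).
Variables (eps : R) (l S0 s0 d : nat).
Let omega k : R := \sum_i c i * (u i k)%:~R.
Let N := #|I|.
Hypotheses (e0 : exists i, e i != 0) (r2 : (r <= 2)%N) (eps0 : 0 < eps) (l0 : (0 < l)%N).
Hypotheses (cardK' : #|K'| = (L ^ r)%N) (beta_inj : injective beta).
Hypotheses (beta1 : forall k, nm (beta k) = 1).
Hypotheses (D0 : D != 0) (D_le : `|D| <= (2 ^ g)%N%:Z).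
Hypotheses (B_le : forall k, ible (B k) g) (BE : forall k, acts e (B k) (D%:~R * beta k)).
Hypotheses (u_le : forall i k, `|u i k| <= (2 ^ l)%N%:Z).
Hypotheses (u_inj : forall k', injective (fun m => u i0 (k', m))).
Hypotheses (c_le : forall i, `|c i| <= 8).
Hypotheses (omega_le : forall k, `|omega k| <= (32 * L)%:R).
Hypotheses (betaE : forall k, nm (beta k.1 - cis (omega k)) <= eps).
Hypotheses (d_ge : (1000 <= d)%N) (y_ge : (d * (d * d) * N ^ 2 * s0.+1 <= y)%N).
Hypotheses (S0_ge : (4000 * N * l <= S0)%N) (S0_le : (S0 <= 2 ^ s0)%N).
Hypotheses (g_le : (100 * N * (g + N) <= y ^ 7)%N).

Let r1 : (0 < r)%N. Proof. exact: leq_ltn_trans (leq0n i0) (ltn_ord i0). Qed.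
Let N0 : (0 < N)%N. Proof. by have [i _] := e0; apply/card_gt0P; exists i. Qed.
Let y0 : (0 < y)%N.
Proof.
have d0 : (0 < d)%N by apply: leq_trans d_ge.
by apply: leq_trans y_ge; rewrite !muln_gt0 ?expn_gt0 ?N0 ?d0.
Qed.
Let S00 : (0 < S0)%N.
Proof. by apply: leq_trans S0_ge; rewrite !muln_gt0 N0 l0. Qed.

(* Nineteen extrapolations: small values vanish by [rep_ge], so each one multiplies
   the number of zeros by y, until [exp_poly_vanish] kills the coefficients. *)
Lemma baker_contra : ~ (eps <= (2 ^+ (y ^ 28 * S0))^-1).
Proof.
move=> eps_le.
(* 16000 is twice 20^3. Since T = 20 y^2 L and r is at most 2, there are at most (20 y^2)^3 L^(r+1)
   S0 N equations, half the number of unknowns. *)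
have [cc ccE] : exists cc, cc = (16 * 1000)%N by eexists.
set L0 := (cc * N * y ^ 6 * S0)%N.
set T := (20 * y ^ 8)%N.
set sg := (s0 + 19 * y)%N.
set nu := (L0 + 18 * y)%N.
set P := (1 + nu + L0 * (1 + sg) + 2 * l * T + (g + N) * S0)%N.
have leLy : (L <= 2 ^ (6 * y))%N.
  by rewrite /L mulnC expnM leq_exp2r // ltnW // ltn_expl.
have cardJ : #|{: 'I_L0 * K}| = (L0 * (L ^ r * L))%N.
  by rewrite !card_prod !card_ord cardK'.
have nu_le : (#|{: 'I_L0 * K}| <= 2 ^ nu)%N.
  rewrite cardJ /nu expnD leq_mul //; first by rewrite ltnW // ltn_expl.
  apply: (@leq_trans (2 ^ (12 * y) * 2 ^ (6 * y))); last by rewrite -expnD leq_exp2l //; lia.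
  rewrite leq_mul // (@leq_trans ((2 ^ (6 * y)) ^ r)) //; first by rewrite leq_exp2r.
  by rewrite -expnM leq_exp2l //; nia.
pose E : finType := ('I_T * {ffun 'I_r -> 'I_T} * 'I_S0 * I)%type.
have [j0 ej0] := e0.
pose ent (x : E) (j : 'I_L0 * K) : int :=
  (hasse x.1.1.1 j.1 x.1.2)%:Z * monomial_u u (fun i => x.1.1.2 i : nat) j.2 *
  ipow (B j.2.1) x.1.2 j0 x.2.
have S0sg : (S0 <= 2 ^ sg)%N.
  by rewrite (leq_trans S0_le) // leq_exp2l // leq_addr.
have ent_le x j : `|ent x j| <= (2 ^ (L0 * (1 + sg) + 2 * l * T + (g + N) * S0))%N%:Z.
  rewrite /ent; apply: normzM_le; first apply: normzM_le.
  - rewrite ger0_norm // lez_nat hasse_le //.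
    by rewrite (leq_trans (ltnW (ltn_ord _))).
  - rewrite (le_trans (monomial_u_le u_le _ _)) // lez_nat leq_exp2l // mulnC.
    rewrite -mulnA [(l * T)%N]mulnC mulnA leq_mul2r; apply/orP; right.
    apply: (@leq_trans (r * T)); last by rewrite leq_mul2r r2 orbT.
    rewrite /tdeg -[X in (_ <= X * _)%N](card_ord r) -sum_nat_const leq_sum // => i _.
    by rewrite ltnW.
  - apply: ible_mono (ible_pow _ (B_le _)) _ _.
    by rewrite mulnC [(#|I| + g)%N]addnC leq_mul2l ltnW ?orbT.
have cardE : (2 * #|E| <= #|{: 'I_L0 * K}|)%N.
  rewrite cardJ !card_prod card_ffun !card_ord -/N /L0 ccE.
  have -> : (T = 20 * (y * y) * L)%N by rewrite /T /L !expnS; ring.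
  set q := (20 * (y * y))%N; rewrite expnMn.
  have qr : (2 * (q * q ^ r) <= 16 * 1000 * y ^ 6)%N.
    apply: (@leq_trans (2 * (q * q ^ 2))).
      rewrite leq_mul2l leq_mul2l; apply/orP; right; apply/orP; right.
      by rewrite leq_pexp2l // /q !muln_gt0 y0.
    by rewrite /q !expnS expn0; lia.
  have -> : (2 * (q * L * (q ^ r * L ^ r) * S0 * N) = (2 * (q * q ^ r)) * (N * S0 * (L ^ r * L)))%N by ring.
  have -> : (16 * 1000 * N * y ^ 6 * S0 * (L ^ r * L) = (16 * 1000 * y ^ 6) * (N * S0 * (L ^ r * L)))%N by ring.
  by rewrite leq_mul2r qr orbT.
have E0 : (0 < #|E|)%N.
  apply/card_gt0P.
  have T0 : (0 < T)%N by rewrite /T muln_gt0 expn_gt0 y0.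
  by exists (Ordinal T0, [ffun=> Ordinal T0], Ordinal S00, j0).
have [|p [[j1 pj1] p_le prel]] := @siegel _ E ent _ E0 cardE _ ent_le.
  by rewrite expn_gt0.
have {}p_le j : `|p j| <= (2 ^ P)%N%:Z.
  rewrite (le_trans (p_le j)) // lez_nat.
  rewrite (_ : P = (1 + nu + (L0 * (1 + sg) + 2 * l * T + (g + N) * S0)))%N; last by rewrite /P; lia.
  by rewrite [in leqRHS]expnD leq_mul // expnD expn1 leq_mul2l nu_le orbT.
pose f := auxf (fun k : K => beta k.1) u p.
have base t0 t s : (t0 + tdeg t < T)%N -> (s < S0)%N -> f t0 t s = 0.
  move=> ltT lts.
  have tT i : (t i < T)%N.
    by apply: leq_trans ltT; rewrite ltnS (leq_trans _ (leq_addl _ _)) // /tdeg (bigD1 i) //= leq_addr.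
  have t0T : (t0 < T)%N by apply: leq_trans ltT; rewrite ltnS leq_addr.
  have H a : \sum_j (p j * (hasse t0 j.1 s)%:Z * monomial_u u t j.2) * ipow (B j.2.1) s j0 a = 0.
    rewrite -[RHS](prel (Ordinal t0T, [ffun i => Ordinal (tT i)], Ordinal lts, a)).
    apply: eq_bigr => j _; rewrite /ent /=.
    have -> : monomial_u u (fun i => [ffun i => Ordinal (tT i)] i : nat) j.2 = monomial_u u t j.2.
      by apply: eq_bigr => i _; rewrite ffunE.
    by rewrite mulrC !mulrA; ring.
  have : (D%:~R ^+ s * f t0 t s) * e j0 = 0.
    rewrite /f /auxf mulr_sumr mulr_suml.
    have E1 (j : 'I_L0 * K) : D%:~R ^+ s * ((p j * (hasse t0 j.1 s)%:Z * monomial_u u t j.2)%:~R * beta j.2.1 ^+ s) * e j0 =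
       \sum_a ((p j * (hasse t0 j.1 s)%:Z * monomial_u u t j.2) * ipow (B j.2.1) s j0 a)%:~R * e a.
      have := acts_pow s (BE j.2.1) j0; rewrite exprMn.
      move=> E1; transitivity ((p j * (hasse t0 j.1 s)%:Z * monomial_u u t j.2)%:~R * (D%:~R ^+ s * beta j.2.1 ^+ s * e j0)).
        by ring.
      by rewrite E1 mulr_sumr; apply: eq_bigr => a _; rewrite [in RHS]intrM mulrA.
    rewrite (eq_bigr _ (fun j _ => E1 j)) exchange_big big1 //= => a _.
    by rewrite -mulr_suml -rmorph_sum /= H mul0r.
  move/eqP; rewrite !mulf_eq0 (negPf ej0) orbF expf_eq0 intr_eq0 (negPf D0) andbF /=.
  by move/eqP.
have step j : (j <= 19)%N -> forall t0 t s, (t0 + tdeg t < (20 - j) * y ^ 8)%N ->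
    (s < S0 * y ^ j)%N -> f t0 t s = 0.
  elim: j => [|j IH] lej t0 t s ltT lts.
    by apply: base; rewrite ?subn0 // in ltT *; rewrite expn0 muln1 in lts.
  have {IH} van := IH (ltnW lej).
  apply/eqP; rewrite -[_ == _]negbK; apply/negP => f0.
  have [par1 par2] := @parameters N g (32 * L) l y S0 s0 j d cc d_ge ccE y_ge N0 l0 S0_ge g_le (leqnn _) lej.
  have Y8 : (0 < y ^ 8)%N by rewrite expn_gt0 y0.
  have leTT : ((20 - j) * y ^ 8 <= T)%N by rewrite /T leq_mul2r leq_subr orbT.
  have lest := @stage R r K L0 (fun k => beta k.1) u c eps l (32 * L) r2 eps0
     (fun k => beta1 k.1) u_le c_le omega_le betaE p P nu p_le nu_le
     t0 t (S0 * y ^ j)%N (S0 * y ^ j.+1)%N (y ^ 8) sg ((20 - j) * y ^ 8)%N (8 * y) s.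
  have Ssg : (S0 * y ^ j.+1 <= 2 ^ sg)%N.
    rewrite /sg expnD leq_mul // (@leq_trans (y ^ 19)) // ?leq_pexp2l //.
    by rewrite mulnC expnM leq_exp2r // ltnW // ltn_expl.
  have {lest} := lest _ _ Ssg Y8 _ _ lts van.
  rewrite muln_gt0 S00 expn_gt0 y0 leq_mul2l leq_pexp2l // orbT => /(_ isT isT).
  have -> : (y ^ 8 <= 2 ^ (8 * y))%N by rewrite mulnC expnM leq_exp2r // ltnW // ltn_expl.
  have -> : (t0 + tdeg t + y ^ 8 <= (20 - j) * y ^ 8)%N.
    have -> : (20 - j = (20 - j.+1).+1)%N by clear -lej; lia.
    by rewrite mulSn addnC leq_add2l ltnW.
  move=> /(_ isT isT) lest.
  set Z1 := (_ + _ * _)%N in lest; set Z2 := (_ + _ * _)%N in lest.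
  have rf : rep e (nu + P + L0 * (1 + sg) + l * T + (g + N) * (S0 * y ^ j.+1)) (f t0 t s).
    exists (D ^+ s), (fun i a => \sum_j (p j * (hasse t0 j.1 s)%:Z * monomial_u u t j.2) * ipow (B j.2.1) s i a).
    split.
    - by rewrite expf_neq0.
    - rewrite normrX (@le_trans _ _ ((2 ^ g)%N%:Z ^+ s)) ?lerXn2r ?nnegrE //.
      rewrite -rmorphXn /= natrXE lez_nat -expnM leq_exp2l //.
      apply: (@leq_trans ((g + N) * (S0 * y ^ j.+1))); last by rewrite leq_addl.
      by rewrite leq_mul ?leq_addr // ltnW.
    - move=> i a.
      rewrite (_ : (nu + P + L0 * (1 + sg) + l * T + (g + N) * (S0 * y ^ j.+1) = nu + (P + L0 * (1 + sg) + l * T + (g + N) * (S0 * y ^ j.+1)))%N); last by lia.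
      apply: ible_sum => // k; apply: normzM_le.
        apply: normzM_le; first apply: normzM_le => //.
          by rewrite ger0_norm // lez_nat hasse_le // (leq_trans (ltnW lts)).
        rewrite (le_trans (monomial_u_le u_le _ _)) // lez_nat leq_exp2l // leq_mul2l.
        apply/orP; right; apply: leq_trans leTT.
        apply: (@leq_trans ((20 - j.+1) * y ^ 8)); last by rewrite leq_mul2r leq_sub2l ?orbT.
        by rewrite (leq_trans _ (ltnW ltT)) // leq_addl.
      apply: ible_mono (ible_pow _ (B_le _)) _ _.
      by rewrite mulnC [(#|I| + g)%N]addnC leq_mul2l ltnW ?orbT.
    - rewrite /f /auxf mulr_sumr.
      apply: (acts_sum (A := fun j i a => (p j * (hasse t0 j.1 s)%:Z * monomial_u u t j.2) * ipow (B j.2.1) s i a)) => k.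
      rewrite mulrCA rmorphXn /= -exprMn.
      by apply: acts_scale; apply: acts_pow; apply: BE.
  have lb := rep_ge e0 f0 rf.
  apply: (pow2_contra lb lest _ _ eps_le).
  - apply: leq_trans par1; rewrite leq_add2l /Z2 leq_add2r leq_add2l leq_mul2l leTT orbT //.
  - apply: leq_trans par2; rewrite leq_add2l /Z1 /bnd_f !leq_add2r; apply: leq_add.
    by rewrite leq_add2r leq_add2l leq_mul2l leTT orbT.
    by rewrite leq_mul2l leTT orbT.
(* The zeros below S0 y^19 exceed the L0 L^r required by [exp_poly_vanish], and the y^8 orders that
   remain exceed the L power sums in [u i0] that separate the coefficients over one base. *)
have vanish l0' k' m : p (l0', (k', m)) = 0.
  have coef tau (ltau : (tau < L)%N) : \sum_(m : 'I_L) (p (l0', (k', m)))%:~R * ((u i0 (k', m))%:~R : R[i]) ^+ tau = 0.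
    pose t (i : 'I_r) := (if i == i0 then tau else 0)%N.
    have tdt : tdeg t = tau.
      rewrite /tdeg (bigD1 i0) //= /t eqxx big1 ?addn0 // => i /negPf->//.
    have mont k : monomial_u u t k = u i0 k ^+ tau.
      rewrite /monomial_u (bigD1 i0) //= /t eqxx big1 ?mulr1 // => i /negPf->//.
    have := @exp_poly_vanish _ K' beta L0 (fun l1 k1 => \sum_(m : 'I_L) (p (l1, (k1, m)))%:~R * ((u i0 (k1, m))%:~R : R[i]) ^+ tau) beta_inj.
    apply.
      by move=> k; rewrite -nm_eq0 beta1 oner_eq0.
    move=> s lts; rewrite -[RHS](step 19%N (leqnn _) 0%N t s).
    - rewrite /f /auxf.
      rewrite [RHS](eq_bigr (fun j : 'I_L0 * K => (p (j.1, j.2))%:~R * (u i0 j.2)%:~R ^+ tau * s%:R ^+ j.1 * beta j.2.1 ^+ s)).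
        rewrite -(pair_bigA _ (fun l1 k => (p (l1, k))%:~R * (u i0 k)%:~R ^+ tau * s%:R ^+ l1 * beta k.1 ^+ s)) /=.
        rewrite exchange_big /=; apply: eq_bigr => l1 _.
        under eq_bigr => k1 _ do rewrite !mulr_suml.
        by rewrite pair_bigA; apply: eq_bigr => -[k1 m1] _.
      case=> l1 k _ /=; congr (_ * _).
      have E1 (q : nat) : (q%:Z)%:~R = q%:R :> R[i] by [].
      have -> : hasse 0 l1 s = (s ^ l1)%N by rewrite /hasse bin0 mul1n subn0.
      by rewrite mont !intrM E1 natrX rmorphXn /=; ring.
    - rewrite add0n tdt mul1n (leq_trans ltau) // leq_pexp2l //.
    - apply: (leq_trans lts); rewrite cardK'.
      apply: (@leq_trans (L0 * L ^ 2)); first by rewrite leq_mul2l leq_pexp2l ?orbT // expn_gt0 y0.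
      have -> : (L0 * L ^ 2 = (cc * N) * (S0 * y ^ 18))%N.
        by rewrite /L0 /L -expnM (_ : y ^ 18 = y ^ 6 * y ^ (6 * 2))%N ?expnD //; ring.
      have -> : (S0 * y ^ 19 = y * (S0 * y ^ 18))%N by rewrite expnS; ring.
      rewrite leq_mul2r; apply/orP; right; apply: leq_trans y_ge.
      have -> : (d * (d * d) * N ^ 2 * s0.+1 = (d * (d * d) * N * s0.+1) * N)%N by rewrite expnS expn1; ring.
      rewrite leq_mul2r; apply/orP; right.
      apply: (@leq_trans (d * (d * d))); first by rewrite ccE; nia.
      by rewrite -mulnA leq_pmulr // muln_gt0 N0.
  have inj : injective (fun m : 'I_L => ((u i0 (k', m))%:~R : R[i])).
    by move=> m1 m2 /eqP; rewrite eqr_int => /eqP /u_inj.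
  have := power_sums_vanish inj coef m => /eqP.
  by rewrite intr_eq0 => /eqP.
by case: j1 pj1 => l1 [k1 m1]; rewrite vanish eqxx.
Qed.

End Baker.

(** * Lower bounds for the distance of powers of gamma from a point *)

Section CircleMod.
Variable R : realType.
Implicit Types (x : R) (z w : R[i]).

Lemma cis_eq1 x : cis x = 1 -> exists m : int, x = 2 * pi * m%:~R.
Proof.
move=> x1; have p0 := @pi_gt0 R.
have p2 : 0 < 2 * pi :> R by lra.
exists (Num.floor (x / (2 * pi))).
set m : R := _%:~R; pose x' := x - 2 * pi * m.
have /andP[m1 m2] := real_floor_itv (num_real (x / (2 * pi))).
rewrite ler_pdivlMr // -/m in m1.
rewrite ltr_pdivrMr // intrD -/m in m2.
have c1 : cis x' = 1 by rewrite cisB x1 /m cis2piz divr1.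
have [cx sx] : cos x' = 1 /\ sin x' = 0 by case: c1.
suff : x' = 0 by rewrite /x'; lra.
have x0 : 0 <= x' by rewrite /x'; lra.
have x2 : x' < 2 * pi by rewrite /x'; lra.
have [lt|gt|xpi] := ltgtP x' pi.
- apply/eqP; rewrite eq_le x0 andbT leNgt; apply/negP => gt0.
  by have := @sin_gt0_pi R x'; rewrite gt0 lt sx ltxx => /(_ isT).
- have := @sin_gt0_pi R (x' - pi); rewrite sinB cospi sinpi sx mul0r mulr0 subr0 ltxx.
  by move=> H; have : false by apply: H; apply/andP; split; lra.
- by move: cx; rewrite xpi cospi; lra.
Qed.

Lemma pi2_le8 : 2 * pi <= 8 :> R.
Proof. have := @pihalf_lt2 R; lra. Qed.

Lemma pi2_ge4 : 4 <= 2 * pi :> R.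
Proof. have := @pi_ge2 R; lra. Qed.

End CircleMod.

Lemma exponent_bound1 L y l k : (L <= 2 ^ (6 * y) -> k <= 2 ^ l ->
  L * (2 * k + 4) <= 2 ^ (l + 12 * y + 5))%N.
Proof.
move=> leL lek; have -> : (l + 12 * y + 5 = 6 * y + (l + 6 * y + 5))%N by ring.
rewrite expnD leq_mul // (@leq_trans (2 ^ (l + 3))) //; last first.
  by rewrite leq_exp2l // leq_add // leq_addr.
by rewrite expnD; have := expn_gt0 2 l; move: (2 ^ l)%N lek => p; lia.
Qed.

Lemma exponent_bound2 L y l q : (L <= 2 ^ (6 * y) -> 0 < q -> q <= 2 ^ (l + 6 * y + 1) ->
  L * (3 * q + 1) <= 2 ^ (l + 12 * y + 5))%N.
Proof.
move=> leL q0 leq; have -> : (l + 12 * y + 5 = 6 * y + (4 + (l + 6 * y + 1)))%N by ring.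
by rewrite expnD leq_mul // expnD; apply: (@leq_trans (4 * q)); [lia | rewrite leq_mul].
Qed.

Lemma int_bound1 (a b : int) (k L : nat) : a <= L%:Z -> b <= ((2 * k + 3) * L)%N%:Z ->
  a + b <= (L * (2 * k + 4))%N%:Z.
Proof. have -> : (L * (2 * k + 4) = L + (2 * k + 3) * L)%N by ring.
by lia. Qed.

Lemma int_bound2 (a b : int) (q L : nat) : a <= ((2 * q + 1) * L)%N%:Z -> b <= (q * L)%N%:Z ->
  a + b <= (L * (3 * q + 1))%N%:Z.
Proof. have -> : (L * (3 * q + 1) = (2 * q + 1) * L + q * L)%N by ring.
by lia. Qed.

Lemma rev_index b i : (i < b -> b.-1 - (b - i.+1) = i)%N.
Proof. lia. Qed.

Lemma nat_bound (a b k L : nat) : (a <= L -> b <= L -> a + k * b <= L * (2 * k + 4))%N.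
Proof.
move=> la lb; have -> : (L * (2 * k + 4) = L + k * L + (3 + k) * L)%N by ring.
by rewrite (@leq_trans (L + k * L)) ?leq_addr // leq_add // leq_mul2l lb orbT.
Qed.

Section BakerBound.
Variables (R : realType) (I : finType) (e : I -> R[i]) (h : nat) (gam alp : R[i]).
Hypotheses (e0 : exists i, e i != 0) (gam1 : nm gam = 1) (alp1 : nm alp = 1).
Hypotheses (rg : rep e h gam) (ra : rep e h alp).
Hypothesis gam_free : forall n, (0 < n)%N -> gam ^+ n <> 1.
Let N := #|I|.
Variables (y l s0 d S0 : nat).
Hypotheses (d_ge : (1000 <= d)%N) (y_ge : (d * (d * d) * N ^ 2 * s0.+1 <= y)%N).
Hypotheses (y_ge2 : (400 * N * (N + h) <= y)%N).
Hypotheses (S0E : (S0 = 4000 * N * (l + 12 * y + 5))%N) (S0_le : (S0 <= 2 ^ s0)%N).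
Let L := (y ^ 6)%N.

Let N0 : (0 < N)%N. Proof. by have [i _] := e0; apply/card_gt0P; exists i. Qed.
Let y0 : (0 < y)%N.
Proof.
have d0 : (0 < d)%N by apply: leq_trans d_ge.
by apply: leq_trans y_ge; rewrite !muln_gt0 ?expn_gt0 ?N0 ?d0.
Qed.
Let Ly : (L <= 2 ^ (6 * y))%N.
Proof. by rewrite /L mulnC expnM leq_exp2r // ltnW // ltn_expl. Qed.

(** The auxiliary function wants one denominator for all products with exponents below L: the L-th
    power of the product of the two denominators. *)
Lemma power_matrices : exists D : int, exists B : nat -> nat -> I -> I -> int,
  let g := (2 * L * (N + h) + N)%N in
  [/\ D != 0, `|D| <= (2 ^ g)%N%:Z &
      forall a b, (a < L)%N -> (b < L)%N ->
        ible (B a b) g /\ acts e (B a b) (D%:~R * (gam ^+ a * alp ^+ b))].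
Proof.
have [d1 [A1 [d10 bd1 bA1 aA1]]] := rg; have [d2 [A2 [d20 bd2 bA2 aA2]]] := ra.
exists ((d1 * d2) ^+ L), (fun a b => fun i j =>
  (d1 ^+ (L - a) * d2 ^+ (L - b)) * imul (ipow A1 a) (ipow A2 b) i j).
have zX (q : int) n m : `|q| <= (2 ^ n)%N%:Z -> `|q ^+ m| <= (2 ^ (m * n))%N%:Z.
  move=> le; rewrite normrX (@le_trans _ _ ((2 ^ n)%N%:Z ^+ m)) ?lerXn2r ?nnegrE //.
  by rewrite -rmorphXn /= natrXE lez_nat -expnM leq_exp2l // mulnC.
split.
- by rewrite expf_neq0 // mulf_neq0.
- rewrite (le_trans (zX _ _ _ (normzM_le bd1 bd2))) // lez_nat leq_exp2l //; nia.
- move=> a b lta ltb; split.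
    have le : ((L - a) * h + (L - b) * h + (N + (a * (N + h) + b * (N + h))) <= 2 * L * (N + h) + N)%N.
      have -> : (2 * L * (N + h) = (L - a) * (N + h) + (L - b) * (N + h) + (a * (N + h) + b * (N + h)))%N.
        rewrite -!mulnDl; congr (_ * _)%N; lia.
      have : ((L - a) * h <= (L - a) * (N + h))%N by rewrite leq_mul2l leq_addl orbT.
      have : ((L - b) * h <= (L - b) * (N + h))%N by rewrite leq_mul2l leq_addl orbT.
      lia.
    apply: (ible_mono le) => i j; apply: normzM_le.
      by apply: normzM_le; apply: zX.
    by apply: ible_mul; apply: ible_pow.
  rewrite [_%:~R * _](_ : _ = (d1 ^+ (L - a) * d2 ^+ (L - b))%:~R *
     ((d1%:~R * gam) ^+ a * (d2%:~R * alp) ^+ b)).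
    by apply: acts_scale; apply: acts_mul; apply: acts_pow.
  rewrite exprMn !intrM !rmorphXn /= !exprMn.
  rewrite -{1}(subnK (ltnW lta)) -{2}(subnK (ltnW ltb)) !exprD; ring.
Qed.

Let g_le : (100 * N * ((2 * L * (N + h) + N) + N) <= y ^ 7)%N.
Proof.
have -> : (y ^ 7 = L * y)%N by rewrite /L !expnS; ring.
have L0 : (0 < L)%N by rewrite expn_gt0 y0.
apply: (@leq_trans (L * (400 * N * (N + h)))); last by rewrite leq_mul2l y_ge2 orbT.
have : (N <= L * (N + h))%N.
  by apply: (@leq_trans (N + h)); [rewrite leq_addr | rewrite leq_pmull].
set q := (L * (N + h))%N => le.
have -> : (2 * L * (N + h) = 2 * q)%N by rewrite /q; ring.
have -> : (L * (400 * N * (N + h)) = 100 * N * (4 * q))%N by rewrite /q; ring.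
by rewrite leq_mul2l; apply/orP; right; move: le; clear; lia.
Qed.

Let V := (y ^ 28 * S0)%N.
Let eps : R := (2 ^+ V)^-1.
Let eps0 : 0 < eps. Proof. by rewrite invr_gt0 exprn_gt0. Qed.
Let eps1 : eps <= 1. Proof. by rewrite invf_le1 ?exprn_gt0 // -natrX ler1n expn_gt0. Qed.

(** As k t1 - t2 is 2 pi m up to t, the argument a t1 + b t2 + 2 pi x equals (a + k b) t1 + 2 pi (x
    - m b) up to b t. So the frequencies have integer coordinates on t1 and 2 pi, while the products
    of powers of gam and alp are L^2 distinct bases. The second coordinate separates the values of x
    over one base. *)
Lemma baker_independent (t1 t2 t : R) (k : nat) (m : int) :
  (forall a b a' b', (a < L)%N -> (b < L)%N -> (a' < L)%N -> (b' < L)%N ->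
     gam ^+ a * alp ^+ b = gam ^+ a' * alp ^+ b' -> a = a' /\ b = b') ->
  0 <= t1 <= 2 * pi -> 0 <= t2 <= 2 * pi -> gam = cis t1 -> alp = cis t2 ->
  (k <= 2 ^ l)%N -> k%:R * t1 - t2 = 2 * pi * m%:~R + t -> ~ (2 * L%:R * `|t| <= eps).
Proof.
move=> indep /andP[t10 t1p] /andP[t20 t2p] gE aE kl mE tle.
have [D [B [D0 D_le HB]]] := power_matrices.
have pi8 := @pi2_le8 R; have pi4 := @pi2_ge4 R.
have L1 : 1 <= L%:R :> R by rewrite ler1n expn_gt0 y0.
have t1' : `|t| <= 1 by have := eps1; have := normr_ge0 t; nra.
have mle : `|m| <= (2 * k + 3)%N%:Z.
  rewrite -(ler_int R) intr_norm; have /eqP := mE; rewrite -subr_eq => /eqP mE'.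
  have : 4 * `|m%:~R| <= 8 * k%:R + 9 :> R.
    apply: (@le_trans _ _ `|2 * pi * m%:~R|).
      by rewrite normrM ler_wpM2r // ger0_norm //; lra.
    have kt : 0 <= k%:R * t1 <= 8 * k%:R.
      by rewrite mulr_ge0 //= mulrC ler_wpM2r //; lra.
    rewrite -mE'; move: t1'; rewrite !ler_norml; lra.
  have -> : ((2 * k + 3)%N%:Z%:~R : R) = 2 * k%:R + 3 by rewrite -[_%:~R]/((2 * k + 3)%:R) natrD natrM.
  lra.
pose K' : finType := ('I_L * 'I_L)%type.
pose u (i : 'I_2) (x : (K' * 'I_L)%type) : int :=
  if i == 0 then (x.1.1 : nat)%:Z + k%:Z * (x.1.2 : nat)%:Z
  else (x.2 : nat)%:Z - m * (x.1.2 : nat)%:Z.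
pose c (i : 'I_2) : R := if i == 0 then t1 else 2 * pi.
pose phase (x : (K' * 'I_L)%type) : R := (x.1.1 : nat)%:R * t1 + (x.1.2 : nat)%:R * t2 + 2 * pi * (x.2 : nat)%:R
    + (x.1.2 : nat)%:R * t.
have omE x : \sum_i c i * (u i x)%:~R = phase x.
  rewrite big_ord_recl big_ord1 /c /u /= rmorphD rmorphB /= !intrM /phase.
  have E1 (q : nat) : (q%:Z)%:~R = q%:R :> R by [].
  rewrite !E1; have -> : t2 = k%:R * t1 - 2 * pi * m%:~R - t by lra.
  ring.
have ordL (q : 'I_L) : (q : nat)%:R <= L%:R :> R by rewrite ler_nat ltnW.
apply: (@baker_contra R I e 2 K' y (fun x => gam ^+ x.1 * alp ^+ x.2)
   (fun x => B x.1 x.2) D (2 * L * (N + h) + N) u c 1 eps (l + 12 * y + 5) S0 s0 d) => //.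
- by rewrite !addnS.
- by rewrite card_prod card_ord expnS expn1.
- move=> [a b] [a' b'] /= E; have [] := indep a b a' b' (ltn_ord _) (ltn_ord _) (ltn_ord _) (ltn_ord _) E.
  by move=> /val_inj -> /val_inj ->.
- by move=> x; rewrite nmM !nmX gam1 alp1 !expr1n mulr1.
- by move=> x; case: (HB x.1 x.2 (ltn_ord _) (ltn_ord _)).
- by move=> x; case: (HB x.1 x.2 (ltn_ord _) (ltn_ord _)).
- move=> i x; have lx1 := ltn_ord x.1.1; have lx2 := ltn_ord x.1.2; have lx3 := ltn_ord x.2.
  have H : (L * (2 * k + 4) <= 2 ^ (l + 12 * y + 5))%N by apply: exponent_bound1.
  apply: (@le_trans _ _ (L * (2 * k + 4))%N%:Z); last by rewrite lez_nat.
  rewrite /u; case: ifP => _; last first.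
    rewrite (le_trans (ler_normB _ _)) //; apply: int_bound1.
      by rewrite ger0_norm // lez_nat ltnW.
    by rewrite normrM PoszM ler_pM // ger0_norm // lez_nat ltnW.
  rewrite ger0_norm ?addr_ge0 ?mulr_ge0 // -PoszM -PoszD lez_nat.
  by apply: nat_bound; apply: ltnW.
- move=> k' m1 m2; rewrite /u /= => E; apply/val_inj.
  by move: E => /addIr [].
- by move=> i; rewrite /c; case: ifP => _; rewrite ger0_norm //; lra.
- move=> x; rewrite omE /phase natrM.
  have q1 := ordL x.1.1; have q2 := ordL x.1.2; have q3 := ordL x.2.
  have p1 : 0 <= (x.1.1 : nat)%:R * t1 <= 8 * L%:R.
    by rewrite mulr_ge0 //= mulrC ler_pM //; lra.
  have p2 : 0 <= (x.1.2 : nat)%:R * t2 <= 8 * L%:R.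
    by rewrite mulr_ge0 //= mulrC ler_pM //; lra.
  have p3 : 0 <= 2 * (pi : R) * (x.2 : nat)%:R <= 8 * L%:R.
    by rewrite mulr_ge0 ?ler_pM ?mulr_ge0 ?pi_ge0 //; lra.
  have : `|(x.1.2 : nat)%:R * t| <= L%:R * 1 by rewrite normrM ler_pM // ger0_norm.
  rewrite -/L !ler_norml; lra.
- move=> x; rewrite omE.
  have -> : gam ^+ x.1.1 * alp ^+ x.1.2 = cis ((x.1.1 : nat)%:R * t1 + (x.1.2 : nat)%:R * t2 + 2 * pi * (x.2 : nat)%:Z%:~R).
    by rewrite cisD2pi cisD !cisMn gE aE.
  rewrite (le_trans (MVT_cis _ _)) // (le_trans _ tle) // /phase opprD addrA subrr add0r normrN.
  rewrite -mulrA ler_wpM2l // normrM ler_wpM2r // ger0_norm //.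
- by rewrite S0E.
Qed.

(** If gam^q were that close to 1, t1 would be nearly 2 pi m / q, and the frequencies would be
    integer multiples m a + q x of the single number 2 pi / q. The bases gam^a are distinct because
    gam is not a root of unity. *)
Lemma baker_homogeneous (q : nat) : (0 < q)%N -> (q <= 2 ^ (l + 6 * y + 1))%N ->
  ~ (4 * L%:R * nm (gam ^+ q - 1) <= eps).
Proof.
move=> q0 ql tle0.
have [t1 /andP[t10 t1p] gE] := cis_surj gam1.
have [D [B [D0 D_le HB]]] := power_matrices.
have pi8 := @pi2_le8 R; have pi4 := @pi2_ge4 R.
have L1 : 1 <= L%:R :> R by rewrite ler1n expn_gt0 y0.
have [t tE tn] : exists2 t, gam ^+ q = cis t & `|t| <= 2 * nm (gam ^+ q - 1).
  apply: cis_near1; first by rewrite nmX gam1 expr1n.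
  by have := eps1; have := nm_ge0 (gam ^+ q - 1); nra.
have tle : 2 * L%:R * `|t| <= eps by rewrite (le_trans _ tle0) //; nra.
have t1' : `|t| <= 1 by have := eps1; have := normr_ge0 t; nra.
have [m mE] : exists m : int, q%:R * t1 - t = 2 * pi * m%:~R.
  by apply: cis_eq1; rewrite cisB cisMn -gE tE divff ?cis_neq0.
have mle : `|m| <= (2 * q + 1)%N%:Z.
  rewrite -(ler_int R) intr_norm.
  have : 4 * `|m%:~R| <= 8 * q%:R + 1 :> R.
    apply: (@le_trans _ _ `|2 * pi * m%:~R|).
      by rewrite normrM ler_wpM2r // ger0_norm //; lra.
    have kt : 0 <= q%:R * t1 <= 8 * q%:R.
      by rewrite mulr_ge0 //= mulrC ler_wpM2r //; lra.
    rewrite -mE; move: t1'; rewrite !ler_norml; lra.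
  have -> : ((2 * q + 1)%N%:Z%:~R : R) = 2 * q%:R + 1 by rewrite -[_%:~R]/((2 * q + 1)%:R) natrD natrM.
  lra.
have q1 : 1 <= q%:R :> R by rewrite ler1n.
pose u (i : 'I_1) (x : ('I_L * 'I_L)%type) : int :=
  m * (x.1 : nat)%:Z + q%:Z * (x.2 : nat)%:Z.
pose c (i : 'I_1) : R := 2 * pi / q%:R.
pose phase (x : ('I_L * 'I_L)%type) : R := (x.1 : nat)%:R * t1 + 2 * pi * (x.2 : nat)%:R
    - (x.1 : nat)%:R * (t / q%:R).
have omE x : \sum_i c i * (u i x)%:~R = phase x.
  rewrite big_ord1 /c /u /= rmorphD /= !intrM /phase.
  have E1 (p : nat) : (p%:Z)%:~R = p%:R :> R by [].
  rewrite !E1; have -> : t1 = (2 * pi * m%:~R + t) / q%:R by rewrite -mE; field; rewrite gt_eqF //; lra.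
  by field; rewrite gt_eqF //; lra.
have tq : `|t / q%:R| <= `|t|.
  rewrite normrM normfV ler_pdivrMr ?normr_gt0 ?gt_eqF //; last by lra.
  by rewrite ler_peMr // ger0_norm.
have ordL (p : 'I_L) : (p : nat)%:R <= L%:R :> R by rewrite ler_nat ltnW.
apply: (@baker_contra R I e 1 'I_L y (fun x => gam ^+ x)
   (fun x => B x 0%N) D (2 * L * (N + h) + N) u c 0 eps (l + 12 * y + 5) S0 s0 d) => //.
- by rewrite !addnS.
- by rewrite card_ord expn1.
- move=> a b E; apply/val_inj => /=; apply/eqP; apply/negP.
  wlog lt : a b E / (a < b)%N.
    move=> H /negP ne; have /orP [lt|lt] : ((a < b)%N || (b < a)%N) by rewrite -neq_ltn.
      by apply: (H a b) => //; apply/negP.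
    by apply: (H b a) => //; apply/negP; rewrite eq_sym.
  move=> _; apply: (@gam_free (b - a)); first by rewrite subn_gt0.
  have g0 : gam ^+ a != 0 by rewrite -nm_eq0 nmX gam1 expr1n oner_eq0.
  by apply: (mulfI g0); rewrite -exprD subnKC ?(ltnW lt) // mulr1 E.
- by move=> x; rewrite nmX gam1 expr1n.
- by move=> x; have L0 := leq_ltn_trans (leq0n x) (ltn_ord x); case: (HB x 0%N (ltn_ord _) L0).
- move=> x; have L0 := leq_ltn_trans (leq0n x) (ltn_ord x); case: (HB x 0%N (ltn_ord _) L0).
  by rewrite expr0 mulr1.
- move=> i x; have lx1 := ltn_ord x.1; have lx2 := ltn_ord x.2.
  have H : (L * (3 * q + 1) <= 2 ^ (l + 12 * y + 5))%N by apply: exponent_bound2.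
  apply: (@le_trans _ _ (L * (3 * q + 1))%N%:Z); last by rewrite lez_nat.
  rewrite /u (le_trans (ler_normD _ _)) // !normrM; apply: int_bound2.
    by rewrite PoszM ler_pM // ger0_norm // lez_nat ltnW.
  by rewrite PoszM ler_pM // ger0_norm // lez_nat ltnW.
- move=> k' m1 m2; rewrite /u /= => E; apply/val_inj => /=.
  have qn : q%:Z != 0 by rewrite eqz_nat -lt0n.
  by move: E => /addrI /(mulfI qn) [].
- move=> i; rewrite /c ger0_norm ?divr_ge0 //; last lra.
  by rewrite ler_pdivrMr; [nra | lra].
- move=> x; rewrite omE /phase natrM.
  have q2 := ordL x.1; have q3 := ordL x.2.
  have p1 : 0 <= (x.1 : nat)%:R * t1 <= 8 * L%:R.
    by rewrite mulr_ge0 //= mulrC ler_pM //; lra.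
  have p3 : 0 <= 2 * (pi : R) * (x.2 : nat)%:R <= 8 * L%:R.
    by rewrite mulr_ge0 ?ler_pM ?mulr_ge0 ?pi_ge0 //; lra.
  have : `|(x.1 : nat)%:R * (t / q%:R)| <= L%:R * 1.
    by rewrite normrM ler_pM ?(le_trans tq) // ger0_norm.
  rewrite -/L !ler_norml; lra.
- move=> x; rewrite omE.
  have -> : gam ^+ x.1 = cis ((x.1 : nat)%:R * t1 + 2 * pi * (x.2 : nat)%:Z%:~R).
    by rewrite cisD2pi !cisMn gE.
  rewrite (le_trans (MVT_cis _ _)) // (le_trans _ tle) // /phase opprB addrCA subrr addr0.
  rewrite -mulrA ler_wpM2l // normrM ler_pM // ger0_norm //.
- by rewrite S0E.
Qed.

(** Put w = gam^k / alp. A coincidence among the products gam^a alp^b with a, b < L, which excludes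
    the independent case, gives gam^(k b + a) = w^b gam^a' for some 0 < b <= L. As w^b is still
    close to 1, so is gam to the power |k b + a - a'|: the homogeneous case. If this exponent is 0,
    w is a root of unity of order at most L, other than 1, and cannot be so close to 1. The margin
    20 y pays for the factor 4 L^2. *)
Theorem baker k : (0 < k)%N -> (k <= 2 ^ l)%N -> gam ^+ k <> alp ->
  (2 ^+ (V + 20 * y))^-1 <= nm (gam ^+ k - alp).
Proof.
move=> k0 kl ne; rewrite leNgt; apply/negP => lt.
have L1 : 1 <= L%:R :> R by rewrite ler1n expn_gt0 y0.
have L0 : (0 < L)%N by rewrite expn_gt0 y0.
have a0 : alp != 0 by rewrite -nm_eq0 alp1 oner_eq0.
have g0 n : gam ^+ n != 0 by rewrite -nm_eq0 nmX gam1 expr1n oner_eq0.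
pose w := gam ^+ k / alp.
have w1 : nm w = 1 by rewrite nmM nmV nmX gam1 alp1 expr1n divr1.
have wE : nm (w - 1) = nm (gam ^+ k - alp).
  have -> : w - 1 = (gam ^+ k - alp) / alp by rewrite /w mulrBl divff.
  by rewrite nmM nmV alp1 invr1 mulr1.
have wn1 : w != 1.
  by apply/eqP => E; apply: ne; rewrite -[gam ^+ k](divfK a0) -/w E mul1r.
have small : 4 * L%:R * L%:R * nm (w - 1) <= eps.
  rewrite wE; apply: (@le_trans _ _ (4 * L%:R * L%:R * (2 ^+ (V + 20 * y))^-1)).
    by rewrite ler_wpM2l ?mulr_ge0 // ltW.
  rewrite ler_pdivrMr ?exprn_gt0 // exprD /eps mulrA mulVf ?gt_eqF ?exprn_gt0 // mul1r.
  rewrite -!natrM -natrX ler_nat (@leq_trans (4 * 2 ^ (6 * y) * 2 ^ (6 * y))) ?leq_mul //.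
  rewrite -[4%N]/(2 ^ 2)%N -!expnD leq_exp2l //; move: y0; clear; lia.
have nw0 := nm_ge0 (w - 1).
have small1 : 4 * L%:R * nm (w - 1) <= eps.
  by apply: le_trans small; rewrite ler_wpM2r // ler_peMr // mulr_ge0.
have whalf : nm (w - 1) <= 2^-1 by have := eps1; nra.
have [indep|] := pselect (forall a b a' b', (a < L)%N -> (b < L)%N -> (a' < L)%N -> (b' < L)%N ->
     gam ^+ a * alp ^+ b = gam ^+ a' * alp ^+ b' -> a = a' /\ b = b').
  have [t1 t1b gE] := cis_surj gam1; have [t2 t2b aE] := cis_surj alp1.
  have [t tE tn] := cis_near1 w1 whalf.
  have [m mE] : exists m : int, k%:R * t1 - t2 - t = 2 * pi * m%:~R.
    by apply: cis_eq1; rewrite !cisB cisMn -gE -aE -tE /w divff // mulf_neq0 // invr_eq0.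
  apply: (@baker_independent t1 t2 t k m indep t1b t2b gE aE kl).
    by rewrite -mE; lra.
  apply: le_trans small1; nra.
move=> dep; apply: dep => a b a' b'.
wlog lebb : a b a' b' / (b' <= b)%N.
  move=> H la lb la' lb' E; have [le|le] := leqP b' b; first exact: H.
  by have [|-> ->] := H a' b' a b _ la' lb' la lb (esym E); first exact: ltnW.
move=> la lb la' lb' E.
pose bb := (b - b')%N.
have E2 : gam ^+ a * alp ^+ bb = gam ^+ a'.
  apply: (mulIf (expf_neq0 b' a0)).
  by rewrite -mulrA -exprD subnK.
have ggap n1 n2 : (n1 < n2)%N -> nm (gam ^+ n2 - gam ^+ n1) = nm (gam ^+ (n2 - n1) - 1).
  move=> ltn; have -> : gam ^+ n2 - gam ^+ n1 = gam ^+ n1 * (gam ^+ (n2 - n1) - 1).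
    by rewrite mulrBr mulr1 -exprD subnKC // ltnW.
  by rewrite nmM nmX gam1 expr1n mul1r.
have [bb0|bb0] := posnP bb.
  move: E2; rewrite bb0 expr0 mulr1 => E3; split; last by apply/eqP; rewrite eqn_leq lebb andbT -subn_eq0 -/bb bb0.
  have [ltaa|ltaa|//] := ltngtP a a'.
    have := ggap _ _ ltaa; rewrite E3 subrr nm0 => /esym /eqP; rewrite nm_eq0 subr_eq0 => /eqP.
    by move/(gam_free _ (n := a' - a)) => []; rewrite subn_gt0.
  have := ggap _ _ ltaa; rewrite E3 subrr nm0 => /esym /eqP; rewrite nm_eq0 subr_eq0 => /eqP.
  by move/(gam_free _ (n := a - a')) => []; rewrite subn_gt0.
exfalso.
have bbL : (bb <= L)%N by rewrite (leq_trans (leq_subr _ _)) // ltnW.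
have wb : gam ^+ (k * bb + a) = w ^+ bb * gam ^+ a'.
  by rewrite -E2 /w exprMn exprVn exprD exprM; field; rewrite expf_neq0.
have nwb : nm (w ^+ bb - 1) <= bb%:R * nm (w - 1).
  by have := @nm_subX R w 1 bb w1 (nm1 _); rewrite expr1n.
have nwbL : nm (w ^+ bb - 1) <= L%:R * nm (w - 1).
  by rewrite (le_trans nwb) // ler_wpM2r // ler_nat.
have dist : nm (gam ^+ (k * bb + a) - gam ^+ a') = nm (w ^+ bb - 1).
  by rewrite wb -{2}[gam ^+ a']mul1r -mulrBl nmM nmX gam1 expr1n mulr1.
have smallq : 4 * L%:R * nm (gam ^+ (k * bb + a) - gam ^+ a') <= eps.
  rewrite dist (le_trans _ small) // -[X in _ <= X]mulrA ler_wpM2l ?mulr_ge0 //.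
have kbb : (k * bb + a <= 2 ^ (l + 6 * y + 1))%N.
  rewrite addn1 expnS expnD; apply: (@leq_trans (2 ^ l * 2 ^ (6 * y) + 2 ^ (6 * y))).
    by rewrite leq_add // ?leq_mul // (leq_trans _ Ly) // ltnW.
  rewrite [(2 * (_ * _))%N]mul2n -addnn leq_add2l leq_pmull // expn_gt0 //.
have [ltk|ltk|eqk] := ltngtP (k * bb + a) a'.
- apply: (@baker_homogeneous (a' - (k * bb + a))); first by rewrite subn_gt0.
    rewrite (leq_trans (leq_subr _ _)) // (leq_trans (ltnW la')) // (leq_trans Ly) //.
    by rewrite leq_exp2l // addn1 leqW // leq_addl.
  by rewrite -ggap // nmBC.
- apply: (@baker_homogeneous (k * bb + a - a')); first by rewrite subn_gt0.
    by rewrite (leq_trans (leq_subr _ _)).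
  by rewrite -ggap.
- have wb1 : w ^+ bb = 1.
    by move: wb; rewrite eqk -{1}[gam ^+ a']mul1r => /(mulIf (g0 a')).
  (* The powers of w sum to 0 over a period, so the differences 1 - w^i sum to bb and cannot all be
     small. *)
  have : \sum_(i < bb) (1 - w ^+ i) = bb%:R.
    rewrite sumrB sumr_const card_ord.
    have : (w - 1) * \sum_(i < bb) w ^+ i = 0.
      have := subrXX w 1 bb; rewrite wb1 expr1n subrr => /esym.
      rewrite (reindex_inj rev_ord_inj) /=.
      rewrite (eq_bigr (fun i : 'I_bb => w ^+ i)) => [//|i _].
      by rewrite expr1n mulr1; congr (_ ^+ _); rewrite rev_index ?ltn_ord.
    by move/eqP; rewrite mulf_eq0 subr_eq0 (negPf wn1) => /eqP ->; rewrite subr0.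
  move/(congr1 (@nm R)); rewrite nm_nat => sumE.
  have : bb%:R <= bb%:R * (L%:R * nm (w - 1)) :> R.
    rewrite -{1}sumE (le_trans (nm_sum _ _ _)) //.
    apply: (@le_trans _ _ (\sum_(i < bb) (L%:R * nm (w - 1)))); last by rewrite sumr_const card_ord -[_ *+ bb]mulr_natl.
    apply: ler_sum => i _; rewrite nmBC.
    have := @nm_subX R w 1 i w1 (nm1 _); rewrite expr1n => /le_trans; apply.
    by rewrite ler_wpM2r // ler_nat (leq_trans _ bbL) // ltnW.
  have b1 : 1 <= bb%:R :> R by rewrite ler1n.
  have := eps1; nra.
Qed.

End BakerBound.

(** * LTL along a rotation *)

Section Rotation.
Variables (R : realType) (gam : R[i]) (theta : R).
Hypothesis gamE : gam = cis theta.
Hypothesis gam_free : forall n, (0 < n)%N -> gam ^+ n <> 1.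
Implicit Types (x y t a : R) (n j q : nat) (K : nat).

Lemma gamX n : gam ^+ n = cis (n%:R * theta).
Proof. by rewrite cisMn gamE. Qed.

Lemma gamX_neq0 n : gam ^+ n != 0.
Proof. by rewrite gamX cis_neq0. Qed.

Lemma gamX_inj n n' : gam ^+ n = gam ^+ n' -> n = n'.
Proof.
wlog lt : n n' / (n < n')%N.
  move=> H E; have [/H->//|/H H2|//] := ltngtP n n'.
  by rewrite (H2 (esym E)).
move=> E; exfalso; apply: (@gam_free (n' - n)); first by rewrite subn_gt0.
by apply: (mulfI (gamX_neq0 n)); rewrite -exprD subnKC ?(ltnW lt) // mulr1 E.
Qed.

Lemma cis_eq x y : cis x = cis y -> exists m : int, x = y + 2 * pi * m%:~R.
Proof.
move=> E; have [m mE] : exists m : int, x - y = 2 * pi * m%:~R.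
  by apply: cis_eq1; rewrite cisB E divff ?cis_neq0.
by exists m; rewrite -mE; lra.
Qed.

Lemma cis_inj_near x y : x < y -> y - x < 2 * pi -> cis x <> cis y.
Proof.
move=> lt lt2 /esym /cis_eq [m mE].
have p0 := @pi_gt0 R.
have {}mE : y - x = 2 * pi * m%:~R by rewrite mE; lra.
have : (0 : R) < m%:~R by rewrite -(pmulr_rgt0 _ (_ : 0 < 2 * pi)) -?mE; lra.
rewrite ltr0z => m0; have : (1 : R) <= m%:~R by rewrite (_ : 1 = 1%:~R) // ler_int; lia.
by rewrite leNgt => /negP; apply; rewrite -(ltr_pM2l (_ : 0 < 2 * pi)) -?mE; lra.
Qed.

(** Only even steps are taken, so that the parity of the time is kept. *)
Definition hits (N : nat) (d : R) := forall a n, exists j t,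
  [/\ (j <= N)%N, a < t < a + d & cis t = gam ^+ (n + 2 * j)].

Lemma step_count (y eta : R) : 0 <= y -> 0 < eta ->
  exists2 i : nat, y < i%:R * eta <= y + eta & i%:R <= y / eta + 1.
Proof.
move=> y0 eta0; have ye : 0 <= y / eta by rewrite divr_ge0 // ltW.
have /andP[f1 f2] := real_floor_itv (num_real (y / eta)).
have fl0 : 0 <= Num.floor (y / eta) by rewrite floor_ge0.
exists (absz (Num.floor (y / eta) + 1)).
  have -> : (absz (Num.floor (y / eta) + 1))%:R = (Num.floor (y / eta) + 1)%:~R :> R.
    by rewrite pmulrn gez0_abs // addr_ge0.
  rewrite ltr_pdivrMr // in f2; rewrite f2 intrD mulrDl mul1r lerD2r.
  by rewrite ler_pdivlMr // in f1.
have -> : (absz (Num.floor (y / eta) + 1))%:R = (Num.floor (y / eta) + 1)%:~R :> R.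
  by rewrite pmulrn gez0_abs // addr_ge0.
by rewrite intrD lerD2r.
Qed.

Lemma shift_window x a : exists m : int, a <= x + 2 * pi * m%:~R < a + 2 * pi.
Proof.
have p0 := @pi_gt0 R; have p2 : 0 < 2 * pi :> R by lra.
exists (- Num.floor ((x - a) / (2 * pi))).
have /andP[f1 f2] := real_floor_itv (num_real ((x - a) / (2 * pi))).
rewrite ler_pdivlMr // in f1; rewrite ltr_pdivrMr // intrD in f2.
by rewrite rmorphN /=; move: f1 f2; set z := (Num.floor _)%:~R; lra.
Qed.

(** Repeated rotation by eta sweeps the circle and cannot jump over an arc of length d > |eta|; the
    sign of eta decides from which side the arc is approached. *)
Lemma hits_step (q N : nat) (d eta : R) : gam ^+ (2 * q) = cis eta -> eta != 0 ->
  `|eta| < d -> (forall i : nat, i%:R <= 2 * pi / `|eta| + 1 -> (q * i <= N)%N) -> hits N d.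
Proof.
move=> qE eta0 etad HN a n.
have e0 : 0 < `|eta| by rewrite normr_gt0.
have [neg|pos] := ltP eta 0.
  have [m /andP[m1 m2]] := shift_window (n%:R * theta) (a + d).
  set x := n%:R * theta + 2 * pi * m%:~R in m1 m2.
  have y0 : 0 <= x - (a + d) by lra.
  have [i /andP[i1 i2] i3] := step_count y0 e0.
  have le : i%:R <= 2 * pi / `|eta| + 1.
    rewrite (le_trans i3) // lerD2r ler_wpM2r ?invr_ge0 //; lra.
  exists (q * i)%N, (x + i%:R * eta); split; first exact: HN.
    have -> : i%:R * eta = - (i%:R * `|eta|) by rewrite ltr0_norm //; lra.
    lra.
  by rewrite cisD cisMn -qE cisD2pi -gamX -exprM -exprD mulnA.
have {}pos : 0 < eta by rewrite lt_def eta0.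
have [m /andP[m1 m2]] := shift_window (n%:R * theta) (a - 2 * pi).
set x := n%:R * theta + 2 * pi * m%:~R in m1 m2.
have y0 : 0 <= a - x by lra.
have [i /andP[i1 i2] i3] := step_count y0 e0.
have le : i%:R <= 2 * pi / `|eta| + 1.
  rewrite (le_trans i3) // lerD2r ler_wpM2r ?invr_ge0 //; lra.
exists (q * i)%N, (x + i%:R * eta); split; first exact: HN.
  by rewrite (gtr0_norm pos) in i1 i2 etad; lra.
by rewrite cisD cisMn -qE cisD2pi -gamX -exprM -exprD mulnA.
Qed.

(** Dirichlet's pigeonhole: Q + 2 even powers in Q + 1 boxes, one box more than Q because the angle
    2 pi is allowed. *)
Lemma small_step (Q : nat) : (0 < Q)%N -> exists q eta,
  [/\ (0 < q)%N, (q <= Q.+1)%N, gam ^+ (2 * q) = cis eta, eta != 0 & `|eta| * Q%:R <= 2 * pi].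
Proof.
move=> Q0; have p0 := @pi_gt0 R; have p2 : 0 < 2 * pi :> R by lra.
have Q0' : 0 < Q%:R :> R by rewrite ltr0n.
have /fin_all_exists [x xP] : forall j : 'I_Q.+2, exists x, 0 <= x <= 2 * pi /\ gam ^+ (2 * j) = cis x.
  by move=> j; have [|x x1 x2] := @cis_surj R (gam ^+ (2 * j)); [rewrite gamX nm_cis|exists x].
have bx (j : 'I_Q.+2) : (absz (Num.floor (x j * Q%:R / (2 * pi))) < Q.+1)%N.
  have [/andP[x0 x1] _] := xP j.
  have y0 : 0 <= x j * Q%:R / (2 * pi) by rewrite divr_ge0 ?mulr_ge0 // ltW.
  have f0 : 0 <= Num.floor (x j * Q%:R / (2 * pi)) by rewrite floor_ge0.
  have : (Num.floor (x j * Q%:R / (2 * pi)))%:~R <= Q%:Z%:~R :> R.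
    by rewrite (le_trans (ge_floor _)) // ler_pdivrMr // mulrC ler_pM2l.
  by rewrite ler_int; lia.
pose g (j : 'I_Q.+2) : 'I_Q.+1 := Ordinal (bx j).
have /injectivePn [j1 [j2 ne eqg]] : ~~ injectiveb g.
  by apply/negP => /injectiveP /leq_card; rewrite !card_ord ltnn.
wlog lt : j1 j2 ne eqg / (j1 < j2)%N.
  move=> H; have /orP[lt|lt] : ((j1 < j2)%N || (j2 < j1)%N) by rewrite -neq_ltn.
    exact: (H j1 j2).
  by apply: (H j2 j1) => //; rewrite eq_sym.
have [/andP[a0 a1] aE] := xP j1; have [/andP[b0 b1] bE] := xP j2.
exists (j2 - j1)%N, (x j2 - x j1).
have E : gam ^+ (2 * (j2 - j1)) = cis (x j2 - x j1).
  rewrite cisB -aE -bE mulnBr; apply: (mulIf (gamX_neq0 (2 * j1))).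
  by rewrite -exprD subnK ?leq_mul2l ?(ltnW lt) ?orbT // divfK ?gamX_neq0.
split=> //.
- by rewrite subn_gt0.
- by rewrite (leq_trans (leq_subr _ _)) // -ltnS.
- apply/eqP => E0; apply: (@gam_free (2 * (j2 - j1))); first by rewrite muln_gt0 subn_gt0.
  by rewrite E E0 cis0.
have := congr1 (@nat_of_ord _) eqg; rewrite /= => eqf.
have f0 (j : 'I_Q.+2) : 0 <= Num.floor (x j * Q%:R / (2 * pi)).
  have [/andP[z0 z1] _] := xP j.
  by rewrite floor_ge0 divr_ge0 ?mulr_ge0 // ltW.
have {}eqf : Num.floor (x j1 * Q%:R / (2 * pi)) = Num.floor (x j2 * Q%:R / (2 * pi)).
  by have := f0 j1; have := f0 j2; move: eqf; lia.
have /andP[f1 f2] := real_floor_itv (num_real (x j1 * Q%:R / (2 * pi))).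
have /andP[f3 f4] := real_floor_itv (num_real (x j2 * Q%:R / (2 * pi))).
rewrite eqf in f1 f2; rewrite intrD in f2 f4.
rewrite !ler_pdivlMr // in f1 f3; rewrite !ltr_pdivrMr // in f2 f4.
have -> : `|x j2 - x j1| * Q%:R = `|x j2 * Q%:R - x j1 * Q%:R|.
  by rewrite -mulrBl normrM [`|Q%:R|]ger0_norm // ltW.
move: f1 f2 f3 f4; set z := (Num.floor _)%:~R; set u := x j1 * _; set v := x j2 * _.
by rewrite ler_norml; lra.
Qed.

(** The non-quantitative form is enough for moving the endpoint of a component. *)
Lemma hits_exists d : 0 < d -> exists N, hits N d.
Proof.
move=> d0; have p0 := @pi_gt0 R.
pose Q := (absz (Num.floor (2 * pi / d))).+1.
have Qd : 2 * pi < Q%:R * d.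
  have /andP[_ f2] := real_floor_itv (num_real (2 * pi / d)).
  have f0 : 0 <= Num.floor (2 * pi / d) by rewrite floor_ge0 divr_ge0 // ?ltW //; lra.
  have -> : Q%:R = (Num.floor (2 * pi / d) + 1)%:~R :> R.
    by rewrite /Q intrD -natr1 pmulrn gez0_abs.
  by rewrite -ltr_pdivrMr.
have [|q [eta [q0 qQ qE eta0 etaQ]]] := @small_step Q; first by [].
have e0 : 0 < `|eta| by rewrite normr_gt0.
have etad : `|eta| < d.
  have Q0 : 0 < Q%:R :> R by rewrite ltr0n.
  by rewrite -(ltr_pM2r Q0); apply: le_lt_trans etaQ _; rewrite [d * _]mulrC.
exists (q * absz (Num.floor (2 * pi / `|eta| + 1)))%N; apply: (hits_step qE) => // i le.
rewrite leq_mul2l; apply/orP; right.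
have : i%:Z <= Num.floor (2 * pi / `|eta| + 1) by rewrite floor_ge_int.
by case: (Num.floor _) => //= ?; lia.
Qed.

Variable Z : seq R[i].

Definition cut K (u : R[i]) := exists2 z, z \in Z & exists2 j, (j <= K)%N & gam ^+ j * u = z.
Definition free K x y := forall t, x <= t <= y \/ y <= t <= x -> ~ cut K (cis t).
(** The angles x and y select an arc joining the two powers, in either direction. *)
Definition same K n n' := exists x y, [/\ cis x = gam ^+ n, cis y = gam ^+ n' & free K x y].

Lemma cut_mono K K' u : (K <= K')%N -> cut K u -> cut K' u.
Proof. by move=> le [z zZ [j lej E]]; exists z => //; exists j => //; apply: leq_trans le. Qed.

Lemma same_sym K n n' : same K n n' -> same K n' n.
Proof.
by move=> [x [y [xE yE F]]]; exists y, x; split=> // t /or_comm; apply: F.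
Qed.

Lemma same_mono K K' n n' : (K <= K')%N -> same K' n n' -> same K n n'.
Proof.
move=> le [x [y [xE yE F]]]; exists x, y; split=> // t tin ct.
exact: F tin (cut_mono le ct).
Qed.

(** A cut for K that is met after j more rotations is already a cut for K + j. *)
Lemma same_shift K j n n' : same (K + j) n n' -> same K (n + j) (n' + j).
Proof.
move=> [x [y [xE yE F]]]; exists (x + j%:R * theta), (y + j%:R * theta); split.
- by rewrite cisD xE -gamX -exprD.
- by rewrite cisD yE -gamX -exprD.
move=> t tin [z zZ [i lei E]]; apply: (F (t - j%:R * theta)).
  by case: tin => /andP[t1 t2]; [left|right]; apply/andP; split; lra.
exists z => //; exists (i + j)%N; first by rewrite leq_add2r.
by rewrite cisB -gamX exprD -E -mulrA [gam ^+ j * _]mulrC divfK ?gamX_neq0.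
Qed.

Lemma eventually_no_cut K : exists N0, forall n, (N0 <= n)%N -> ~ cut K (gam ^+ n).
Proof.
have [N0 HN] : exists N0, forall z, z \in Z -> forall i, (N0 <= i)%N -> gam ^+ i <> z.
  elim: Z => [|z s [N1 IH]]; first by exists 0%N.
  have [[i iE]|no] := pselect (exists i, gam ^+ i = z).
    exists (maxn N1 i.+1) => z'; rewrite in_cons => /orP[/eqP->|zs] i'; rewrite geq_max => /andP[l1 l2].
      by rewrite -iE => /gamX_inj ii; rewrite ii ltnn in l2.
    exact: IH.
  exists N1 => z'; rewrite in_cons => /orP[/eqP->|zs] i' l1; last exact: IH.
  by move=> E; apply: no; exists i'.
exists N0 => n len [z zZ [j _]]; rewrite -exprD; apply: HN zZ _ _.
by rewrite (leq_trans len) // leq_addl.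
Qed.

Definition gap K (d : R) := forall u v, cut K u -> cut K v -> u <> v -> d <= nm (u - v).

(** Cuts on both sides within d / 8 of the angle of gam^n'' would be two distinct cuts closer than
    d. So one side is free, and the orbit enters that short arc; one additional step corrects the
    parity if necessary. *)
Lemma visit K d N n n'' : 0 < d -> d <= 1 -> gap K d -> hits N (d / 8) ->
  ~ cut K (gam ^+ n'') ->
  exists j, [/\ (j <= 2 * N + 1)%N, odd (n + j) = odd n'' & same K (n + j) n''].
Proof.
move=> d0 d1 gd hN nc; have p2 := @pi_ge2 R.
pose i : nat := odd n (+) odd n''.
have [x _ xE] : exists2 x, true & gam ^+ n'' = cis x by exists (n''%:R * theta); rewrite ?gamX.
rewrite xE in nc.
have oddi j : odd (n + (i + 2 * j)) = odd n''.
  by rewrite mul2n !oddD odd_double /i addbF oddb addKb.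
have bi j : (j <= N)%N -> (i + 2 * j <= 2 * N + 1)%N.
  by rewrite /i; case: (_ (+) _) => /=; lia.
have [right|] := pselect (forall t, x <= t <= x + d / 8 -> ~ cut K (cis t)).
  have [j [t [lej /andP[t1 t2] tE]]] := hN x (n + i)%N.
  exists (i + 2 * j)%N; split; rewrite ?oddi ?bi // addnA.
  exists t, x; split=> // w [/andP[w1 w2]|/andP[w1 w2]]; apply: right; lra.
move=> nright.
have [left|nleft] := pselect (forall t, x - d / 8 <= t <= x -> ~ cut K (cis t)).
  have [j [t [lej /andP[t1 t2] tE]]] := hN (x - d / 8) (n + i)%N.
  exists (i + 2 * j)%N; split; rewrite ?oddi ?bi // addnA.
  exists t, x; split=> // w [/andP[w1 w2]|/andP[w1 w2]]; apply: left; lra.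
exfalso.
have [t1 [/andP[t1a t1b] c1]] : exists t, x <= t <= x + d / 8 /\ cut K (cis t).
  have [//|H] := pselect (exists t, x <= t <= x + d / 8 /\ cut K (cis t)).
  by case: nright => t tin ct; apply: H; exists t.
have [t2 [/andP[t2a t2b] c2]] : exists t, x - d / 8 <= t <= x /\ cut K (cis t).
  have [//|H] := pselect (exists t, x - d / 8 <= t <= x /\ cut K (cis t)).
  by case: nleft => t tin ct; apply: H; exists t.
have lt1 : x < t1 by rewrite lt_def t1a andbT; apply/eqP => E; apply: nc; rewrite -E.
have ne : cis t2 <> cis t1 by apply: cis_inj_near; lra.
have := gd _ _ c2 c1 ne; have := MVT_cis t2 t1.
rewrite distrC ger0_norm; lra.
Qed.

Section Formulas.
Variables (m : nat) (T : 'I_m -> atom) (orb : nat -> 'cV[R]_3).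

Definition sem phi n := models T phi (fun k => orb (n + k)).

Lemma sem_suffix phi n k : models T phi (fun j => orb (n + (k + j))) = sem phi (n + k).
Proof. by rewrite /sem; congr (models _ _ _); apply/funext => j; rewrite addnA. Qed.

Lemma sem_until f g n : sem (Until f g) n <->
  exists k, sem g (n + k) /\ forall j, (j < k)%N -> sem f (n + j).
Proof.
split=> [[k [gk fk]]|[k [gk fk]]]; exists k; split.
- by rewrite -sem_suffix.
- by move=> j /fk; rewrite -sem_suffix.
- by rewrite sem_suffix.
- by move=> j /fk; rewrite -sem_suffix.
Qed.

Lemma sem_release f g n : sem (Release f g) n <->
  forall k, sem g (n + k) \/ exists2 j, (j < k)%N & sem f (n + j).
Proof.
split=> [H k|H]; last rewrite /sem /= => k; have := H k => -[gk|[j jk fj]].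
- by left; rewrite -sem_suffix.
- by right; exists j => //; rewrite -sem_suffix.
- by left; rewrite sem_suffix.
- by right; exists j => //; rewrite sem_suffix.
Qed.

Lemma sem_next f n : sem (Next f) n <-> sem f (n + 1).
Proof. by rewrite -sem_suffix. Qed.

(** An implication suffices because [same] is symmetric. *)
Definition stable K phi := exists N0, forall n n', (N0 <= n)%N -> (N0 <= n')%N ->
  odd n = odd n' -> same K n n' -> sem phi n -> sem phi n'.

Lemma stable_mono K K' phi : (K <= K')%N -> stable K phi -> stable K' phi.
Proof.
move=> le [N0 H]; exists N0 => n n' ln ln' od s; apply: H => //; exact: same_mono le s.
Qed.

Lemma stable_shift K N0 phi : (forall n n', (N0 <= n)%N -> (N0 <= n')%N ->
    odd n = odd n' -> same K n n' -> sem phi n -> sem phi n') ->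
  forall Nv j n n', (j <= Nv)%N -> (N0 <= n)%N -> (N0 <= n')%N ->
    odd n = odd n' -> same (K + Nv) n n' -> sem phi (n + j) -> sem phi (n' + j).
Proof.
move=> H Nv j n n' lej ln ln' od s; apply: H.
- by rewrite (leq_trans ln) // leq_addr.
- by rewrite (leq_trans ln') // leq_addr.
- by rewrite !oddD od.
- by apply: same_shift; apply: same_mono s; rewrite leq_add2l.
Qed.

(** The bound Nv is uniform in n'': a class met at any late time is met within Nv steps from every
    n. *)
Definition visits K Nv := exists N0, forall n n'', (N0 <= n'')%N ->
  exists j, [/\ (j <= Nv)%N, odd (n + j) = odd n'' & same K (n + j) n''].

(** A witness k > Nv is replaced by some j <= Nv of the same class, where g holds too; f holds
    before j because j < k. Enlarging K by Nv carries the truth values at all offsets up to Nv from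
    n to n'. *)
Lemma stable_until K Nv f g : visits K Nv -> stable K f -> stable K g ->
  stable (K + Nv) (Until f g).
Proof.
move=> [N1 vis] [N2 Hf] [N3 Hg]; exists (maxn N1 (maxn N2 N3)) => n n'.
rewrite !geq_max => /and3P[n1 n2 n3] /and3P[n1' n2' n3'] od s.
have sf := stable_shift Hf; have sg := stable_shift Hg.
move/sem_until => [k [gk fk]]; apply/sem_until.
have [k' [lek' gk' fk']] : exists k', [/\ (k' <= Nv)%N, sem g (n + k') & forall j, (j < k')%N -> sem f (n + j)].
  have [lek|ltk] := leqP k Nv; first by exists k.
  have [|j [lej odj sj]] := vis n (n + k)%N; first by rewrite (leq_trans n1) // leq_addr.
  exists j; split=> //.
    apply: Hg (same_sym sj) gk => //; rewrite (leq_trans n3) // leq_addr //.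
  by move=> i lti; apply: fk; apply: leq_trans lti _; rewrite (leq_trans lej) // ltnW.
exists k'; split; first exact: (sg _ _ _ _ lek' n3 n3' od s).
move=> j ltj; apply: (sf Nv j n n') => //; last exact: fk'.
by rewrite (leq_trans (ltnW ltj)).
Qed.

(** Dually, a failure at n' is moved into the window, where it contradicts the hypothesis at n. *)
Lemma stable_release K Nv f g : visits K Nv -> stable K f -> stable K g ->
  stable (K + Nv) (Release f g).
Proof.
move=> [N1 vis] [N2 Hf] [N3 Hg]; exists (maxn N1 (maxn N2 N3)) => n n'.
rewrite !geq_max => /and3P[n1 n2 n3] /and3P[n1' n2' n3'] od s.
have sf := stable_shift Hf; have sg := stable_shift Hg.
move/sem_release => rel; apply/sem_release => k.
have [//|no] := pselect (sem g (n' + k) \/ exists2 j, (j < k)%N & sem f (n' + j)).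
exfalso.
have ngk : ~ sem g (n' + k) by move=> H; apply: no; left.
have nfk j : (j < k)%N -> ~ sem f (n' + j) by move=> ltj H; apply: no; right; exists j.
have [k' [lek' ngk' nfk']] : exists k', [/\ (k' <= Nv)%N, ~ sem g (n' + k') & forall j, (j < k')%N -> ~ sem f (n' + j)].
  have [lek|ltk] := leqP k Nv; first by exists k.
  have [|j [lej odj sj]] := vis n' (n' + k)%N; first by rewrite (leq_trans n1') // leq_addr.
  exists j; split=> //.
    move=> gj; apply: ngk; apply: Hg sj gj => //; rewrite (leq_trans n3') // leq_addr //.
  by move=> i lti; apply: nfk; apply: leq_trans lti _; rewrite (leq_trans lej) // ltnW.
case: (rel k') => [gk|[j ltj fj]].
  by apply: ngk'; apply: (sg _ _ _ _ lek' n3 n3' od s).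
apply: (nfk' j ltj); apply: (sf Nv j n n') => //.
by rewrite (leq_trans (ltnW ltj)).
Qed.

Lemma stable_next K f : stable K f -> stable (K + 1) (Next f).
Proof.
move=> [N2 Hf]; exists N2 => n n' ln ln' od s /sem_next H; apply/sem_next.
exact: (stable_shift Hf (leqnn 1) ln ln' od s H).
Qed.

Lemma stable_and K f g : stable K f -> stable K g -> stable K (And f g).
Proof.
move=> [N2 Hf] [N3 Hg]; exists (maxn N2 N3) => n n'.
rewrite !geq_max => /andP[n2 n3] /andP[n2' n3'] od s [Sf Sg].
by split; [apply: (Hf n) | apply: (Hg n)].
Qed.

Lemma stable_or K f g : stable K f -> stable K g -> stable K (Or f g).
Proof.
move=> [N2 Hf] [N3 Hg]; exists (maxn N2 N3) => n n'.
rewrite !geq_max => /andP[n2 n3] /andP[n2' n3'] od s [Sf|Sg].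
  by left; apply: (Hf n).
by right; apply: (Hg n).
Qed.

(** The size of a formula counts only the atoms that occur in it, so the second bound of the theorem
    rests on those alone. *)
Fixpoint occurs (i : 'I_m) (phi : ltl m) : bool :=
  match phi with
  | Prp k => k == i
  | And f g | Or f g | Until f g | Release f g => occurs i f || occurs i g
  | Next f => occurs i f
  end.

(** [k d] is the number of shifts allowed at depth d. The successor in [(Nv i).+1] leaves room for
    the shift by one that [Next] makes. *)
Lemma stable_depth (D : nat) (k Nv : nat -> nat) phi :
  (forall i, (i < D)%N -> visits (k i) (Nv i) /\ (k i + (Nv i).+1 <= k i.+1)%N) ->
  (forall i, occurs i phi -> stable (k 0) (Prp i)) ->
  forall d, (depth phi <= d <= D)%N -> stable (k d) phi.
Proof.
move=> step.
have kmono i j : (i <= j <= D)%N -> (k i <= k j)%N.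
  case/andP; elim: j => [|j IH]; first by rewrite leqn0 => /eqP->.
  rewrite leq_eqVlt => /orP[/eqP->//|]; rewrite ltnS => le ltD.
  have [_ h] := step j ltD; rewrite (leq_trans (IH le (ltnW ltD))) //.
  by rewrite (leq_trans _ h) // leq_addr.
elim: phi => [i|f IHf g IHg|f IHf g IHg|f IHf g IHg|f IHf g IHg|f IHf] at_ d /andP[led leD] /=.
- apply: stable_mono (at_ i (eqxx i)); exact: kmono.
- move: led; rewrite /= geq_max => /andP[l1 l2]; apply: stable_and.
    by apply: IHf; rewrite ?l1 // => i oi; apply: at_; rewrite /= oi.
  by apply: IHg; rewrite ?l2 // => i oi; apply: at_; rewrite /= oi orbT.
- move: led; rewrite /= geq_max => /andP[l1 l2]; apply: stable_or.
    by apply: IHf; rewrite ?l1 // => i oi; apply: at_; rewrite /= oi.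
  by apply: IHg; rewrite ?l2 // => i oi; apply: at_; rewrite /= oi orbT.
- case: d led leD => // d; rewrite /= ltnS geq_max => /andP[l1 l2] ltD.
  have [vis le] := step d ltD.
  apply: (@stable_mono (k d + Nv d)); first by rewrite (leq_trans _ le) // leq_add2l.
  apply: stable_until vis _ _.
    by apply: IHf; rewrite ?l1 ?(ltnW ltD) // => i oi; apply: at_; rewrite /= oi.
  by apply: IHg; rewrite ?l2 ?(ltnW ltD) // => i oi; apply: at_; rewrite /= oi orbT.
- case: d led leD => // d; rewrite /= ltnS geq_max => /andP[l1 l2] ltD.
  have [vis le] := step d ltD.
  apply: (@stable_mono (k d + Nv d)); first by rewrite (leq_trans _ le) // leq_add2l.
  apply: stable_release vis _ _.
    by apply: IHf; rewrite ?l1 ?(ltnW ltD) // => i oi; apply: at_; rewrite /= oi.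
  by apply: IHg; rewrite ?l2 ?(ltnW ltD) // => i oi; apply: at_; rewrite /= oi orbT.
- case: d led leD => // d; rewrite /= ltnS => l1 ltD.
  have [vis le] := step d ltD.
  apply: (@stable_mono (k d + 1)); first by rewrite (leq_trans _ le) // leq_add2l.
  by apply: stable_next; apply: IHf; rewrite ?l1 ?(ltnW ltD).
Qed.

(* An endpoint of a component which is not a cut could be moved: the arc around
   it is detected to lie in J, against the maximality of J. *)
Lemma extend_component K phi J a b p w (eta : R * R) a' b' (q : R) :
  stable K phi -> is_Jset [set n | sem phi n] gam J -> arc_component J (open_arc a b) (b - a) ->
  a < b -> 0 < w -> (forall t, p <= t <= p + w -> a <= t <= b) ->
  (forall t, p <= t <= p + w -> eta.1 <= t <= eta.2) -> eta.1 < eta.2 -> eta.2 - eta.1 <= 2 * pi ->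
  (forall t, eta.1 <= t <= eta.2 -> ~ cut K (cis t)) ->
  a' <= a -> b <= b' -> b' - a' < 2 * pi ->
  (forall t, a' < t < b' -> a < t < b \/ eta.1 < t < eta.2) ->
  a' < q < b' -> q <= a \/ b <= q -> False.
Proof.
move=> [N0 st] [[k [A [Aarc JE]]] [N1 dsc] Jmax] [_ AJ Amax] ltab w0 wab weta eta12 etapi fr la lb pib cov qin qout.
pose J' := J `|` open_arc eta.1 eta.2.
have fin' : finite_union_of_arcs J'.
  exists k.+1, (fun i => if unlift ord0 i is Some j then A j else open_arc eta.1 eta.2); split.
    move=> i; case: unliftP => [j _|_]; first exact: Aarc.
    by exists (eta.2 - eta.1); left; exists eta.1, eta.2; split=> //; lra.
  apply/seteqP; split=> z.
    case=> [|zin]; last by exists ord0 => //; rewrite unlift_none.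
    by rewrite JE => -[i _ Ai]; exists (lift ord0 i) => //; rewrite liftK.
  case=> i _; case: unliftP => [j _ Aj|_]; last by right.
  by left; rewrite JE; exists j.
have desc' : eventually_describes [set n | sem phi n] gam J'.
  exists (maxn N0 N1) => n; rewrite geq_max => /andP[n0 n1].
  split; first by move=> /(dsc n n1); left.
  case=> [/(dsc n n1)//|[t]]; rewrite /= in_itv /= => /andP[t1 t2] tE.
  have [N hN] := hits_exists w0.
  have [j [s [_ /andP[s1 s2] sE]]] := hN p n.
  have wab1 := wab s; have weta1 := weta s.
  have sJ : J (gam ^+ (n + 2 * j)).
    apply: AJ; exists s => //; rewrite /= in_itv /=.
    by have := wab p; have := wab (p + w); lra.
  have n1' : (N1 <= n + 2 * j)%N by rewrite (leq_trans n1) // leq_addr.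
  apply: (st (n + 2 * j)%N n) => //.
  - by rewrite (leq_trans n0) // leq_addr.
  - by rewrite mul2n oddD odd_double addbF.
  - exists s, t; split=> //.
    have : eta.1 <= s <= eta.2 by apply: weta; lra.
    by move=> /andP[h1 h2] v [/andP[v1 v2]|/andP[v1 v2]]; apply: fr; lra.
  - exact/(dsc _ n1').
have J'J := Jmax _ fin' desc'.
pose B : set R[i] := open_arc a' b'.
have arcB : is_arc B (b' - a') by left; exists a', b'; split=> //; lra.
have AB : open_arc a b `<=` B.
  by move=> z [t]; rewrite /= in_itv /= => /andP[t1 t2] <-; exists t => //; rewrite /= in_itv /=; lra.
have BJ : B `<=` J.
  move=> z [t]; rewrite /= in_itv /= => tin <-; have [tab|teta] := cov t tin.
    by apply: AJ; exists t => //; rewrite /= in_itv.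
  by apply: J'J; right; exists t => //; rewrite /= in_itv.
have := Amax B _ arcB AB BJ.
move=> BA; have : B (cis q) by exists q => //; rewrite /= in_itv.
rewrite BA => -[t]; rewrite /= in_itv /= => /andP[t1 t2] tE.
case: qout => [qa|bq].
  by apply: (@cis_inj_near q t) => //; lra.
by apply: (@cis_inj_near t q) => //; lra.
Qed.

End Formulas.
End Rotation.

(** * Gaps between cuts and lengths of components *)

(** q is the logarithm of the Dirichlet parameter that brings the rotation step below an eighth of
    the gap 2^-(A (l + 1)); the left side is the logarithm of the resulting window. *)
Lemma step_exponent A l q : (0 < A)%N -> (0 < l)%N -> q = (A * l.+1 + 7)%N ->
  (A * (q + 3) + q + 10 <= 40 * A ^ 2 * l)%N.
Proof.
move=> A0 l0 qE; have q9 : (q <= 9 * (A * l))%N.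
  have : (A * l.+1 = A * l + A)%N by rewrite mulnS addnC.
  have : (A <= A * l)%N by rewrite leq_pmulr.
  by rewrite qE; move: (A * l)%N => x; lia.
clear qE.
have le : (A * (q + 3) <= A * (12 * (A * l)))%N.
  rewrite leq_mul2l; apply/orP; right.
  have : (0 < A * l)%N by rewrite muln_gt0 A0.
  by move: q9; move: (A * l)%N q => x z; lia.
have E : (40 * A ^ 2 * l = 40 * (A * (A * l)))%N by rewrite expnS expn1; ring.
have E2 : (A * (12 * (A * l)) = 12 * (A * (A * l)))%N by ring.
have E3 : (A * l <= A * (A * l))%N by rewrite leq_pmull.
have : (0 < A * l)%N by rewrite muln_gt0 A0.
move: le q9; rewrite E E2; move: E3; move: q E2 E (A * (A * l))%N (A * l)%N (A * (q + 3))%N => v _ _ x z u.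
lia.
Qed.

Section Components.
Variables (R : realType) (gam : R[i]) (theta : R).
Hypothesis gamE : gam = cis theta.
Hypothesis gam_free : forall n, (0 < n)%N -> gam ^+ n <> 1.
Variable Z : seq R[i].

(** For a given K there are only finitely many cuts. *)
Lemma away_from_cuts K (a : R) : ~ cut gam Z K (cis a) ->
  exists2 eta : R, 0 < eta & forall t, a - eta <= t <= a + eta -> ~ cut gam Z K (cis t).
Proof.
move=> nc.
pose s := [seq z / gam ^+ j | z <- Z, j <- iota 0 K.+1].
have cutP u : cut gam Z K u -> u \in s.
  move=> [z zZ [j lej E]]; apply/allpairsP; exists (z, j); split=> //=.
    by rewrite -[0%N :: _]/(iota 0 K.+1) mem_iota.
  by rewrite -E [_ * u]mulrC mulfK ?(gamX_neq0 gamE).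
have nin : cis a \notin s.
  apply/negP => /allpairsP [[z j] /= [zZ]]; rewrite -[0%N :: _]/(iota 0 K.+1) mem_iota ltnS => lej E.
  by apply: nc; exists z => //; exists j => //; rewrite E mulrC divfK ?(gamX_neq0 gamE).
have [d0 d00 H] : exists2 d0 : R, 0 < d0 & forall u, u \in s -> d0 <= nm (cis a - u).
  elim: s nin {cutP} => [|u s IH]; first by exists 1.
  rewrite in_cons negb_or => /andP[ne /IH [d0 d00 H]].
  exists (Num.min d0 (nm (cis a - u))).
    by rewrite lt_min d00 nm_gt0 subr_eq0.
  move=> v; rewrite in_cons => /orP[/eqP->|vs]; first by rewrite ge_min lexx orbT.
  by rewrite ge_min H.
exists (d0 / 4); first by lra.
move=> t /andP[t1 t2] /cutP /H le.
have := MVT_cis a t; have : `|a - t| <= d0 / 4 by rewrite ler_norml; lra.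
lra.
Qed.

Variables (m : nat) (T : 'I_m -> atom) (orb : nat -> 'cV[R]_3).

(** By [extend_component] both endpoints are cuts, and those of a component shorter than d / 2 are
    distinct. The chord is at most twice the angle, whence the factor 1/2. *)
Lemma component_ge K d phi J A L : 0 < d -> d <= 1 -> gap gam Z K d ->
  stable gam Z T orb K phi -> is_Jset [set n | sem T orb phi n] gam J ->
  arc_component J A L -> d / 2 <= L.
Proof.
move=> d0 d1 gd st Js comp; have p2 := @pi_ge2 R.
have [[[a [b [ab bpi AE LE]]]|[_ ->]] _ _] := comp; last by lra.
subst A L; rewrite leNgt; apply/negP => lt.
have ext p : p = a \/ p = b -> cut gam Z K (cis p).
  move=> pab; have [//|nc] := pselect (cut gam Z K (cis p)); exfalso.
  have [eta0 eta00 fr] := away_from_cuts nc.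
  pose eta := Num.min eta0 (Num.min (b - a) 1).
  have e0 : 0 < eta by rewrite !lt_min eta00 ltr01 subr_gt0 ab.
  have e1 : eta <= eta0 by rewrite ge_min lexx.
  have e2 : eta <= b - a by rewrite !ge_min lexx !orbT.
  have e3 : eta <= 1 by rewrite !ge_min lexx !orbT.
  have {}fr t : p - eta <= t <= p + eta -> ~ cut gam Z K (cis t).
    by move=> tin; apply: fr; lra.
  case: pab => pE; rewrite pE in fr.
    apply: (@extend_component R gam theta gamE gam_free Z m T orb K phi J a b a eta
      (a - eta, a + eta) (a - eta) b (a - eta / 2) st Js comp) => //=; try lra.
    - by move=> t tin; lra.
    - by move=> t tin; lra.
    - move=> t tin; have [lta|gea] := ltP a t; [left|right]; lra.
  apply: (@extend_component R gam theta gamE gam_free Z m T orb K phi J a b (b - eta) eta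
    (b - eta, b + eta) a (b + eta) (b + eta / 2) st Js comp) => //=; try lra.
  - by move=> t tin; lra.
  - by move=> t tin; lra.
  - move=> t tin; have [lta|gea] := ltP t b; [left|right]; lra.
have ca := ext a (or_introl erefl); have cb := ext b (or_intror erefl).
have ne : cis a <> cis b by apply: cis_inj_near; lra.
have := gd _ _ ca cb ne; have := MVT_cis a b.
rewrite distrC ger0_norm; lra.
Qed.

Hypothesis Z1 : 1 \in Z.
Variables (A D : nat).
Hypothesis A0 : (0 < A)%N.
Hypothesis sep : forall l k z z', (l <= (40 * A ^ 2) ^ D.+1)%N -> (k <= 2 ^ l)%N ->
  z \in Z -> z' \in Z -> gam ^+ k * z <> z' -> (2 ^+ (A * l.+1))^-1 <= nm (gam ^+ k * z - z').

Let gam1 n : nm (gam ^+ n) = 1. Proof. by rewrite (gamX gamE) nm_cis. Qed.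
Let g0 n := gamX_neq0 gamE n.

(** Rotating both cuts by the larger of the two shifts leaves a single power of gam to be compared
    with Z. *)
Lemma gap_sep l : (l <= (40 * A ^ 2) ^ D.+1)%N -> gap gam Z (2 ^ l) (2 ^+ (A * l.+1))^-1.
Proof.
move=> lel u v [z zZ [j lej uE]] [z' z'Z [j' lej' vE]] ne.
wlog lejj : u v z z' zZ z'Z j j' lej lej' uE vE ne / (j <= j')%N.
  move=> H; have [le|lt] := leqP j j'; first exact: (H u v z z' zZ z'Z j j').
  by rewrite nmBC; apply: (H v u z' z z'Z zZ j' j) => //; [exact: nesym | exact: ltnW].
have E : nm (u - v) = nm (gam ^+ (j' - j) * z - z').
  rewrite -uE -vE mulrA -exprD subnK // -mulrBr nmM gam1 mul1r //.
rewrite E; apply: sep => //.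
  by rewrite (leq_trans (leq_subr _ _)).
rewrite -uE -vE mulrA -exprD subnK // => /(mulfI (g0 j')); exact: ne.
Qed.

(** The binary logarithm of the number of shifts allowed at depth d. *)
Let lseq d := ((40 * A ^ 2) ^ d)%N.

Lemma lseq_gt0 d : (0 < lseq d)%N.
Proof. by rewrite expn_gt0 muln_gt0 expn_gt0 A0. Qed.

(** The Dirichlet step is less than an eighth of the gap. It is not too small either: the separation
    of gam^(2 s) from 1 gives 2 |eta| >= 2^-(A (q + 3)), which is the purpose of having 1 in Z. So
    the circle is swept in a number of steps whose logarithm is linear in l. *)
Lemma visits_sep d : (d < D)%N ->
  exists Nv, visits gam Z (2 ^ lseq d) Nv /\ (2 ^ lseq d + Nv.+1 <= 2 ^ lseq d.+1)%N.
Proof.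
move=> ltd; set l := lseq d; have l0 : (0 < l)%N := lseq_gt0 d.
have pi8 := @pi2_le8 R.
have B0 : (0 < 40 * A ^ 2)%N by rewrite muln_gt0 expn_gt0 A0.
pose q := (A * l.+1 + 7)%N.
have stepE := step_exponent A0 l0 (erefl q).
have lE : (40 * A ^ 2 * l = lseq d.+1)%N by rewrite /l /lseq -expnS.
have leD : (lseq d.+1 <= (40 * A ^ 2) ^ D.+1)%N by rewrite leq_pexp2l // ltnW.
have leq2 : (q + 2 <= (40 * A ^ 2) ^ D.+1)%N.
  apply: leq_trans leD; rewrite -lE; apply: leq_trans stepE; lia.
have lelD : (l <= (40 * A ^ 2) ^ D.+1)%N by rewrite leq_pexp2l //; lia.
pose Q := (2 ^ q)%N; have Q0 : (0 < Q)%N by rewrite expn_gt0.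
have [s [eta [s0 sQ sE eta0 etaQ]]] := @small_step R gam theta gamE gam_free Q Q0.
have e0 : 0 < `|eta| by rewrite normr_gt0.
have p2 n : 0 < 2 ^+ n :> R by rewrite exprn_gt0.
have etad : `|eta| < (2 ^+ (A * l.+1))^-1 / 8.
  have Q1 : 0 < Q%:R :> R by rewrite ltr0n.
  rewrite -(ltr_pM2r Q1); apply: le_lt_trans etaQ _.
  rewrite /Q natrX /q exprD.
  have -> : (2 ^+ (A * l.+1))^-1 / 8 * (2 ^+ (A * l.+1) * 2 ^+ 7) = 16 :> R.
    by field; rewrite gt_eqF.
  lra.
have sle : (2 * s <= 2 ^ (q + 2))%N.
  by rewrite expnD; move: sQ Q0; rewrite /Q; move: (2 ^ q)%N => x; lia.
have eta_ge : (2 ^+ (A * (q + 3)))^-1 <= 2 * `|eta|.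
  have ne : gam ^+ (2 * s) * 1 <> 1 by rewrite mulr1; apply: gam_free; rewrite muln_gt0.
  have := sep leq2 sle Z1 Z1 ne; rewrite mulr1 sE => le.
  have := MVT_cis eta 0; rewrite cis0 subr0.
  by move=> h; rewrite (_ : q + 3 = (q + 2).+1)%N ?(le_trans le) // addnS.
pose Nh := (2 ^ (q + 1 + (A * (q + 3) + 5)))%N.
have hN : hits gam Nh ((2 ^+ (A * l.+1))^-1 / 8).
  apply: (@hits_step R gam theta gamE s Nh _ eta sE eta0 etad) => i ile.
  rewrite /Nh expnD leq_mul //.
    by rewrite (leq_trans sQ) // /Q expnD; move: Q0; rewrite /Q; move: (2 ^ q)%N => x; lia.
  rewrite -(ler_nat R) natrX (le_trans ile) //.
  have h1 : 2 * pi / `|eta| <= 8 * (2 * 2 ^+ (A * (q + 3))).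
    rewrite ler_pdivrMr // -mulrA.
    rewrite (le_trans pi8) // ler_peMr //.
    rewrite mulrAC; have := ler_wpM2l (ltW (p2 (A * (q + 3))%N)) eta_ge.
    by rewrite mulfV ?gt_eqF //; lra.
  have h2 : 1 <= 2 ^+ (A * (q + 3)) :> R by rewrite -natrX ler1n expn_gt0.
  by rewrite exprD (_ : (2 : R) ^+ 5 = 32); [lra | ring].
exists (2 * Nh + 1)%N; split.
  have [N0 nc] := eventually_no_cut gamE gam_free Z (2 ^ l).
  exists N0 => n n'' ln''.
  have gd := gap_sep lelD.
  have dd0 : 0 < (2 ^+ (A * l.+1))^-1 :> R by rewrite invr_gt0.
  have dd1 : (2 ^+ (A * l.+1))^-1 <= 1 :> R by rewrite invf_le1 // -natrX ler1n expn_gt0.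
  exact: (visit gamE n dd0 dd1 gd hN (nc _ ln'')).
rewrite -lE; apply: (@leq_trans (2 ^ (A * (q + 3) + q + 10))); last by rewrite leq_exp2l.
have -> : (A * (q + 3) + q + 10 = (q + 1 + (A * (q + 3) + 5)) + 4)%N by ring.
rewrite expnD -/Nh; have : (2 ^ l <= Nh)%N.
  rewrite /Nh leq_exp2l // /q; apply: (@leq_trans (A * l.+1)); first by rewrite (leq_trans (leqnSn l)) // leq_pmull.
  by rewrite -!addnA leq_addr.
have : (0 < Nh)%N by rewrite expn_gt0.
by move: Nh {hN} (2 ^ l)%N => x z; lia.
Qed.

(** Atoms are stable without shifts, hence also for the 2 shifts allowed at depth 0. With l = (40
    A^2)^D, half the gap is at least 2^-(3 A l). *)
Theorem component_bound phi J Ac L : (depth phi <= D)%N ->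
  (forall i, occurs i phi -> stable gam Z T orb 0 (Prp i)) ->
  is_Jset [set n | sem T orb phi n] gam J -> arc_component J Ac L ->
  (2 ^+ (3 * A * (40 * A ^ 2) ^ D))^-1 <= L.
Proof.
move=> dD at0 Js comp.
have [Nv NvP] : exists Nv, forall d, (d < D)%N ->
    visits gam Z (2 ^ lseq d) (Nv d) /\ (2 ^ lseq d + (Nv d).+1 <= 2 ^ lseq d.+1)%N.
  have : forall d, exists Nv, (d < D)%N ->
    visits gam Z (2 ^ lseq d) Nv /\ (2 ^ lseq d + Nv.+1 <= 2 ^ lseq d.+1)%N.
    move=> d; have [lt|ge] := ltnP d D; last by exists 0%N.
    by have [Nv H] := visits_sep lt; exists Nv.
  by move=> /choice [Nv H]; exists Nv.
have st : stable gam Z T orb (2 ^ lseq D) phi.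
  apply: (@stable_depth R gam theta gamE Z m T orb D (fun d => 2 ^ lseq d)%N Nv phi NvP).
    by move=> i oi; apply: stable_mono (at0 i oi).
  by rewrite dD leqnn.
have lD : (lseq D <= (40 * A ^ 2) ^ D.+1)%N.
  by rewrite leq_pexp2l // muln_gt0 expn_gt0 A0.
have := component_ge _ _ (gap_sep lD) st Js comp.
have p2 n : 0 < 2 ^+ n :> R by rewrite exprn_gt0.
rewrite invr_gt0 p2 invf_le1 ?p2 // -natrX ler1n expn_gt0 => /(_ isT isT).
apply: le_trans; rewrite -invfM lef_pV2 ?posrE ?p2 ?mulr_gt0 ?ltr0n ?expn_gt0 //.
rewrite -natrM -natrX ler_nat mulnC -expnS leq_exp2l //.
have := lseq_gt0 D; rewrite -/(lseq D); move: (lseq D) => x x0.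
have : (A <= A * x)%N by rewrite leq_pmulr.
rewrite mulnS -mulnA; move: (A * x)%N => z; lia.
Qed.

End Components.

Lemma int_bits_ge (a : int) h : (int_bits a <= h)%N -> `|a| <= (2 ^ h)%N%:Z.
Proof.
move=> le; rewrite -abszE lez_nat ltnW // (leq_trans (trunc_log_ltn _ (isT : (1 < 2)%N))) //.
by rewrite leq_exp2l // (leq_trans _ le) // /int_bits /nat_bits.
Qed.

(** * The spectral expansion *)

(** Conjugation permutes the generators, so the conjugate of a represented number is represented by
    a permuted matrix of the same height. *)
Definition conj_stable (R : rcfType) (I : finType) (e : I -> R[i]) :=
  exists2 tau : I -> I, involutive tau & forall i, e (tau i) = (e i)^*.

Lemma rep_conj (R : rcfType) (I : finType) (e : I -> R[i]) h x :
  conj_stable e -> rep e h x -> rep e h x^*.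
Proof.
move=> [tau tauK tauE] [d [A [d0 bd bA aA]]].
exists d, (fun i j => A (tau i) (tau j)); split=> // i.
apply: (can_inj (@conjCK _)); rewrite rmorphM /= rmorphM /= conjCK -tauE rmorph_int aA rmorph_sum.
rewrite [RHS](reindex_inj (inv_inj tauK)) /=; apply: eq_bigr => j _.
by rewrite rmorphM /= rmorph_int -tauE tauK.
Qed.

Lemma hinv_mono N N' h h' : (N <= N')%N -> (h <= h')%N -> (hinv N h <= hinv N' h')%N.
Proof.
by move=> le le'; rewrite /hinv !leq_add // ?leq_mul // leq_add.
Qed.

(** * Adjunction of algebraic numbers *)

Section Adjunction.
Variables (R : rcfType) (I : finType) (e : I -> R[i]).

Lemma rep_rat h (q : rat) : (rat_bits q <= h)%N -> rep e h (ratr q).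
Proof.
rewrite /rat_bits => le; exists (denq q), (fun i j => numq q * ione i j); split.
- by rewrite denq_eq0.
- by apply: int_bits_ge; apply: leq_trans le; rewrite leq_addl.
- move=> i j; rewrite -[h]addn0; apply: normzM_le; last exact: ible_one.
  by apply: int_bits_ge; apply: leq_trans le; rewrite leq_addr.
- rewrite (_ : _ * _ = (numq q)%:~R * 1); first exact/acts_scale/acts_one.
  by rewrite /ratr mulr1 mulrC divfK // intr_eq0 denq_eq0.
Qed.

Lemma prodD1_norm_le (J : finType) (d : J -> int) (a : int) j h :
  (forall j, `|d j| <= (2 ^ h)%N%:Z) -> `|a| <= (2 ^ h)%N%:Z ->
  `|(\prod_(k | k != j) d k) * a| <= (2 ^ (#|J| * h))%N%:Z.
Proof.
move=> bd ba; have -> : (#|J| * h = #|J|.-1 * h + h)%N.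
  by rewrite -mulSnr prednK //; apply/card_gt0P; exists j.
apply: normzM_le ba.
rewrite normr_prod; apply: (@le_trans _ _ (\prod_(k | k != j) (2 ^ h)%N%:Z)).
  by apply: ler_prod => l _; rewrite normr_ge0 bd.
rewrite prodr_const -rmorphXn /= natrXE lez_nat mulnC expnM leq_eqVlt; apply/orP; left.
by apply/eqP; congr (_ ^ _)%N; exact: cardC1.
Qed.

Lemma rep_rat_matrix h (Q : I -> I -> rat) x :
  (forall i j, (rat_bits (Q i j) <= h)%N) ->
  (forall i, x * e i = \sum_j ratr (Q i j) * e j) -> rep e (#|I| * #|I| * h) x.
Proof.
move=> bQ act; pose d (p : I * I) := denq (Q p.1 p.2).
have bd p : `|d p| <= (2 ^ h)%N%:Z.
  by apply: int_bits_ge; apply: leq_trans (bQ p.1 p.2); rewrite leq_addl.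
exists (\prod_p d p), (fun i j => (\prod_(p | p != (i, j)) d p) * numq (Q i j)); split.
- by apply/prodf_neq0 => p _; rewrite /d denq_eq0.
- by rewrite (le_trans (prod_norm_le _ bd)) // card_prod.
- move=> i j; rewrite -card_prod; apply: prodD1_norm_le => //.
  by apply: int_bits_ge; apply: leq_trans (bQ i j); rewrite leq_addr.
move=> i; rewrite -mulrA act mulr_sumr; apply: eq_bigr => j _.
rewrite mulrA; congr (_ * _); rewrite (bigD1 (i, j)) //= !rmorphM /= mulrAC mulrC; congr (_ * _).
by rewrite /ratr mulrC divfK // intr_eq0 denq_eq0.
Qed.

Variables (P : {poly R[i]}) (n h : nat) (z : R[i]).
Hypotheses (P0 : P != 0) (sP : (size P <= n.+1)%N) (rP : forall k, rep e h P`_k)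
  (Pz : root P z).

(** The products e_i z^j, with j below the degree of P, generate the larger field. The generating
    vector only has to be nonzero, so P need not be irreducible. Old elements act blockwise and keep
    their height; closure under conjugation survives when z is real. *)
Lemma adjoin : (exists i, e i != 0) ->
  exists (J : finType) (e' : J -> R[i]),
  [/\ (exists j, e' j != 0), (#|J| <= #|I| * n)%N,
      rep e' (n.+1 * (#|I| + (h + hinv #|I| h))) z,
      forall h' x, rep e h' x -> rep e' h' x &
      z^* = z -> conj_stable e -> conj_stable e'].
Proof.
move=> e0; have [i0 ei0] := e0.
set h1 := (#|I| + (h + hinv #|I| h))%N.
have s2 : (1 < size P)%N.
  rewrite ltnNge; apply/negP => /size1_polyC PE; move: P0 Pz; rewrite PE.
  by rewrite polyC_eq0 rootC => /negP.
pose m := (size P).-1.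
have m0 : (0 < m)%N by rewrite /m; lia.
have mE : size P = m.+1 by rewrite /m; lia.
have lc : lead_coef P != 0 by rewrite lead_coef_eq0.
pose c (k : 'I_m) := - (P`_k / lead_coef P).
have zm : z ^+ m = \sum_(k < m) c k * z ^+ k.
  apply: (mulfI lc); rewrite mulr_sumr.
  move: Pz; rewrite /root horner_coef mE big_ord_recr /= addrC addr_eq0 => /eqP.
  rewrite -/m -{1}[m]/(m.+1.-1) -mE -/(lead_coef P) => ->; rewrite -sumrN; apply: eq_bigr => k _.
  by rewrite /c !mulNr mulrN mulrCA mulrA mulfVK // .
have rc k : rep e h1 (c k).
  by apply: rep_opp; apply: rep_mul => //; apply: rep_inv => //; apply: rP.
have /fin_all_exists [d /fin_all_exists [A H]] := rc.
have bd k : `|d k| <= (2 ^ h1)%N%:Z by case: (H k).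
exists (I * 'I_m)%type, (fun p : I * 'I_m => e p.1 * z ^+ p.2); split.
- by exists (i0, Ordinal m0); rewrite /= expr0 mulr1.
- by rewrite card_prod card_ord leq_mul2l /m; apply/orP; right; lia.
- pose D := \prod_k d k; pose D' k := \prod_(l | l != k) d l.
  have DE k : D = D' k * d k by rewrite /D (bigD1 k) //= mulrC.
  have bD : `|D| <= (2 ^ (m * h1))%N%:Z.
    by rewrite (le_trans (prod_norm_le _ bd)) // card_ord.
  have le : (m * h1 <= n.+1 * h1)%N by rewrite leq_mul2r; apply/orP; right; lia.
  (* The companion matrix of P in blocks, times the common denominator D: z raises the exponent by
     one, except in the last block, where z^m is expanded. *)
  exists D, (fun p q : I * 'I_m => if (p.2.+1 < m)%N
     then D * ((q.1 == p.1) && (q.2 == p.2.+1 :> nat))%:R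
     else D' q.2 * A q.2 p.1 q.1); split.
  + by apply/prodf_neq0 => k _; case: (H k).
  + by rewrite (le_trans bD) // lez_nat leq_exp2l.
  + move=> p q; apply: (@le_trans _ _ (2 ^ (m * h1))%N%:Z); last by rewrite lez_nat leq_exp2l.
    case: ifP => _.
      by case: (_ && _); rewrite ?mulr1 // mulr0 normr0.
    have -> : (m * h1 = #|'I_m| * h1)%N by rewrite card_ord.
    apply: prodD1_norm_le => //.
    by case: (H q.2) => _ _ bA _; apply: bA.
  + move=> [i j] /=; case lt: (j.+1 < m)%N.
      rewrite (bigD1 (i, Ordinal lt)) //= !eqxx mulr1 big1 ?addr0.
        by rewrite exprS; ring.
      move=> [i' j'] /= ne; case: eqP => [E1|]; last by rewrite mulr0 mul0r.
      case: eqP => [E2|]; last by rewrite mulr0 mul0r.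
      by case/eqP: ne; congr pair => //; apply: val_inj.
    have jm : j.+1 = m by move: (ltn_ord j); lia.
    rewrite -(pair_bigA _ (fun i' j' => (D' j' * A j' i i')%:~R * (e i' * z ^+ j'))) /=.
    rewrite exchange_big /=.
    have -> : D%:~R * z * (e i * z ^+ j) = \sum_(k < m) D%:~R * (c k * e i) * z ^+ k.
      rewrite (_ : D%:~R * z * (e i * z ^+ j) = D%:~R * e i * z ^+ m); last first.
        by rewrite -[in RHS]jm exprS; ring.
      by rewrite zm mulr_sumr; apply: eq_bigr => k _; ring.
    apply: eq_bigr => k _; have [_ _ _ aA] := H k.
    rewrite (DE k) (_ : _ * _ * _ = (D' k)%:~R * ((d k)%:~R * c k * e i) * z ^+ k); last first.
      by rewrite rmorphM /=; ring.
    rewrite aA mulr_sumr mulr_suml; apply: eq_bigr => i' _.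
    by rewrite rmorphM /=; ring.
- move=> h' x [dx [B [dx0 bdx bB aB]]].
  exists dx, (fun p q : I * 'I_m => B p.1 q.1 * (p.2 == q.2)%:R); split=> //.
    move=> p q; case: (_ == _); rewrite ?mulr1 ?bB // mulr0 normr0 lez_nat; exact: leq0n.
  move=> [i j] /=; rewrite mulrA aB.
  rewrite -(pair_bigA _ (fun i' j' => (B i i' * (j == j')%:R)%:~R * (e i' * z ^+ j'))) /=.
  rewrite mulr_suml; apply: eq_bigr => i' _.
  rewrite (bigD1 j) //= eqxx mulr1 big1 ?addr0 ?mulrA // => j' ne.
  by rewrite eq_sym (negPf ne) mulr0 mul0r.
- move=> zE [tau tauK tauE]; exists (fun p : I * 'I_m => (tau p.1, p.2)) => p /=.
    by rewrite tauK; case: p.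
  by rewrite rmorphM rmorphXn /= tauE zE.
Qed.

End Adjunction.

Lemma rat_bits0 : (rat_bits 0 = 4)%N.
Proof. by rewrite /rat_bits /int_bits /nat_bits. Qed.

Lemma rat_bits_ge q : (4 <= rat_bits q)%N.
Proof. by rewrite /rat_bits /int_bits /nat_bits; lia. Qed.

(** * A field containing lambda and gamma *)

Section BaseField.
Variables (R : rcfType) (M : 'M[rat]_3) (lambda : R[i]).
Let Mc : 'M[R[i]]_3 := map_mx ratr M.
Hypothesis eig : eigenvalue Mc lambda.

(** For a left eigenvector v, lambda acts through M on the first index, and exchanging the indices
    is conjugation; v alone need not be closed under it. *)
Definition eigen_base (v : 'rV[R[i]]_3) (p : 'I_3 * 'I_3) := v ord0 p.1 * (v ord0 p.2)^*.

Lemma conj_ratr (q : rat) : (ratr q : R[i])^* = ratr q.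
Proof. by rewrite fmorph_rat. Qed.

Lemma entry_bits i j : (rat_bits (M i j) <= mx_bits M)%N.
Proof.
rewrite /mx_bits (bigD1 i) //= (bigD1 j) //= -addnA; exact: leq_addr.
Qed.

Lemma eigen_base_rep : exists (I : finType) (e : I -> R[i]),
  [/\ exists i, e i != 0, #|I| = 9%N, conj_stable e & rep e (81 * mx_bits M)%N lambda].
Proof.
have /eigenvalueP [v vM v0] := eig.
exists ('I_3 * 'I_3)%type, (eigen_base v); split.
- have [j vj] : exists j, v ord0 j != 0.
    by apply/rV0Pn.
  by exists (j, j); rewrite /eigen_base mulf_neq0 // fmorph_eq0.
- by rewrite card_prod card_ord.
- exists (fun p => (p.2, p.1)) => [[i j]|p] //.
  by rewrite /eigen_base rmorphM /= conjCK mulrC.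
have -> : (81 = #|{: 'I_3 * 'I_3}| * #|{: 'I_3 * 'I_3}|)%N by rewrite card_prod card_ord.
apply: (@rep_rat_matrix R _ (eigen_base v) _ (fun p q => if q.2 == p.2 then M q.1 p.1 else 0)).
  move=> p q; case: ifP => _; first exact: entry_bits.
  by rewrite rat_bits0 (leq_trans (rat_bits_ge (M ord0 ord0))) // entry_bits.
move=> [i j] /=.
rewrite -(pair_bigA _ (fun k l => ratr (if l == j then M k i else 0) * eigen_base v (k, l))) /=.
have := congr1 (fun w : 'rV_3 => w ord0 i) vM; rewrite mxE [in RHS]mxE => E.
rewrite /eigen_base /= mulrA -E mulr_suml; apply: eq_bigr => k _.
rewrite (bigD1 j) //= eqxx big1 ?addr0.
  by rewrite [Mc k i]mxE [in RHS]mulrA [ratr _ * _]mulrC.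
by move=> l /negPf ->; rewrite rmorph0 mul0r.
Qed.


Hypothesis lambda0 : lambda != 0.

(** The heights in [base_field]: 81 b for lambda, then the product with its conjugate in dimension
    9, then its square root by [adjoin]; [base_height] adds the quotient in dimension 18. *)
Definition norm_height (b : nat) : nat :=
  let h := (9 + (81 * b + 81 * b))%N in (3 * (9 + (h + hinv 9 h)))%N.
Definition base_height (b : nat) : nat :=
  (18 + (norm_height b + hinv 18 (norm_height b)))%N.

(** The modulus of lambda is a root of a quadratic polynomial over the field of dimension 9, and it
    is real, so closure under conjugation is kept. *)
Lemma base_field : exists (I : finType) (e : I -> R[i]),
  [/\ exists i, e i != 0, (#|I| <= 18)%N, conj_stable e,
      rep e (base_height (mx_bits M)) lambda &
      rep e (base_height (mx_bits M)) (lambda / `|lambda|)].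
Proof.
have [I [e [e0 I9 conjI rl]]] := eigen_base_rep.
set b := mx_bits M in rl *; pose r := `|lambda|.
have r0 : r != 0 by rewrite normr_eq0.
have rE : r ^+ 2 = lambda * lambda^* by rewrite /r normCK.
have rc : r^* = r by apply: CrealP; rewrite normr_real.
pose P : {poly R[i]} := 'X^2 - (lambda * lambda^*)%:P.
have sP : size P = 3 by rewrite size_XnsubC.
have rll : rep e (9 + (81 * b + 81 * b))%N (lambda * lambda^*).
  by rewrite -{1}I9; apply: rep_mul => //; apply: rep_conj.
have rP k : rep e (9 + (81 * b + 81 * b))%N P`_k.
  rewrite coefB coefXn coefC; case: k => [|[|[|k]]] /=; rewrite ?sub0r ?subr0 ?oppr0.
  - exact: rep_opp.
  - exact: rep_zero.
  - exact: rep_one.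
  - exact: rep_zero.
have P0 : P != 0 by rewrite -size_poly_gt0 sP.
have Pr : root P r by rewrite /root !hornerE rE subrr.
have [J [f [f0 J18 rr inh cj]]] := adjoin P0 (eq_leq sP) rP Pr e0.
rewrite I9 in J18 rr.
have hE : (81 * b <= norm_height b)%N.
  by rewrite /norm_height; move: (hinv _ _) => x; lia.
have {}rl : rep f (norm_height b) lambda by apply: rep_mono hE _; apply: inh.
exists J, f; split=> //; first exact: cj.
  by apply: rep_mono rl; rewrite /base_height; move: (hinv _ _) => x; lia.
apply: rep_mono (rep_mul rl (rep_inv f0 r0 rr)).
by rewrite /base_height leq_add // leq_add // (hinv_mono J18 (leqnn _)).
Qed.

End BaseField.

(** * The orbit as a sum of powers of the eigenvalues *)

Section Eigenvalues.
Variables (R : rcfType) (M : 'M[rat]_3) (s : 'cV[rat]_3) (l : R[i]).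
Let Mc : 'M[R[i]]_3 := map_mx ratr M.
Hypothesis eig : eigenvalue Mc l.
Hypothesis l_nonreal : l^* != l.
Let y n i : R[i] := (Mc ^+ n *m map_mx ratr s) i ord0.

(** Read off the trace; [char_poly_roots] shows that it is the remaining root. *)
Definition third_eigenvalue : R[i] := \tr Mc - l - l^*.

Lemma map_ratr_conj (A : 'M[rat]_3) : map_mx (@Num.conj R[i]) (map_mx ratr A) = map_mx ratr A.
Proof. by apply/matrixP => i j; rewrite !mxE conj_ratr. Qed.

Lemma trace_conj : (\tr Mc)^* = \tr Mc.
Proof.
by rewrite /mxtrace rmorph_sum /=; apply: eq_bigr => i _; rewrite mxE conj_ratr.
Qed.

Lemma third_eigenvalue_conj : third_eigenvalue^* = third_eigenvalue.
Proof. by rewrite /third_eigenvalue !rmorphB /= conjCK trace_conj addrAC. Qed.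

(** The characteristic polynomial is rational, so the conjugate of l is a second root; the last
    linear factor is then determined by the trace. *)
Lemma char_poly_roots : char_poly Mc = ('X - l%:P) * ('X - (l^*)%:P) * ('X - third_eigenvalue%:P).
Proof.
have r1 : root (char_poly Mc) l by rewrite -eigenvalue_root_char.
have r2 : root (char_poly Mc) l^*.
  rewrite -[Mc](map_ratr_conj M) -map_char_poly /root horner_map /= fmorph_eq0 //.
have /uniq_roots_dvdp /(_ _) H : all (root (char_poly Mc)) [:: l; l^*] by rewrite /= r1 r2.
have {H} : ('X - l%:P) * ('X - (l^*)%:P) %| char_poly Mc.
  have := H; rewrite uniq_rootsE /= inE eq_sym l_nonreal big_cons big_seq1; exact.
move=> /dvdpP [Q QE]; rewrite QE mulrC; congr (_ * _).
have mP := char_poly_monic Mc; have sP := size_char_poly Mc.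
have m2 : ('X - l%:P) * ('X - (l^*)%:P) \is monic by rewrite monicMl ?monicXsubC.
have mQ : Q \is monic by rewrite -(monicMr _ m2) -QE.
have sQ : size Q = 2%N.
  move: sP; rewrite QE size_Mmonic ?monic_neq0 // size_Mmonic ?monicXsubC ?polyXsubC_eq0 //.
  by rewrite !size_XsubC addn3 => -[].
have Q1 : Q`_1 = 1 by move: mQ; rewrite monicE /lead_coef sQ => /eqP.
have QX : Q = 'X + (Q`_0)%:P.
  apply/polyP => k; rewrite coefD coefX coefC; case: k => [|[|k]] /=; rewrite ?add0r ?addr0 //.
  by rewrite nth_default // sQ.
have := char_poly_trace Mc (isT : (0 < 3)%N); rewrite QE [in LHS]QX /=.
have -> : ('X + (Q`_0)%:P) * (('X - l%:P) * ('X - (l^*)%:P)) =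
  'X^3 + (Q`_0 - l - l^*) *: 'X^2 + ((l * l^*) - Q`_0 * (l + l^*)) *: 'X + (Q`_0 * l * l^*)%:P.
  rewrite -!mul_polyC !polyCB !polyCM !polyCD; ring.
rewrite !coefD !coefZ !coefXn coefX coefC /= mulr0 mulr1 add0r !addr0 => E.
rewrite {1}QX; congr (_ + _); rewrite -polyCN; congr (_%:P).
by rewrite /third_eigenvalue -[\tr Mc]opprK -E; ring.
Qed.

Lemma orbit_rec n i : y n.+3 i = (l + l^* + third_eigenvalue) * y n.+2 i
  - (l * l^* + (l + l^*) * third_eigenvalue) * y n.+1 i + l * l^* * third_eigenvalue * y n i.
Proof.
have := Cayley_Hamilton Mc; rewrite char_poly_roots.
have -> : ('X - l%:P) * ('X - (l^*)%:P) * ('X - third_eigenvalue%:P) = 'X^3 - (l + l^* + third_eigenvalue)%:P * 'X^2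
   + (l * l^* + (l + l^*) * third_eigenvalue)%:P * 'X - (l * l^* * third_eigenvalue)%:P.
  rewrite !polyCD !polyCM !polyCD; ring.
move: (l + l^* + third_eigenvalue) (l * l^* + (l + l^*) * third_eigenvalue) (l * l^* * third_eigenvalue) => c1 c2 c3.
have -> : horner_mx Mc ('X^3 - c1%:P * 'X^2 + c2%:P * 'X - c3%:P) =
    Mc ^+ 3 - c1%:M *m Mc ^+ 2 + c2%:M *m Mc - c3%:M.
  rewrite rmorphB rmorphD rmorphB /= rmorphXn [horner_mx Mc (c1%:P * _)]rmorphM.
  by rewrite [horner_mx Mc (c2%:P * _)]rmorphM rmorphXn /= horner_mx_X !horner_mx_C.
move=> CH; have : (Mc ^+ 3 - c1%:M *m Mc ^+ 2 + c2%:M *m Mc - c3%:M) *m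
    (Mc ^+ n *m map_mx ratr s) = 0 by rewrite CH mul0mx.
have yE k : Mc ^+ k *m (Mc ^+ n *m map_mx ratr s) = Mc ^+ (k + n) *m map_mx ratr s.
  by rewrite mulmxA -[_ *m _ ^+ n]/(_ * _) -exprD.
move: (yE 3%N) (yE 2%N) (yE 1%N); rewrite expr1.
set u := Mc ^+ n *m _; move: (Mc ^+ 3) (Mc ^+ 2) => P3 P2 y3 y2 y1.
rewrite mulmxBl mulmxDl mulmxBl -!mulmxA y3 y2 y1 !mul_scalar_mx.
have comb (A B C D : 'cV[R[i]]_3) : (A - c1 *: B + c2 *: C - c3 *: D) i ord0 =
  A i ord0 - c1 * B i ord0 + c2 * C i ord0 - c3 * D i ord0 by rewrite !mxE.
move=> /(congr1 (fun A : 'cV_3 => A i ord0)); rewrite comb [X in _ = X -> _]mxE => /eqP.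
rewrite subr_eq0 => /eqP E; rewrite -[c3 * y n i]E -/(y n.+3 i) -/(y n.+2 i) -/(y n.+1 i); ring.
Qed.

(** The coefficient of a^n in the solution, with the initial values of the orbit, of the recurrence
    with distinct characteristic roots a, b, c. *)
Definition lagrange (a b c : R[i]) i := (y 2 i - (b + c) * y 1 i + b * c * y 0 i) / ((a - b) * (a - c)).

Definition mu (t : 'I_3) : R[i] := nth 0 [:: l; l^*; third_eigenvalue] t.
Definition amp (t : 'I_3) (i : 'I_3) : R[i] :=
  nth 0 [:: lagrange l l^* third_eigenvalue i; lagrange l^* l third_eigenvalue i; lagrange third_eigenvalue l l^* i] t.

Lemma third_eigenvalue_neq : (l != third_eigenvalue) && (l^* != third_eigenvalue).
Proof.
by apply/andP; split; apply: contra_neq l_nonreal => E; [rewrite E third_eigenvalue_conj | rewrite -[RHS]conjCK E third_eigenvalue_conj].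
Qed.

(** Both sides satisfy the same recurrence of order three, so n = 0, 1, 2 decide. The roots are
    distinct because l is not real and the third one is. *)
Lemma orbitE n i : y n i = \sum_t mu t ^+ n * amp t i.
Proof.
rewrite !big_ord_recl big_ord0 addr0 /mu /amp /=.
have /andP[n1 n2] := third_eigenvalue_neq.
have d1 : l - l^* != 0 by rewrite subr_eq0 eq_sym.
have d2 : l - third_eigenvalue != 0 by rewrite subr_eq0.
have d3 : l^* - third_eigenvalue != 0 by rewrite subr_eq0.
have d4 : l^* - l != 0 by rewrite subr_eq0.
have d5 : third_eigenvalue - l != 0 by rewrite subr_eq0 eq_sym.
have d6 : third_eigenvalue - l^* != 0 by rewrite subr_eq0 eq_sym.
have : [/\ y n i = l ^+ n * lagrange l l^* third_eigenvalue i + (l^* ^+ n * lagrange l^* l third_eigenvalue i + third_eigenvalue ^+ n * lagrange third_eigenvalue l l^* i),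
 y n.+1 i = l ^+ n.+1 * lagrange l l^* third_eigenvalue i + (l^* ^+ n.+1 * lagrange l^* l third_eigenvalue i + third_eigenvalue ^+ n.+1 * lagrange third_eigenvalue l l^* i) &
 y n.+2 i = l ^+ n.+2 * lagrange l l^* third_eigenvalue i + (l^* ^+ n.+2 * lagrange l^* l third_eigenvalue i + third_eigenvalue ^+ n.+2 * lagrange third_eigenvalue l l^* i)]; last by case.
elim: n => [|n [IH0 IH1 IH2]].
  rewrite /lagrange; move: (y 0%N i) (y 1%N i) (y 2%N i) => y0 y1 y2.
  by split; field; rewrite ?d1 ?d2 ?d3 ?d4 ?d5 ?d6.
split=> //; rewrite orbit_rec IH0 IH1 IH2 !exprS; ring.
Qed.



Variables (I : finType) (e : I -> R[i]) (h : nat).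
Hypotheses (e0 : exists i, e i != 0) (I18 : (#|I| <= 18)%N) (ec : conj_stable e)
  (rl : rep e h l) (Mh : (mx_bits M <= h)%N) (sh : (mx_bits s <= h)%N).

Lemma rep_mul18 h1 h2 x z : rep e h1 x -> rep e h2 z -> rep e (18 + (h1 + h2)) (x * z).
Proof. by move=> rx rz; apply: rep_mono (rep_mul rx rz); rewrite leq_add2r. Qed.

Lemma rep_sum3 h' (F : 'I_3 -> R[i]) :
  (forall j, rep e h' (F j)) -> rep e (3 * h'.+1) (\sum_j F j).
Proof. by move=> rF; have := rep_sum rF; rewrite card_ord. Qed.

Definition orbit_height (h : nat) : nat :=
  let h1 := (3 * (18 + (h + h)).+1)%N in let h2 := (3 * (18 + (h + h1)).+1)%N in
  (h2 + 2 * (2 * (h2 + h2).+1 + h2).+1)%N.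

Definition amp_height (h : nat) : nat :=
  let s := (2 * (h + h).+1)%N in
  let q := (2 * (h + (18 + (s + h))).+1)%N in
  let a := (2 * (q + (18 + (18 + (h + h) + h))).+1)%N in
  (18 + (a + hinv 18 (18 + (s + s))))%N.

Lemma orbit_rep : [/\ forall t i, (t <= 2)%N -> rep e (orbit_height h) (y t i),
  rep e (orbit_height h) l, rep e (orbit_height h) l^* & rep e (orbit_height h) third_eigenvalue].
Proof.
set h1 := (3 * (18 + (h + h)).+1)%N; set h2 := (3 * (18 + (h + h1)).+1)%N.
have h01 : (h <= h1)%N by rewrite /h1; lia.
have h12 : (h1 <= h2)%N by rewrite /h2; lia.
have h02 := leq_trans h01 h12.
have h2E : (h2 <= orbit_height h)%N by rewrite /orbit_height -/h1 -/h2 leq_addr.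
have rM i j : rep e h (Mc i j).
  by rewrite mxE; apply: rep_rat; apply: leq_trans Mh; exact: entry_bits.
have y0E i : y 0 i = ratr (s i ord0) by rewrite /y expr0 mul1mx mxE.
have ry0 i : rep e h (y 0 i).
  rewrite y0E; apply: rep_rat; apply: leq_trans sh.
  by rewrite /mx_bits (bigD1 i) //= big_ord_recl big_ord0 addn0 leq_addr.
have ystep n i : y n.+1 i = \sum_j Mc i j * y n j.
  by rewrite /y exprS -mulmxA [LHS]mxE.
have ry1 i : rep e h1 (y 1 i).
  by rewrite ystep /h1; apply: rep_sum3 => j; apply: rep_mul18.
have ry2 i : rep e h2 (y 2 i).
  by rewrite ystep /h2; apply: rep_sum3 => j; apply: rep_mul18.
have rc : rep e h l^* by apply: rep_conj.
have rt : rep e h2 (\tr Mc).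
  apply: (@rep_mono _ _ _ (3 * h.+1)); first by rewrite /h2; lia.
  by apply: rep_sum3 => j; apply: rM.
split.
- move=> [|[|[|t]]] i // _; apply: (rep_mono h2E); first exact: rep_mono (ry0 i).
    exact: rep_mono (ry1 i).
  exact: ry2.
- by apply: rep_mono rl; apply: leq_trans h2E.
- by apply: rep_mono rc; apply: leq_trans h2E.
apply: (@rep_mono _ _ _ (2 * (2 * (h2 + h2).+1 + h2).+1)).
  by rewrite /orbit_height -/h1 -/h2 leq_addl.
by apply: rep_sub; [apply: rep_sub => // | ]; [exact: rep_mono rl | exact: rep_mono rc].
Qed.

Lemma lagrange_rep H a b c i : (forall t i, (t <= 2)%N -> rep e H (y t i)) ->
  rep e H a -> rep e H b -> rep e H c -> a != b -> a != c ->
  rep e (amp_height H) (lagrange a b c i).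
Proof.
move=> ry ra rb rc nab nac.
have d0 : (a - b) * (a - c) != 0 by rewrite mulf_neq0 // subr_eq0.
apply: rep_mul18.
  apply: rep_add; last by apply: rep_mul18; [apply: rep_mul18 | exact: ry].
  apply: rep_sub; first exact: ry.
  by apply: rep_mul18; [apply: rep_add | exact: ry].
apply: (@rep_mono _ _ _ (hinv #|I| (18 + (2 * (H + H).+1 + 2 * (H + H).+1)))).
  by rewrite hinv_mono.
by apply: rep_inv => //; apply: rep_mul18; apply: rep_sub.
Qed.

Definition spectral_height : nat := orbit_height h + amp_height (orbit_height h).

Lemma spectral_rep t i : rep e spectral_height (mu t) /\ rep e spectral_height (amp t i).
Proof.
have [ry rl' rlc rt] := orbit_rep; have /andP[n1 n2] := third_eigenvalue_neq.
have n3 : l != l^* by rewrite eq_sym.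
split.
  apply: (@rep_mono _ _ _ (orbit_height h)); first exact: leq_addr.
  by case: t => [[|[|[|t]]] lt] //; rewrite /mu /=.
apply: (@rep_mono _ _ _ (amp_height (orbit_height h))); first exact: leq_addl.
case: t => [[|[|[|t]]] lt] //; rewrite /amp /=; apply: lagrange_rep => //; by rewrite eq_sym.
Qed.

End Eigenvalues.

Lemma bin_le_pow n k : ('C(n, k) <= 2 ^ n)%N.
Proof.
elim: n k => [|n IH] [|k]; rewrite ?bin0 ?expn_gt0 //.
by rewrite binS expnS mul2n -addnn leq_add.
Qed.

Lemma binomial_wide (C : comNzRingType) (x z : C) n K : (n < K)%N ->
  (x + z) ^+ n = \sum_(j < K) 'C(n, j)%:R * (x ^+ (n - j) * z ^+ j).
Proof.
move=> lt; rewrite exprDn (big_ord_widen _ (fun j => (x ^+ (n - j) * z ^+ j) *+ 'C(n, j)) lt).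
rewrite big_mkcond; apply: eq_bigr => j _; case: ifP => [_|/negbT]; first by rewrite mulr_natl.
by rewrite -leqNgt => le; rewrite bin_small // mul0r.
Qed.

(** The index set does not depend on n, terms out of range being killed by their binomial
    coefficients; so all monomials expand over one finite type. *)
Lemma trinomial (C : comNzRingType) (x z u : C) n K : (n < K)%N ->
  (x + (z + u)) ^+ n = \sum_(q : 'I_K * 'I_K) ('C(n, q.1) * 'C(q.1, q.2))%:R *
    (x ^+ (n - q.1) * z ^+ (q.1 - q.2) * u ^+ q.2).
Proof.
move=> lt; rewrite (binomial_wide _ _ lt).
rewrite -(pair_bigA _ (fun i j : 'I_K => ('C(n, i) * 'C(i, j))%:R *
  (x ^+ (n - i) * z ^+ (i - j) * u ^+ j))) /=.
apply: eq_bigr => i _; rewrite (binomial_wide z u (ltn_ord i)) !mulr_sumr.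
by apply: eq_bigr => j _; rewrite natrM; ring.
Qed.

Lemma term_split (C : comNzRingType) (B x1 x2 x3 X1 X2 X3 : C) a1 a2 a3 n :
  B * ((x1 ^+ n * X1) ^+ a1 * (x2 ^+ n * X2) ^+ a2 * (x3 ^+ n * X3) ^+ a3) =
  B * (X1 ^+ a1 * X2 ^+ a2 * X3 ^+ a3) * (x1 ^+ a1 * x2 ^+ a2 * x3 ^+ a3) ^+ n.
Proof.
rewrite !exprMn !(exprAC _ n) .
move: (X1 ^+ a1) (X2 ^+ a2) (X3 ^+ a3) (x1 ^+ a1 ^+ n) (x2 ^+ a2 ^+ n) (x3 ^+ a3 ^+ n).
by move=> *; ring.
Qed.

Lemma sum3_le (F : 'I_3 -> nat) K : (forall i, F i <= K)%N -> (\sum_i F i <= 3 * K)%N.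
Proof.
move=> H; have := @leq_sum _ (index_enum 'I_3) xpredT F (fun=> K) (fun i _ => H i).
by rewrite sum_nat_const card_ord.
Qed.

Section Coefficients.
Variable p : mpoly 3 int.
Let k := (mpoly.msize p).-1.+1.

Lemma card_monomials : (#|{: bmultinom 3 k}| <= mpoly_bits p)%N.
Proof.
rewrite /mpoly_bits -sum1_card leq_sum // => m _; by rewrite /int_bits.
Qed.

(** The coefficient list contains the zeros as well, so the powers of one variable already make it
    as long as the degree. *)
Lemma degree_bits : (k <= mpoly_bits p)%N.
Proof.
apply: leq_trans card_monomials.
have lt (j : 'I_k) : (mdeg (mnm_muln (mnm1 (ord0 : 'I_3)) j) < k)%N.
  by rewrite mdegMn mdeg1 mul1n.
rewrite -[k in (k <= _)%N]card_ord; apply: (@leq_card _ _ (fun j => BMultinom (lt j))).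
move=> i j /(congr1 (fun m : bmultinom 3 k => bmnm m ord0)) /=.
by rewrite !mulmnE !mnm1E eqxx !mul1n => /val_inj.
Qed.

Lemma coef_bits (m : bmultinom 3 k) : (int_bits (mcoeff (bmnm m) p) <= mpoly_bits p)%N.
Proof. by rewrite /mpoly_bits (bigD1 m) //= leq_addr. Qed.

Lemma exponent_bits (m : bmultinom 3 k) i : (bmnm m i < mpoly_bits p)%N.
Proof.
apply: leq_trans degree_bits; apply: leq_ltn_trans (bmdeg m).
by rewrite mdegE (bigD1 i) //= leq_addr.
Qed.

End Coefficients.

Section Expansion.
Variables (R : realType) (M : 'M[rat]_3) (s : 'cV[rat]_3) (l : R[i]).
Let Mc : 'M[R[i]]_3 := map_mx ratr M.
Hypothesis eig : eigenvalue Mc l.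
Hypothesis l_nonreal : l^* != l.

Lemma orbit_complex n i :
  (lds_orbit R M s n i ord0)%:C%C = (Mc ^+ n *m map_mx ratr s) i ord0.
Proof.
have E (A : 'M[rat]_3) : map_mx (real_complex R) (map_mx ratr A) = map_mx ratr A.
  by apply/matrixP => a b; rewrite !mxE fmorph_rat.
have E' (A : 'cV[rat]_3) : map_mx (real_complex R) (map_mx ratr A) = map_mx ratr A.
  by apply/matrixP => a b; rewrite !mxE fmorph_rat.
have -> : (lds_orbit R M s n i ord0)%:C%C = map_mx (real_complex R) (lds_orbit R M s n) i ord0.
  by rewrite [RHS]mxE.
by rewrite /lds_orbit map_mxM rmorphXn /= E E'.
Qed.

Variables (I : finType) (e : I -> R[i]) (h : nat).
Hypotheses (e0 : exists i, e i != 0) (I18 : (#|I| <= 18)%N) (ec : conj_stable e)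
  (rl : rep e h l) (Mh : (mx_bits M <= h)%N) (sh : (mx_bits s <= h)%N).

Lemma rep_prod3 h' (F : 'I_3 -> R[i]) :
  (forall j, rep e h' (F j)) -> rep e (3 * (18 + h')) (\prod_j F j).
Proof.
move=> /rep_prod; rewrite card_ord; apply: rep_mono.
by rewrite leq_mul2l leq_add2r I18.
Qed.

Definition term_height (h K : nat) : nat :=
  let P := (K * (18 + spectral_height h))%N in
  (18 + (K + 3 * (18 + (18 + (2 * K + (18 + (18 + (P + P) + P)))))))%N.

(** Besides the monomial, a term chooses two numbers below K for each coordinate, hence at most K^7
    terms. The exponents a and b are bounded because they become exponents of gamma; d enters only
    the moduli and signs. *)
Lemma expansion (p : mpoly 3 int) (K := mpoly_bits p) :
  exists (T : finType) (c : T -> R[i]) (a b d : T -> nat),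
  [/\ (#|T| <= K ^ 7)%N,
      forall n, (poly_at p (lds_orbit R M s n))%:C%C =
        \sum_t c t * (l ^+ a t * l^* ^+ b t * third_eigenvalue M l ^+ d t) ^+ n,
      forall t, (a t <= 3 * K)%N, forall t, (b t <= 3 * K)%N &
      forall t, rep e (term_height h K) (c t)].
Proof.
set k := (mpoly.msize p).-1.+1.
pose T := (bmultinom 3 k * {ffun 'I_3 -> 'I_K * 'I_K})%type.
pose bc (x : T) i := ('C(bmnm x.1 i, (x.2 i).1) * 'C((x.2 i).1, (x.2 i).2))%N.
pose A t i := amp M s l t i.
pose t0 := @ord0 2; pose t1 := lift (@ord0 2) (@ord0 1).
pose t2 := lift (@ord0 2) (lift (@ord0 1) (@ord0 0)).
pose c (x : T) : R[i] := (mcoeff (bmnm x.1) p)%:~R * \prod_i ((bc x i)%:R *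
  (A t0 i ^+ (bmnm x.1 i - (x.2 i).1) * A t1 i ^+ ((x.2 i).1 - (x.2 i).2) * A t2 i ^+ (x.2 i).2)).
pose a (x : T) := (\sum_i (bmnm x.1 i - (x.2 i).1))%N.
pose b (x : T) := (\sum_i ((x.2 i).1 - (x.2 i).2))%N.
pose d (x : T) := (\sum_i (x.2 i).2)%N.
exists T, c, a, b, d; split.
- rewrite card_prod card_ffun !card_ord card_prod card_ord mulnn -expnM expnS leq_mul //.
  exact: card_monomials.
- move=> n; rewrite /poly_at (mmapE k); last by rewrite /k leqSpred.
  rewrite rmorph_sum /=.
  rewrite -(pair_bigA _ (fun m f => c (m, f) * (l ^+ a (m, f) * l^* ^+ b (m, f) *
    third_eigenvalue M l ^+ d (m, f)) ^+ n)) /=; apply: eq_bigr => m _.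
  rewrite rmorphM /= rmorph_int /mmap1 rmorph_prod /=.
  under eq_bigr => i _.
    rewrite rmorphXn /= orbit_complex (orbitE _ eig l_nonreal) !big_ord_recl big_ord0 addr0.
    rewrite (trinomial _ _ _ (exponent_bits m i)); over.
  rewrite bigA_distr_bigA /= mulr_sumr; apply: eq_bigr => f _.
  rewrite /c -[RHS]mulrA; congr (_ * _).
  rewrite /a /b /d -!prodrXr -!big_split -prodrXl -big_split /=; apply: eq_bigr => i _.
  have [-> -> ->] : [/\ mu M l (@ord0 2) = l, mu M l (lift (@ord0 2) (@ord0 1)) = l^* &
    mu M l (lift (@ord0 2) (lift (@ord0 1) (@ord0 0))) = third_eigenvalue M l] by [].
  rewrite /A -/t0 -/t1 -/t2 /bc /=.
  exact: term_split.
- move=> x; apply: sum3_le => i.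
  by rewrite (leq_trans (leq_subr _ _)) // ltnW // exponent_bits.
- move=> x; apply: sum3_le => i.
  by rewrite (leq_trans (leq_subr _ _)) // ltnW.
move=> x; rewrite /c; apply: rep_mul18 => //.
  by apply: rep_int; apply: int_bits_ge; apply: coef_bits.
have pw t i q : (q <= K)%N -> rep e (K * (18 + spectral_height h))%N (A t i ^+ q).
  move=> le; apply: (@rep_mono _ _ _ (q * (#|I| + spectral_height h))%N).
    by rewrite leq_mul // leq_add.
  apply: rep_exp; apply: (spectral_rep eig l_nonreal e0 I18 ec rl Mh sh t i).2.
apply: rep_prod3 => i; apply: rep_mul18 => //; last first.
  apply: rep_mul18 => //; last by apply: pw; rewrite ltnW.
  apply: rep_mul18 => //; apply: pw; rewrite (leq_trans (leq_subr _ _)) // ltnW //.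
  exact: exponent_bits.
apply: (@rep_int _ _ _ _ (bc x i)%:Z); rewrite ger0_norm // lez_nat.
apply: (@leq_trans (2 ^ K * 2 ^ K)); last by rewrite -expnD addnn -mul2n.
by apply: leq_mul; rewrite (leq_trans (bin_le_pow _ _)) // leq_exp2l // ltnW // exponent_bits.
Qed.

End Expansion.

(** * Dominant terms *)

Lemma poly_lt_exp k a : exists N, forall l, (N <= l)%N -> (a * l.+1 ^ k <= 2 ^ l)%N.
Proof.
elim: k a => [|k IH] a.
  exists a => l le; rewrite expn0 muln1 (leq_trans le) // ltnW // ltn_expl //.
have [N HN] := IH (a * 2 ^ k.+1)%N; exists (2 * N).+1 => l le.
pose m := l./2; have mN : (N <= m)%N by rewrite /m; lia.
have lE : (l.+1 <= 2 * m.+1)%N by rewrite /m; lia.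
have := HN _ mN => {}HN.
apply: (@leq_trans (a * 2 ^ k.+1 * m.+1 ^ k * m.+1)).
  rewrite -!mulnA -[(m.+1 ^ k * _)%N]expnSr -expnMn leq_mul2l leq_exp2r // lE orbT //.
apply: (@leq_trans (2 ^ m * 2 ^ m)); first by rewrite leq_mul // ltn_expl.
by rewrite -expnD leq_exp2l // /m; lia.
Qed.

Section Slowly.
Variable R : realType.
Implicit Types u v : nat -> R.

(** Quasi-polynomial decay, l being a logarithm of n. The exponent 50 leaves room for the 41 that
    [baker_isolated] produces; products only change C. *)
Definition slowly u := exists C N : nat, forall n l : nat, (N <= n)%N -> (n <= 2 ^ l)%N ->
  (2 ^+ (C * l.+1 ^ 50))^-1 <= u n.

Lemma pow_lt (x : R) : exists n : nat, x <= 2 ^+ n.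
Proof.
exists (Num.bound `|x|); apply: (@le_trans _ _ (Num.bound `|x|)%:R).
  by apply/ltW/(le_lt_trans (ler_norm x))/archi_boundP.
by rewrite -natrX ler_nat ltnW // ltn_expl.
Qed.

Lemma slowly_const (a : R) : 0 < a -> slowly (fun=> a).
Proof.
move=> a0; have [C HC] := pow_lt a^-1; exists C, 0%N => n l _ _.
rewrite -[a]invrK lef_pV2 ?posrE ?exprn_gt0 ?invr_gt0 // (le_trans HC) // -!natrX ler_nat.
by rewrite leq_exp2l // leq_pmulr // expn_gt0.
Qed.

Lemma slowly_mul u v : slowly u -> slowly v -> slowly (fun n => u n * v n).
Proof.
move=> [C [N H]] [C' [N' H']]; exists (C + C')%N, (N + N')%N => n l le len.
rewrite mulnDl exprD invfM ler_pM ?invr_ge0 ?exprn_ge0 //.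
  by apply: H => //; lia.
by apply: H' => //; lia.
Qed.

Lemma slowly_mono u v : (exists N : nat, forall n : nat, (N <= n)%N -> u n <= v n) -> slowly u -> slowly v.
Proof.
move=> [N' H'] [C [N H]]; exists C, (N + N')%N => n l le len.
by rewrite (le_trans (H n l _ len)) ?H' //; lia.
Qed.

(** C (l + 1)^50 is polynomial in l, while n is of order 2^l. Bernoulli's inequality for 1 / q
    supplies an m with q^m <= 1/2. *)
Lemma slowly_beats_geometric u (q B : R) : 0 <= q -> q < 1 -> 0 <= B -> slowly u ->
  exists N, forall n, (N <= n)%N -> B * q ^+ n < u n.
Proof.
move=> q0 q1 B0 [C [N H]].
have [m m0 qm] : exists2 m, (0 < m)%N & q ^+ m <= 2^-1.
  have [->|qn0] := eqVneq q 0; first by exists 1%N; rewrite // expr1 invr_ge0.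
  have qp : 0 < q by rewrite lt0r qn0.
  pose a := q^-1 - 1; have a0 : 0 < a by rewrite subr_gt0 invf_gt1.
  pose m := (Num.bound a^-1).+1; exists m => //.
  have ma : 1 <= m%:R * a.
    rewrite -ler_pdivrMr // mul1r; apply: (@le_trans _ _ (Num.bound a^-1)%:R).
      by apply/ltW/archi_boundP; rewrite invr_ge0 ltW.
    by rewrite ler_nat.
  have bern n : 1 + n%:R * a <= (q^-1) ^+ n.
    elim: n => [|n IH]; first by rewrite mul0r addr0 expr0.
    have -> : q^-1 = 1 + a by rewrite /a addrC subrK.
    have n0 : 0 <= n%:R * a :> R by rewrite mulr_ge0 // ltW.
    rewrite exprS; move: IH; rewrite (_ : q^-1 = 1 + a); last by rewrite /a addrC subrK.
    move: (_ ^+ n) => z IH; rewrite -natr1; nra.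
  rewrite -[q]invrK exprVn lef_pV2 ?posrE ?exprn_gt0 ?invr_gt0 //.
  by have := bern m; lra.
have [b Bb] := pow_lt B.
have [L HL] := poly_lt_exp 50 (2 * (m * (b + C + 2)))%N.
exists (N + 2 ^ L + 1)%N => n le.
set l := (trunc_log 2 n).+1.
have n0 : (0 < n)%N by lia.
have lel : (2 ^ l.-1 <= n)%N by apply: trunc_logP.
have ltl : (n < 2 ^ l)%N by apply: trunc_log_ltn.
have Ll : (L <= l)%N by rewrite -(@leq_exp2l 2) //; lia.
have un := H n l _ (ltnW ltl); apply: lt_le_trans (un _); last by lia.
have {}HL : (m * (b + C + 2) * l.+1 ^ 50 <= 2 ^ l.-1)%N.
  by rewrite -(leq_pmul2l (isT : (0 < 2)%N)) mulnA -expnS; apply: HL.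
set P := (l.+1 ^ 50)%N in HL un *; have P0 : (0 < P)%N by rewrite expn_gt0.
have hn : (m * (b + C * P + 1) <= n)%N.
  apply: leq_trans (leq_trans HL lel); rewrite -mulnA leq_mul2l; apply/orP; right.
  rewrite !mulnDl; have : (b <= b * P)%N by rewrite leq_pmulr.
  by clear -P0; move: (b * P)%N (C * P)%N => u v; lia.
have : q ^+ n <= (2^-1) ^+ (b + C * P + 1).
  apply: (@le_trans _ _ (q ^+ (m * (b + C * P + 1)))).
    by rewrite ler_wiXn2l // ltW.
  by rewrite exprM lerXn2r ?nnegrE ?exprn_ge0 ?invr_ge0.
rewrite exprVn !exprD expr1 => le2.
have p2 k : 0 < 2 ^+ k :> R by rewrite exprn_gt0.
have : B * q ^+ n <= 2 ^+ b * (2 ^+ b * 2 ^+ (C * P) * 2)^-1.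
  by rewrite ler_pM // exprn_ge0.
move/le_lt_trans; apply.
rewrite -mulrA invfM mulrA mulfV ?gt_eqF // mul1r ltf_pV2 ?posrE ?mulr_gt0 //.
by rewrite ltr_pMr // ltr1n.
Qed.

End Slowly.

(** * The sign of a real exponential sum *)

Section Signs.
Variables (R : realType) (gam : R[i]) (theta : R).
Hypothesis gamE : gam = cis theta.
Hypothesis gam_free : forall n, (0 < n)%N -> gam ^+ n <> 1.

Definition isolated (z : R[i]) := exists C : nat, forall n l : nat, (0 < n)%N -> (n <= 2 ^ l)%N ->
  gam ^+ n <> z -> (2 ^+ (C * l.+1 ^ 50))^-1 <= nm (gam ^+ n - z).

Let gam1 n : nm (gam ^+ n) = 1. Proof. by rewrite (gamX gamE) nm_cis. Qed.

(** On the circle, gam^n = z for at most one n; off the circle the two moduli differ by a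
    constant. *)
Lemma slowly_root z : (nm z = 1 -> isolated z) -> slowly (fun n => nm (gam ^+ n - z)).
Proof.
have [z1 /(_ z1) [C HC]|nz1 _] := eqVneq (nm z) 1.
  have [N HN] : exists N : nat, forall n, (N <= n)%N -> gam ^+ n <> z.
    have [[m mz]|nex] := pselect (exists m, gam ^+ m = z); last first.
      by exists 0%N => n _ E; apply: nex; exists n.
    by exists m.+1 => n lt E; move: lt; rewrite (gamX_inj gamE gam_free (etrans E (esym mz))) ltnn.
  by exists C, N.+1 => n l le len; apply: HC => //; [lia | apply: HN; lia].
apply: (@slowly_mono _ (fun=> `|1 - nm z|)); last first.
  by apply: slowly_const; rewrite normr_gt0 subr_eq0 eq_sym.
exists 0%N => n _; have := nmD (gam ^+ n - z) z; have := nmD (z - gam ^+ n) (gam ^+ n).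
by rewrite !subrK gam1 nmBC ler_norml; lra.
Qed.

Lemma slowly_poly (P : {poly R[i]}) : P != 0 ->
  (forall z, root P z -> nm z = 1 -> isolated z) -> slowly (fun n => nm P.[gam ^+ n]).
Proof.
move=> P0 H; have [rs PE] := closed_field_poly_normal P.
apply: (@slowly_mono _ (fun n => nm (lead_coef P) * \prod_(z <- rs) nm (gam ^+ n - z))).
  exists 0%N => n _; rewrite [X in _ <= nm X.[_]]PE hornerZ nmM horner_prod.
  by rewrite nm_prod; under [in leRHS]eq_bigr do rewrite hornerXsubC.
apply: slowly_mul; first by apply: slowly_const; rewrite nm_gt0 lead_coef_eq0.
have {}H z : z \in rs -> nm z = 1 -> isolated z.
  by move=> zr; apply: H; rewrite PE rootZ ?lead_coef_eq0 // root_prod_XsubC.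
elim: rs {PE} H => [|z rs IH] H.
  apply: (@slowly_mono _ (fun=> 1)); last exact: slowly_const.
  by exists 0%N => n _; rewrite big_nil.
apply: (@slowly_mono _ (fun n => nm (gam ^+ n - z) * \prod_(z <- rs) nm (gam ^+ n - z))).
  by exists 0%N => n _; rewrite big_cons.
apply: slowly_mul; first by apply: slowly_root; apply: H; rewrite inE eqxx.
by apply: IH => z' z'r; apply: H; rewrite inE z'r orbT.
Qed.

Variables (T : finType) (c : T -> R[i]) (w : T -> R) (ex : T -> nat) (E : nat).
Hypothesis w0 : forall t, 0 <= w t.
Hypothesis exE : forall t, (ex t <= 2 * E)%N.
Variables (g : nat -> R) (par : bool).
Hypothesis gE : forall n, (0 < n)%N -> odd n = par ->
  (g n)%:C%C * gam ^+ (E * n) = \sum_t c t * (w t)%:C%C ^+ n * gam ^+ (ex t * n).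

(* The real part of the terms of modulus [w k ^+ n], as a polynomial in
   [gam ^+ n], multiplied by [2 * gam ^+ (E * n)]. *)
Definition wave_poly k : {poly R[i]} :=
  \sum_(t | w t == w k) (c t *: 'X^(ex t) + (c t)^* *: 'X^(2 * E - ex t)).

Let conjc_cis t : (cis t)^* = cis (- t) :> R[i]. Proof. exact: cis_conj. Qed.

Let conjr (x : R) : (x%:C%C)^* = x%:C%C :> R[i]. Proof. exact: conjc_real. Qed.

Lemma gamV n : (gam ^+ n)^* = (gam ^+ n)^-1.
Proof.
rewrite (gamX gamE) conjc_cis; apply: (mulfI (cis_neq0 (n%:R * theta))).
by rewrite mulfV ?cis_neq0 // -cisD subrr cis0.
Qed.

(** A sum over all k meets each group of equal modulus once per member; dividing by [mult] corrects
    this without an index type for the groups. *)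
Definition mult k : R := #|[pred t | w t == w k]|%:R.

Lemma mult_gt0 k : 0 < mult k.
Proof. by rewrite ltr0n; apply/card_gt0P; exists k; rewrite inE. Qed.

(** The equation for g is added to its conjugate, which exchanges ex t with 2 E - ex t and keeps g
    because it is real. *)
Lemma g_sum n : (0 < n)%N -> odd n = par ->
  (2 * g n)%:C%C * gam ^+ (E * n) = \sum_k ((mult k)^-1 * w k ^+ n)%:C%C * (wave_poly k).[gam ^+ n].
Proof.
move=> n0 pn.
pose f t := (w t)%:C%C ^+ n * (c t * gam ^+ (ex t * n) + (c t)^* * gam ^+ ((2 * E - ex t) * n)).
have lhs : (2 * g n)%:C%C * gam ^+ (E * n) = \sum_t f t.
  have e1 := gE n0 pn.
  have e2 : (g n)%:C%C * gam ^+ (E * n) =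
      \sum_t (c t)^* * (w t)%:C%C ^+ n * gam ^+ ((2 * E - ex t) * n).
    have := congr1 Num.conj e1; rewrite rmorphM /= rmorph_sum /= gamV conjr.
    move=> /(congr1 (fun u => u * gam ^+ (2 * E * n))).
    rewrite -mulrA (_ : _^-1 * _ = gam ^+ (E * n)); last first.
      rewrite -mulnA mul2n -addnn exprD mulKf ?(gamX_neq0 gamE) //.
    move=> ->; rewrite mulr_suml; apply: eq_bigr => t _.
    rewrite !rmorphM /= rmorphXn /= gamV conjr -[LHS]mulrA; congr (_ * _).
    rewrite (_ : (2 * E * n = ex t * n + (2 * E - ex t) * n)%N).
      by rewrite exprD mulKf ?(gamX_neq0 gamE).
    by rewrite -mulnDl subnKC.
  have -> : (2 * g n)%:C%C = (g n)%:C%C + (g n)%:C%C by rewrite -rmorphD /=; congr (_%:C)%C; ring.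
  rewrite mulrDl {1}e1 e2 -big_split /=; apply: eq_bigr => t _; rewrite /f; ring.
rewrite lhs.
have GE k : (w k)%:C%C ^+ n * (wave_poly k).[gam ^+ n] = \sum_(t | w t == w k) f t.
  rewrite /wave_poly horner_sum mulr_sumr; apply: eq_bigr => t /eqP wE.
  by rewrite !hornerE -!exprM /f wE ![(n * _)%N]mulnC.
transitivity (\sum_k (mult k)^-1%:C%C * \sum_(t | w t == w k) f t); last first.
  by apply: eq_bigr => k _; rewrite -GE mulrA [in RHS]rmorphM /= rmorphXn.
under [RHS]eq_bigr do rewrite mulr_sumr.
rewrite (exchange_big_dep predT) //=; apply: eq_bigr => t _.
rewrite (eq_bigr (fun=> ((mult t)^-1)%:C%C * f t)); last first.
  by move=> k /eqP wE; rewrite /mult; congr ((_^-1)%:C%C * _); congr (_%:R); apply: eq_card => u; rewrite !inE wE.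
rewrite sumr_const -mulr_natl; set A := #|_|.
have -> : A%:R = (mult t)%:C%C :> R[i].
  rewrite /mult rmorph_nat; congr (_%:R); apply: eq_card => u.
  by rewrite !inE unfold_in eq_sym.
by rewrite mulrA -rmorphM /= mulfV ?gt_eqF ?mult_gt0 // mul1r.
Qed.

(** [wave_poly] on the circle divided by e^(i E t): a real continuous function, to which the
    intermediate value theorem applies. *)
Definition wave k (t : R) : R := \sum_(j | w j == w k)
  2 * (complex.Re (c j) * cos (((ex j)%:R - E%:R) * t) - complex.Im (c j) * sin (((ex j)%:R - E%:R) * t)).

Lemma waveE k t : cis (- (E%:R * t)) * (wave_poly k).[cis t] = (wave k t)%:C%C.
Proof.
rewrite /wave_poly horner_sum mulr_sumr /wave rmorph_sum /=; apply: eq_bigr => j _.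
rewrite !hornerE -!cisMn mulrDr !(mulrCA (cis _)) -!cisD.
have -> : - (E%:R * t) + (ex j)%:R * t = ((ex j)%:R - E%:R) * t by ring.
have -> : - (E%:R * t) + (2 * E - ex j)%:R * t = - (((ex j)%:R - E%:R) * t).
  by rewrite natrB // natrM; ring.
rewrite /cis cosN sinN; case: (c j) => a b.
move: (cos _) (sin _) => C S; apply/eqP; rewrite eq_complex /=; apply/andP; split; apply/eqP; ring.
Qed.

Lemma wave_norm k t : `|wave k t| = nm (wave_poly k).[cis t].
Proof. by rewrite -nm_real -waveE nmM nm_cis mul1r. Qed.

Lemma wave_continuous k : continuous (wave k).
Proof.
have sum_cont (F : T -> R -> R) (r : seq T) : (forall j, continuous (F j)) ->
    continuous (fun t => \sum_(j <- r | w j == w k) F j t).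
  move=> Fc; elim: r => [|j r IH].
    by under eq_fun do rewrite big_nil; move=> t; exact: cvg_cst.
  under eq_fun do rewrite big_cons; case wj: (w j == w k) => // t.
  exact: (continuousD (Fc j t) (IH t)).
have lin (a : R) : continuous (fun t : R => a * t).
  by move=> t; apply: cvgMl_tmp; exact: cvg_id.
apply: sum_cont => j t; apply: cvgMl_tmp; apply: cvgB; apply: cvgMl_tmp.
  exact: (continuous_comp (lin _ t) (@continuous_cos R _)).
exact: (continuous_comp (lin _ t) (@continuous_sin R _)).
Qed.

Lemma wave_bound : exists2 B : R, 0 <= B & forall k t, `|wave k t| <= B.
Proof.
exists (\sum_j 4 * nm (c j)); first by apply: sumr_ge0 => j _; rewrite mulr_ge0 ?nm_ge0.
move=> k t; rewrite /wave big_mkcond; apply: le_trans (ler_norm_sum _ _ _) _.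
apply: ler_sum => j _; case: ifP => _; last by rewrite normr0 mulr_ge0 ?nm_ge0.
have := Re_le_nm (c j); have := Im_le_nm (c j).
set x := ((ex j)%:R - E%:R) * t.
have := cos_le1 x; have := cos_geN1 x; have := sin_le1 x; have := sin_geN1 x.
move: (cos x) (sin x) (complex.Re _) (complex.Im _) (nm _) => C S a b m s1 s2 c1 c2 bm am.
have c3 : `|C| <= 1 by rewrite ler_norml c1.
have s3 : `|S| <= 1 by rewrite ler_norml s1.
rewrite normrM ger0_norm // (_ : 4 * m = 2 * (m + m)); last by ring.
rewrite ler_pM2l // (le_trans (ler_normB _ _)) // !normrM lerD //.
  by rewrite (le_trans _ am) // ler_piMr.
by rewrite (le_trans _ bm) // ler_piMr.
Qed.

Lemma g_wave n x : (0 < n)%N -> odd n = par -> cis x = gam ^+ n ->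
  2 * g n = \sum_k (mult k)^-1 * w k ^+ n * wave k x.
Proof.
move=> n0 pn xE; apply: (fmorph_inj (real_complex R)); rewrite /= rmorph_sum /=.
transitivity (cis (- (E%:R * x)) * ((2 * g n)%:C%C * gam ^+ (E * n))).
  rewrite mulrCA mulnC exprM -xE -cisMn -cisD addrC subrr cis0 mulr1 //.
rewrite g_sum // mulr_sumr; apply: eq_bigr => k _.
by rewrite mulrCA -xE waveE -rmorphM.
Qed.

Hypothesis sepG : forall k z, wave_poly k != 0 -> root (wave_poly k) z -> nm z = 1 -> isolated z.

(** Moduli 0 disappear for n > 0, and so do groups with zero polynomial; k has the largest modulus
    among the others. Relative to w_k^n the lower groups decay geometrically, but wave k only
    slowly, so g is eventually nonzero with the sign of wave k. This settles strict and weak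
    inequalities at once. *)
Theorem dominant : (forall n, (0 < n)%N -> odd n = par -> g n = 0) \/
  exists k, wave_poly k != 0 /\ exists N, forall n n' x y, (N <= n)%N -> (N <= n')%N ->
    odd n = par -> odd n' = par -> cis x = gam ^+ n -> cis y = gam ^+ n' ->
    (forall t, x <= t <= y \/ y <= t <= x -> ~~ root (wave_poly k) (cis t)) ->
    (0 < g n -> 0 < g n') /\ (0 <= g n -> 0 <= g n').
Proof.
pose S := [pred k | (0 < w k) && (wave_poly k != 0)].
have wave0 k x : wave_poly k = 0 -> wave k x = 0.
  by move=> G0; apply/normr0_eq0; rewrite wave_norm G0 horner0 nm0.
have [k1 Sk1|S0] := pickP S; last first.
  left=> n n0 pn; have := @g_wave n (n%:R * theta) n0 pn (esym (gamX gamE n)).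
  rewrite big1 => [/eqP|k _]; first by rewrite mulf_eq0 pnatr_eq0 => /eqP.
  have := S0 k; rewrite inE => /negbT; rewrite negb_and negbK -leNgt => /orP[le|/eqP G0].
    have -> : w k = 0 by apply/eqP; rewrite eq_le le w0.
    by rewrite expr0n gtn_eqF // mulr0 mul0r.
  by rewrite wave0 // mulr0.
right; pose k := [arg max_(k > k1 | S k) w k]%O; exists k.
have [] : S k /\ forall j, S j -> w j <= w k.
  by rewrite /k; case: arg_maxP => // i Si le; split.
rewrite inE => /andP[wk Gk] kmax; split=> //.
pose q := \big[Num.max/0]_(j | w j < w k) (w j / w k).
have q0 : 0 <= q by exact: bigmax_ge_id.
have q1 : q < 1 by apply: bigmax_lt => // j lt; rewrite ltr_pdivrMr // mul1r.
have qle j : w j < w k -> w j / w k <= q by move=> lt; apply: le_bigmax_cond.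
pose t0 := \sum_(j | w j == w k) (mult j)^-1.
have t00 : 0 < t0.
  rewrite /t0 (bigD1 k) //= ltr_wpDr ?invr_gt0 ?mult_gt0 //.
  by apply: sumr_ge0 => j _; rewrite invr_ge0 ltW // mult_gt0.
have [B B0 HB] := wave_bound.
have sl : slowly (fun n => t0 * nm (wave_poly k).[gam ^+ n]).
  apply: slowly_mul; first exact: slowly_const.
  by apply: slowly_poly => // z; apply: sepG.
have BT0 : 0 <= #|T|%:R * B by rewrite mulr_ge0.
have [N HN] := slowly_beats_geometric q0 q1 BT0 sl.
have key n x : (N < n)%N -> odd n = par -> cis x = gam ^+ n ->
    [/\ wave k x != 0, 0 < g n -> 0 < wave k x, 0 <= g n -> 0 < wave k x & 0 < wave k x -> 0 < g n].
  move=> ltn pn xE; have n0 : (0 < n)%N by lia.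
  have wn : 0 < w k ^+ n by rewrite exprn_gt0.
  pose r := \sum_(j | w j < w k) (mult j)^-1 * (w j / w k) ^+ n * wave j x.
  have gE2 : 2 * g n = w k ^+ n * (t0 * wave k x + r).
    rewrite (g_wave n0 pn xE) (bigID (fun j => w j < w k)) /= [RHS]mulrDr addrC; congr (_ + _).
      rewrite (bigID (fun j => w j == w k)) /= [X in _ + X]big1 ?addr0; last first.
        move=> j /andP[]; rewrite -leNgt => le ne.
        have lt : w k < w j by rewrite lt_neqAle eq_sym ne.
        rewrite wave0 ?mulr0 //; apply/eqP; apply: contraTT lt => Gj; rewrite -leNgt.
        by apply: kmax; rewrite inE Gj andbT (lt_le_trans wk).
      rewrite /t0 mulr_suml mulr_sumr; apply: eq_big => [j|j /andP[_ /eqP wE]].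
        by case: eqP => [->|]; rewrite ?ltxx ?andbF.
      have -> : wave j x = wave k x by rewrite /wave wE.
      by rewrite wE; ring.
    rewrite mulr_sumr; apply: eq_bigr => j _.
    have wn0 : w k ^+ n != 0 by rewrite gt_eqF.
    by rewrite expr_div_n; field; rewrite ?wn0 ?(gt_eqF (mult_gt0 _)) ?(gt_eqF wk).
  have rB : `|r| <= #|T|%:R * B * q ^+ n.
    apply: le_trans (ler_norm_sum _ _ _) _.
    apply: (@le_trans _ _ (\sum_(j : T) B * q ^+ n)); last first.
      by rewrite sumr_const -[leLHS]mulr_natl mulrA.
    rewrite big_mkcond; apply: ler_sum => j _; case: ifP => [lt|_]; last first.
      by rewrite mulr_ge0 // exprn_ge0.
    have m1 : 1 <= mult j by rewrite ler1n; apply/card_gt0P; exists j; rewrite inE.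
    have wjk : 0 <= w j / w k by rewrite divr_ge0 // w0.
    rewrite !normrM mulrC ler_pM ?mulr_ge0 ?HB //.
    rewrite ger0_norm ?invr_ge0 ?(ltW (mult_gt0 _)) // normrX ger0_norm //.
    rewrite -[leRHS]mul1r ler_pM ?invr_ge0 ?exprn_ge0 ?(ltW (mult_gt0 _)) //.
      by rewrite invf_le1 // mult_gt0.
    by rewrite lerXn2r ?nnegrE // qle.
  have := HN n (ltnW ltn); rewrite -xE -wave_norm => lt.
  have nz : wave k x != 0.
    apply/eqP => w00; move: lt; rewrite w00 normr0 mulr0 ltNge => /negP; apply.
    by apply: le_trans rB.
  have rlt : `|r| < t0 * `|wave k x| by apply: le_lt_trans lt.
  have sg : 0 <= g n -> 0 < wave k x.
    move=> gn; rewrite lt0r nz leNgt; apply/negP => neg.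
    have : 0 <= w k ^+ n * (t0 * wave k x + r) by rewrite -gE2 mulr_ge0.
    rewrite pmulr_rge0 //; move: rlt; rewrite (ltr0_norm neg) mulrN.
    have := ler_norm r; lra.
  split=> //; first by move=> /ltW.
  move=> pos; have : 0 < w k ^+ n * (t0 * wave k x + r).
    rewrite mulr_gt0 //; move: rlt; rewrite (gtr0_norm pos).
    have := ler_norm (- r); rewrite normrN; lra.
  by rewrite -gE2; lra.
exists N.+1 => n n' x y len len' pn pn' xE yE nr.
have [nzx s1 s2 s3] := key n x len pn xE.
have [nzy s1' s2' s3'] := key n' y len' pn' yE.
have wt t : x <= t <= y \/ y <= t <= x -> wave k t <> 0.
  move=> /nr /negP rt wt0; apply: rt; rewrite /root -nm_eq0.
  by rewrite -wave_norm wt0 normr0.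
have same : 0 < wave k x -> 0 < wave k y.
  move=> px; rewrite lt0r nzy leNgt; apply/negP => ny.
  have wc a b : {within `[a, b], continuous (wave k)}.
    exact/continuous_subspaceT/wave_continuous.
  have [lexy|ltyx] := leP x y.
    have [|z] := @IVT R (wave k) x y 0 lexy (wc _ _).
      by rewrite ge_min le_max (ltW ny) (ltW px) orbT.
    by rewrite in_itv /= => zin z0; apply: (wt z) => //; left.
  have [|z] := @IVT R (wave k) y x 0 (ltW ltyx) (wc _ _).
    by rewrite ge_min le_max (ltW ny) (ltW px) orbT.
  by rewrite in_itv /= => zin z0; apply: (wt z) => //; right.
by split=> [/s1|/s2] /same /s3' // /ltW.
Qed.

End Signs.

(** * Two specializations of the lower bound *)

Lemma exponent_size W y l : (20 <= W)%N -> (W <= y)%N -> (0 < l)%N ->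
  (W * (l + 12 * y + 5) <= y ^ 3 * l)%N.
Proof.
move=> W20 Wy l0.
have h1 : (l + 12 * y + 5 <= 18 * (y * l))%N.
  have : (l <= y * l)%N by rewrite leq_pmull; lia.
  have : (y <= y * l)%N by rewrite leq_pmulr.
  by move: (y * l)%N => z; lia.
apply: (@leq_trans (W * (18 * (y * l)))); first by rewrite leq_mul2l h1 orbT.
rewrite !expnS expn0 muln1 !mulnA leq_mul2r; apply/orP; right.
by rewrite leq_mul2r; apply/orP; right; rewrite leq_mul //; lia.
Qed.

Lemma exponent_total W y l : (20 <= W)%N -> (W <= y)%N -> (0 < l)%N ->
  (y ^ 28 * (W * (l + 12 * y + 5)) + 20 * y <= y ^ 40 * l)%N.
Proof.
move=> W20 Wy l0; have y0 : (20 <= y)%N by lia.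
apply: (@leq_trans (y ^ 28 * (y ^ 3 * l) + y * y)).
  by rewrite leq_add // leq_mul // exponent_size.
rewrite mulnA -expnD (_ : (28 + 3 = 31)%N) //.
have le1 : (y * y <= y ^ 31 * l)%N.
  by rewrite -[(y * y)%N]/(y ^ 2)%N (leq_trans (n := (y ^ 31)%N)) ?leq_pmulr // leq_exp2l //; lia.
apply: (@leq_trans (y ^ 32 * l)); last by rewrite leq_mul2r leq_exp2l ?orbT //; lia.
rewrite [(y ^ 32)%N]expnS -mulnA; move: le1; move: (y ^ 31 * l)%N (y * y)%N => a b.
by move=> le1; apply: (@leq_trans (2 * a)); [lia | rewrite leq_mul2r; lia].
Qed.

Section BakerForms.
Variables (R : realType) (I : finType) (e : I -> R[i]) (h : nat) (gam alp : R[i]).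
Hypotheses (e0 : exists i, e i != 0) (gam1 : nm gam = 1) (alp1 : nm alp = 1).
Hypotheses (rg : rep e h gam) (ra : rep e h alp).
Hypothesis gam_free : forall n, (0 < n)%N -> gam ^+ n <> 1.
Variables (d W : nat).
Hypotheses (d_ge : (1000 <= d)%N) (W_ge1 : (d * (d * d) * #|I| ^ 2 <= W)%N)
  (W_ge2 : (4000 * #|I| <= W)%N) (W_ge3 : (#|I| + h <= W)%N).

Let N0 : (0 < #|I|)%N. Proof. by have [i _] := e0; apply/card_gt0P; exists i. Qed.
Let W20 : (700 <= W)%N.
Proof. by move: W_ge2 N0; move: #|I| => N; lia. Qed.

(** W absorbs the dimension and the heights, leaving y and s0 to be chosen. The total exponent is
    about y^31 l; 40 leaves a margin. *)
Lemma baker_form y s0 l k : (W * s0.+1 <= y)%N -> (W * W <= y)%N ->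
  (W * (l + 12 * y + 5) <= 2 ^ s0)%N -> (0 < l)%N -> (0 < k)%N -> (k <= 2 ^ l)%N ->
  gam ^+ k <> alp -> (2 ^+ (y ^ 40 * l))^-1 <= nm (gam ^+ k - alp).
Proof.
move=> c1 c2 c3 l0 k0 kl ne.
have Wy : (W <= y)%N by apply: leq_trans c2; rewrite leq_pmulr; lia.
have SW : (4000 * #|I| * (l + 12 * y + 5) <= W * (l + 12 * y + 5))%N by rewrite leq_mul2r W_ge2 orbT.
have := @baker R I e h gam alp e0 gam1 alp1 rg ra gam_free y l s0 d _ d_ge _ _ erefl
  (leq_trans SW c3) k k0 kl ne.
have -> : (d * (d * d) * #|I| ^ 2 * s0.+1 <= y)%N.
  by apply: leq_trans c1; rewrite leq_mul2r W_ge1 orbT.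
have -> : (400 * #|I| * (#|I| + h) <= y)%N.
  apply: leq_trans c2; rewrite leq_mul // (leq_trans _ W_ge2) // leq_mul2r; lia.
move=> /(_ isT isT); apply: le_trans.
rewrite lef_pV2 ?posrE ?exprn_gt0 // -!natrX ler_nat leq_exp2l //.
apply: leq_trans (exponent_total (leq_trans _ W20) Wy l0); last by lia.
by rewrite leq_add2r leq_mul2l SW orbT.
Qed.

Lemma pow_W k : (W ^ k <= 2 ^ (W * k))%N.
Proof. by case: k => [|k]; rewrite ?muln0 // expnM leq_exp2r // ltnW // ltn_expl. Qed.

(** For a quasi-polynomial bound y may grow with l: y = W^3 (l + 1) gives the exponent W^120 (l +
    1)^41. *)
Lemma baker_isolated : isolated gam alp.
Proof.
exists (W ^ 120)%N => n l n0 nl ne.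
have := @baker_form (W ^ 3 * l.+1) (9 * W + 4 * l.+1) l.+1 n _ _ _ isT n0 _ ne.
have -> : (n <= 2 ^ l.+1)%N by rewrite (leq_trans nl) // leq_exp2l.
have W0 : (0 < W)%N by lia.
have -> : (W * W <= W ^ 3 * l.+1)%N.
  by rewrite -[(W * W)%N]/(W ^ 2)%N (leq_trans (n := (W ^ 3)%N)) ?leq_pmulr // leq_exp2l //; lia.
have -> : (W * (9 * W + 4 * l.+1).+1 <= W ^ 3 * l.+1)%N.
  rewrite expnS -mulnA leq_mul2l; apply/orP; right.
  rewrite expnS expn1 -mulnA.
  have : (W <= W * l.+1)%N by rewrite leq_pmulr.
  have : (l.+1 <= W * l.+1)%N by rewrite leq_pmull.
  have : (14 * (W * l.+1) <= W * (W * l.+1))%N by rewrite leq_mul2r; lia.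
  by move: (W * (W * l.+1))%N (W * l.+1)%N => a b; lia.
have -> : (W * (l.+1 + 12 * (W ^ 3 * l.+1) + 5) <= 2 ^ (9 * W + 4 * l.+1))%N.
  apply: leq_trans (exponent_size _ _ _) _ => //; first by lia.
    rewrite expnS -mulnA leq_pmulr // muln_gt0 expn_gt0 W0 //.
  rewrite expnMn -expnM -[(3 * 3)%N]/9%N -mulnA -expnSr expnD leq_mul //.
    by rewrite mulnC pow_W.
  by rewrite mulnC expnM leq_exp2r // ltnW // ltn_expl.
move=> /(_ isT isT isT isT); apply: le_trans.
rewrite lef_pV2 ?posrE ?exprn_gt0 // -!natrX ler_nat leq_exp2l //.
rewrite expnMn -expnM -[(3 * 40)%N]/120%N -mulnA leq_mul2l -expnSr leq_pexp2l ?orbT //.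
Qed.

(** The size of l enters the conditions only through 2^s0, and in this range its logarithm fits into
    s0 = W^3. So y = W^8 can be chosen independently of l, and the exponent is linear in l with
    slope (W^8)^40. *)
Lemma baker_sep D l k : (D < W)%N -> (l <= (40 * (W ^ 320) ^ 2) ^ D.+1)%N ->
  (0 < k)%N -> (k <= 2 ^ l.+1)%N -> gam ^+ k <> alp ->
  (2 ^+ (W ^ 320 * l.+1))^-1 <= nm (gam ^+ k - alp).
Proof.
move=> DW ll k0 kl ne; have W0 : (0 < W)%N by lia.
have := @baker_form (W ^ 8) (W ^ 3) l.+1 k _ _ _ isT k0 kl ne.
have W1 : (1 < W)%N by lia.
have -> : (W * W <= W ^ 8)%N by rewrite -[(W * W)%N]/(W ^ 2)%N leq_exp2l.
have -> : (W * (W ^ 3).+1 <= W ^ 8)%N.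
  apply: (@leq_trans (W * (W * W ^ 3))); last by rewrite -!expnS leq_exp2l.
  rewrite leq_mul2l; apply/orP; right; have : (0 < W ^ 3)%N by rewrite expn_gt0 W0.
  by move=> p; apply: (@leq_trans (2 * W ^ 3)); [lia | rewrite leq_mul2r W1 orbT].
have -> : (W * (l.+1 + 12 * W ^ 8 + 5) <= 2 ^ W ^ 3)%N.
  apply: leq_trans (exponent_size _ _ _) _ => //; first by lia.
    by rewrite expnS leq_pmulr // expn_gt0 W0.
  have lW : (l.+1 <= W ^ (641 * D.+1 + 1))%N.
    rewrite addn1 expnS; clear ne; apply: (@leq_trans (2 * W ^ (641 * D.+1))); last by rewrite leq_mul2r W1 orbT.
    have : (l <= W ^ (641 * D.+1))%N.
      apply: leq_trans ll _; rewrite expnM leq_exp2r // -expnM [(W ^ 641)%N]expnS leq_mul //; lia.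
    have : (0 < W ^ (641 * D.+1))%N by rewrite expn_gt0 W0.
    by clear; move: (W ^ (641 * D.+1))%N => z; lia.
  clear ll; apply: (@leq_trans (W ^ (24 + (641 * D.+1 + 1)))).
    by rewrite [(W ^ (24 + _))%N]expnD leq_mul // -expnM.
  clear lW; apply: leq_trans (pow_W _) _; rewrite leq_exp2l // expnS leq_mul2l; apply/orP; right.
  rewrite expnS expn1; apply: (@leq_trans (W * D.+1)); last by rewrite leq_mul2l DW orbT.
  by apply: (@leq_trans (700 * D.+1)); [lia | rewrite leq_mul2r W20 orbT].
move=> /(_ isT isT isT); by rewrite -expnM.
Qed.

End BakerForms.

(** * Explicit bounds *)

(** These functions follow the constructions when all input sizes are at most X: at most X^7 terms
    in an expansion, wave polynomials of degree at most 6 X, and a base field of dimension at most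
    18. *)
Definition coef_height X := (X ^ 7 * (2 * (term_height (base_height X) X +
  term_height (base_height X) X).+1).+1)%N.
Definition dim1 X := (18 * (6 * X))%N.
Definition dim2 X := (dim1 X * (6 * X))%N.
Definition height1 X := ((6 * X).+1 * (18 + (coef_height X + hinv 18 (coef_height X))))%N.
Definition height2 X := ((6 * X).+1 * (dim1 X + (coef_height X + hinv (dim1 X) (coef_height X))))%N.
Definition pair_height X := (base_height X + height1 X + height2 X)%N.
Definition quot_height X := (dim2 X + (pair_height X +
  (dim2 X + (pair_height X + hinv (dim2 X) (pair_height X)))))%N.
Definition weight_of d n q x := (d * (d * d) * n ^ 2 + 4000 * n + (n + q) + x.+1)%N.
Definition weight X := weight_of (X + 1000) (dim2 X) (quot_height X) X.

Lemma weight_of_bounds d n q x N h (W := weight_of d n q x) : (N <= n)%N -> (h <= q)%N ->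
  [/\ (d * (d * d) * N ^ 2 <= W)%N, (4000 * N <= W)%N, (N + h <= W)%N & (x < W)%N].
Proof.
move=> le1 le2; rewrite /W /weight_of.
have sq : (d * (d * d) * N ^ 2 <= d * (d * d) * n ^ 2)%N by rewrite leq_mul2l leq_exp2r // le1 orbT.
move: (d * _ * _)%N (d * _ * _)%N sq => u v sq; split; lia.
Qed.

Lemma base_height_mono b b' : (b <= b')%N -> (base_height b <= base_height b')%N.
Proof.
move=> le; have le1 : (norm_height b <= norm_height b')%N.
  by rewrite /norm_height leq_mul // leq_add // leq_add ?hinv_mono // leq_add // leq_add // leq_mul.
by rewrite /base_height leq_add // leq_add // hinv_mono.
Qed.

Lemma base_height_ge b : (b <= base_height b)%N.
Proof.
have le : (b <= norm_height b)%N by rewrite /norm_height; move: (hinv _ _) => u; lia.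
by rewrite /base_height; move: le; move: (hinv _ _) => u; lia.
Qed.

Lemma term_height_mono h K K' : (K <= K')%N -> (term_height h K <= term_height h K')%N.
Proof.
move=> le; rewrite /term_height; set P := (K * _)%N; set P' := (K' * _)%N.
have : (P <= P')%N by rewrite leq_mul2r le orbT.
by move: P P' => P P'; lia.
Qed.

(** * The points where atoms can change *)

Section Effective.
Variables (R : realType) (M : 'M[rat]_3) (s : 'cV[rat]_3) (l : R[i]).
Hypothesis eig : eigenvalue (map_mx ratr M : 'M[R[i]]_3) l.
Hypothesis l_nonreal : l^* != l.
Let gam := l / `|l|.
Hypothesis gam_free : forall n, (0 < n)%N -> gam ^+ n <> 1.
Variable X : nat.
Hypotheses (X2 : (2 <= X)%N) (MX : (mx_bits M <= X)%N) (sX : (mx_bits s <= X)%N).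

Let l0 : l != 0. Proof. by apply: contra_neq l_nonreal => ->; rewrite rmorph0. Qed.

Lemma gam_norm : nm gam = 1.
Proof.
have r0 : nm l != 0 by rewrite nm_eq0.
by rewrite /gam nmM nmV nmE nm_real ger0_norm ?nm_ge0 // mulfV.
Qed.

Variables (I : finType) (e : I -> R[i]).
Hypotheses (e0 : exists i, e i != 0) (I18 : (#|I| <= 18)%N) (ec : conj_stable e)
  (rl : rep e (base_height X) l) (rg : rep e (base_height X) gam).

(** The algebraic complexity shared by the zeros of all atoms; 6 X is twice the bound 3 X on the
    exponents of l and its conjugate. *)
Definition tame (z : R[i]) := exists P : {poly R[i]},
  [/\ P != 0, (size P <= (6 * X).+1)%N, forall k, rep e (coef_height X) P`_k & root P z].

Lemma tame1 : tame 1.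
Proof.
exists ('X - 1%:P); split.
- by rewrite polyXsubC_eq0.
- by rewrite size_XsubC; lia.
- move=> k; rewrite coefB coefX coefC; case: k => [|[|k]] /=; rewrite ?sub0r ?subr0 ?oppr0.
  + by apply: rep_opp; apply: rep_one.
  + exact: rep_one.
  + exact: rep_zero.
- by rewrite root_XsubC.
Qed.

Lemma pair_field z z' : tame z -> tame z' -> exists (J : finType) (f : J -> R[i]),
  [/\ exists j, f j != 0, (#|J| <= dim2 X)%N, rep f (pair_height X) gam,
      rep f (pair_height X) z & rep f (pair_height X) z'].
Proof.
move=> [P [P0 sP rP Pz]] [Q [Q0 sQ rQ Qz]].
have [J1 [f1 [f10 J1N rz in1 _]]] := adjoin P0 sP rP Pz e0.
have {}rQ k : rep f1 (coef_height X) Q`_k by apply: in1.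
have [J2 [f2 [f20 J2N rz' in2 _]]] := adjoin Q0 sQ rQ Qz f10.
have dJ1 : (#|J1| <= dim1 X)%N by rewrite (leq_trans J1N) // leq_mul2r I18 orbT.
exists J2, f2; split=> //.
- by rewrite (leq_trans J2N) // leq_mul2r dJ1 orbT.
- apply: (@rep_mono _ _ _ (base_height X)); first by rewrite /pair_height -addnA leq_addr.
  exact/in2/in1.
- apply/in2; apply: rep_mono rz; apply: (@leq_trans (height1 X)).
    by rewrite /height1 leq_mul2l leq_add ?orbT // leq_add // hinv_mono.
  by rewrite /pair_height addnAC leq_addl.
- apply: rep_mono rz'; apply: (@leq_trans (height2 X)).
    by rewrite /height2 leq_mul2l leq_add ?orbT // leq_add // hinv_mono.
  by rewrite /pair_height leq_addl.
Qed.

(* The factor gam turns a relation with exponent k into one with exponent k + 1,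
   which covers k = 0. *)
Lemma quotient_field z z' : tame z -> tame z' -> z != 0 -> exists (J : finType) (f : J -> R[i]),
  [/\ exists j, f j != 0, (#|J| <= dim2 X)%N, rep f (quot_height X) gam,
      rep f (quot_height X) z & rep f (quot_height X) (gam * (z' / z))].
Proof.
move=> az az' z0; have [J [f [f0 JN rfg rz rz']]] := pair_field az az'.
have le : (pair_height X <= quot_height X)%N.
  by rewrite /quot_height addnCA leq_addr.
exists J, f; split=> //; [exact: rep_mono rfg | exact: rep_mono rz | ].
apply: rep_mono (rep_mul rfg (rep_mul rz' (rep_inv f0 z0 rz))).
by rewrite /quot_height leq_add // leq_add // leq_add // leq_add // hinv_mono.
Qed.

Let W := weight X.

Lemma tame_isolated z : tame z -> nm z = 1 -> isolated gam z.
Proof.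
move=> az z1; have z0 : z != 0 by rewrite -nm_eq0 z1 oner_eq0.
have [J [f [f0 JN rfg rz _]]] := quotient_field az az z0.
have [d2 d3 d4 _] := weight_of_bounds (X + 1000) X JN (leqnn (quot_height X)).
exact: (baker_isolated f0 gam_norm z1 rfg rz gam_free (leq_addl X 1000) d2 d3 d4).
Qed.

Lemma tame_sep D q k z z' : (D <= X)%N -> (q <= (40 * (W ^ 320) ^ 2) ^ D.+1)%N -> (k <= 2 ^ q)%N ->
  tame z -> tame z' -> nm z = 1 -> nm z' = 1 -> gam ^+ k * z <> z' ->
  (2 ^+ (W ^ 320 * q.+1))^-1 <= nm (gam ^+ k * z - z').
Proof.
move=> DX ql kq az az' z1 z1' ne; have z0 : z != 0 by rewrite -nm_eq0 z1 oner_eq0.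
have [J [f [f0 JN rfg rz rq]]] := quotient_field az az' z0.
have [d2 d3 d4 XW] := weight_of_bounds (X + 1000) X JN (leqnn (quot_height X)).
have g1 := gam_norm; have g0 : gam != 0 by rewrite -nm_eq0 g1 oner_eq0.
have a1 : nm (gam * (z' / z)) = 1 by rewrite nmM g1 nmM nmV z1 z1' invr1 !mulr1.
have DW : (D < W)%N by apply: leq_ltn_trans XW.
have E : gam ^+ k.+1 - gam * (z' / z) = gam * ((gam ^+ k * z - z') / z).
  by rewrite exprS mulrBl mulfK // mulrBr.
have := @baker_sep _ _ _ _ _ _ f0 g1 a1 rfg rq gam_free _ _ (leq_addl X 1000) d2 d3 d4 D q k.+1 DW ql isT.
rewrite E nmM g1 mul1r nmM nmV z1 invr1 mulr1; apply.
  have : (0 < 2 ^ q)%N by rewrite expn_gt0.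
  by rewrite expnS; move: kq; move: (2 ^ q)%N => u; lia.
rewrite exprS => /(mulfI g0) E2; apply: ne; by rewrite E2 divfK.
Qed.


Let E := (3 * X)%N.
Let rho : R := complex.Re (third_eigenvalue M l).

Lemma third_eigenvalue_real : third_eigenvalue M l = rho%:C%C.
Proof.
have := third_eigenvalue_conj M l; rewrite /rho; case: (third_eigenvalue M l) => a b /eqP.
by rewrite eq_complex /= => /andP[_ /eqP bb]; congr (_ +i* _)%C; lra.
Qed.

Let conjr (x : R) : (x%:C%C)^* = x%:C%C :> R[i]. Proof. exact: conjc_real. Qed.

Lemma gam_conj : gam * gam^* = 1.
Proof. by rewrite -normCK nmE gam_norm expr1n. Qed.

Lemma l_polar : l = (nm l)%:C%C * gam.
Proof. by rewrite /gam nmE mulrCA mulfV ?mulr1 // -nmE normr_eq0. Qed.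

(** The factor gam^E makes the exponent of gamma nonnegative, so that polynomials in gamma arise. *)
Lemma term_shape a b d : (b <= E)%N ->
  l ^+ a * l^* ^+ b * third_eigenvalue M l ^+ d * gam ^+ E =
  (nm l ^+ (a + b) * rho ^+ d)%:C%C * gam ^+ (E + a - b).
Proof.
move=> bE; have g0 : gam != 0 by rewrite -nm_eq0 gam_norm oner_eq0.
have lc : l^* = (nm l)%:C%C * gam^-1.
  rewrite {1}l_polar rmorphM /= conjr; congr (_ * _).
  by apply: (mulfI g0); rewrite gam_conj mulfV.
rewrite {1}l_polar lc third_eigenvalue_real !rmorphM /= !rmorphXn /= exprD.
move: ((nm l)%:C%C) (rho%:C%C) gam g0 {lc} => r u G g0.
have -> : (E + a - b = a + (E - b))%N by lia.
rewrite [G ^+ (a + _)]exprD -{1}(subnK bE) [G ^+ (_ + b)]exprD !exprMn exprVn.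
have gb : G ^+ b != 0 by rewrite expf_neq0.
move: (G ^+ b) gb (G ^+ a) (G ^+ (E - b)) (r ^+ a) (r ^+ b) (u ^+ d) => x x0 ? ? ? ? ?.
by field.
Qed.

(* The sign of [rho ^+ (d * n)] depends on n only through its parity. *)
Definition parity_sign (par : bool) d : R := if rho < 0 then (-1) ^+ (d * par) else 1.

Lemma parity_signE par d n : odd n = par ->
  (rho ^+ d) ^+ n = parity_sign par d * (`|rho| ^+ d) ^+ n.
Proof.
move=> pn; rewrite /parity_sign; case: ltP => [neg|nn]; last by rewrite mul1r ger0_norm.
rewrite ltr0_norm // [(- rho) ^+ d]exprNn exprMn mulrA -[(-1) ^+ d ^+ n]exprM -exprD -signr_odd.
by rewrite oddD !oddM pn oddb addbb expr0 mul1r.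
Qed.

Lemma parity_signP par d : parity_sign par d = 1 \/ parity_sign par d = -1.
Proof.
rewrite /parity_sign; case: ifP => _; last by left.
by rewrite -signr_odd; case: (odd _); [right | left].
Qed.

Lemma rep_sumT h (T : finType) k (F : T -> R[i]) : (#|T| <= k)%N ->
  (forall t, rep e h (F t)) -> rep e (k * h.+1) (\sum_t F t).
Proof. by move=> le /rep_sum; apply: rep_mono; rewrite leq_mul2r le orbT. Qed.

Variables (theta : R).
Hypothesis gamE : gam = cis theta.

(** For a fixed parity the sign of rho^(d n) is constant in n and moves into the coefficients, which
    leaves nonnegative moduli for [dominant]. If g vanishes on this parity class, no zeros are
    recorded. *)
Lemma atom_zeros (p : mpoly 3 int) par (g := fun n => poly_at p (lds_orbit R M s n)) :
  (mpoly_bits p <= X)%N ->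
  exists rs : seq R[i], (forall z, z \in rs -> nm z = 1 /\ tame z) /\
  exists N : nat, forall n n' x y, (N <= n)%N -> (N <= n')%N -> odd n = par -> odd n' = par ->
    cis x = gam ^+ n -> cis y = gam ^+ n' ->
    (forall t, x <= t <= y \/ y <= t <= x -> cis t \notin rs) ->
    (0 < g n -> 0 < g n') /\ (0 <= g n -> 0 <= g n').
Proof.
move=> pX; have Mh := leq_trans MX (base_height_ge X); have sh := leq_trans sX (base_height_ge X).
have [T [c [a [b [d [cT gsum aE bE rc]]]]]] := expansion eig l_nonreal e0 I18 ec rl Mh sh p.
have {}aE t : (a t <= E)%N by rewrite (leq_trans (aE t)) // leq_mul2l pX orbT.
have {}bE t : (b t <= E)%N by rewrite (leq_trans (bE t)) // leq_mul2l pX orbT.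
have {}cT : (#|T| <= X ^ 7)%N by rewrite (leq_trans cT) // leq_exp2r.
pose H := term_height (base_height X) X.
pose c' t := c t * (parity_sign par (d t))%:C%C.
have {}rc t : rep e H (c' t).
  have rct : rep e H (c t) by apply: rep_mono (rc t); exact: term_height_mono.
  rewrite /c'; have [->|->] := parity_signP par (d t); first by rewrite mulr1.
  by rewrite rmorphN mulrN mulr1; apply: rep_opp.
pose w t := nm l ^+ (a t + b t) * `|rho| ^+ d t.
pose ex t := (E + a t - b t)%N.
have w0 t : 0 <= w t by rewrite mulr_ge0 // exprn_ge0 // nm_ge0.
have exE t : (ex t <= 2 * E)%N by rewrite /ex; have := aE t; lia.
have gE n : (0 < n)%N -> odd n = par ->
    (g n)%:C%C * gam ^+ (E * n) = \sum_t c' t * (w t)%:C%C ^+ n * gam ^+ (ex t * n).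
  move=> n0 pn; rewrite /g gsum mulr_suml; apply: eq_bigr => t _.
  rewrite exprM -mulrA -exprMn (term_shape _ _ (bE t)) exprMn /c' /w -exprM.
  rewrite -!mulrA; congr (_ * _); rewrite mulrA; congr (_ * _).
  rewrite -!rmorphXn -rmorphM /=; congr (_%:C)%C.
  by rewrite !exprMn (parity_signE _ pn); ring.
have rG k j : rep e (coef_height X) (wave_poly c' w ex E k)`_j.
  rewrite /wave_poly coef_sum big_mkcond /coef_height; apply: rep_sumT => // t.
  case: ifP => _; last exact: rep_zero.
  rewrite coefD !coefZ !coefXn; apply: rep_add.
    by case: (_ == _); rewrite ?mulr1 // mulr0; exact: rep_zero.
  by case: (_ == _); rewrite ?mulr1 ?mulr0; [apply: rep_conj | exact: rep_zero].
have sG k : (size (wave_poly c' w ex E k) <= (6 * X).+1)%N.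
  have lt j : (j <= 2 * E)%N -> (size ('X^j : {poly R[i]}) <= (6 * X).+1)%N.
    by rewrite size_polyXn /E; lia.
  apply: leq_trans (size_sum _ _ _) _; apply/bigmax_leqP => t _.
  apply: leq_trans (size_polyD _ _) _; rewrite geq_max.
  by rewrite !(leq_trans (size_scale_leq _ _)) ?lt ?leq_subr.
have admG k z : wave_poly c' w ex E k != 0 -> root (wave_poly c' w ex E k) z -> tame z.
  by move=> G0 Gz; exists (wave_poly c' w ex E k).
have iso k z : wave_poly c' w ex E k != 0 -> root (wave_poly c' w ex E k) z -> nm z = 1 -> isolated gam z.
  by move=> G0 Gz; apply: tame_isolated; apply: admG Gz.
have [g0|[k [G0 [N HN]]]] := dominant gamE gam_free w0 exE gE iso.
  exists [::]; split=> //; exists 1%N => n n' x y n1 n1' pn pn' _ _ _.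
  by rewrite !g0 // ltxx.
have [rs rsE] := closed_field_poly_normal (wave_poly c' w ex E k).
have rootE z : root (wave_poly c' w ex E k) z = (z \in rs).
  by rewrite rsE rootZ ?lead_coef_eq0 // root_prod_XsubC.
exists [seq z <- rs | nm z == 1]; split.
  by move=> z; rewrite mem_filter => /andP[/eqP z1 zr]; split=> //; apply: (admG k) => //; rewrite rootE.
exists N => n n' x y len len' pn pn' xE yE fr; apply: (HN n n' x y) => // t /fr.
by rewrite mem_filter nm_cis eqxx rootE.
Qed.

End Effective.

(** With A = W^320, 40 A^2 is at most W^641, and W^(321 + 641 D) is at most 2^(W (321 + 641 D)); the
    last exponent is at most W^3. *)
Lemma final_exponent W D : (700 <= W)%N -> (D < W)%N ->
  (3 * W ^ 320 * (40 * (W ^ 320) ^ 2) ^ D <= 2 ^ (W ^ 3))%N.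
Proof.
move=> W700 DW; have W0 : (0 < W)%N by lia.
apply: (@leq_trans (W ^ (321 + 641 * D))).
  rewrite expnD leq_mul //; first by rewrite [(W ^ 321)%N]expnS leq_mul2r; lia.
  case: D {DW} => [|D]; first by rewrite muln0.
  by rewrite expnM leq_exp2r // -expnM [(W ^ 641)%N]expnS leq_mul //; lia.
apply: leq_trans (pow_W _ _) _; rewrite leq_exp2l // expnS leq_mul2l; apply/orP; right.
rewrite expnS expn1; apply: (@leq_trans (W * D.+1)); last by rewrite leq_mul2l DW orbT.
by apply: (@leq_trans (700 * D.+1)); [lia | rewrite leq_mul2r W700 orbT].
Qed.

(** * Polynomial growth of the weight *)

(** From X = 2 on, constants and sums are absorbed by the exponent. The exponent of the theorem is
    thus obtained from closure properties, without being computed. *)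
Definition polybounded (f : nat -> nat) := exists c, forall X, (2 <= X)%N -> (f X <= X ^ c)%N.

Lemma pb_const k : polybounded (fun=> k).
Proof.
exists k => X X2; apply: (@leq_trans (2 ^ k)); first by rewrite ltnW // ltn_expl.
by case: k => // k; rewrite leq_exp2r.
Qed.

Lemma pb_id : polybounded id. Proof. by exists 1%N => X _; rewrite expn1. Qed.

Lemma pb_add f g : polybounded f -> polybounded g -> polybounded (fun X => f X + g X)%N.
Proof.
move=> [a Ha] [b Hb]; exists (a + b).+1 => X X2; have X0 : (0 < X)%N by lia.
rewrite expnS; apply: (@leq_trans (2 * X ^ (a + b))); last by rewrite leq_mul2r X2 orbT.
rewrite mul2n -addnn leq_add //.
  by rewrite (leq_trans (Ha X X2)) // leq_pexp2l // leq_addr.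
by rewrite (leq_trans (Hb X X2)) // leq_pexp2l // leq_addl.
Qed.

Lemma pb_mul f g : polybounded f -> polybounded g -> polybounded (fun X => f X * g X)%N.
Proof. by move=> [a Ha] [b Hb]; exists (a + b)%N => X X2; rewrite expnD leq_mul ?Ha ?Hb. Qed.

Lemma pb_S f : polybounded f -> polybounded (fun X => (f X).+1).
Proof.
by move=> H; have [c Hc] := pb_add (pb_const 1) H; exists c.
Qed.

Lemma pb_exp f k : polybounded f -> polybounded (fun X => f X ^ k)%N.
Proof.
move=> H; elim: k => [|k IH]; first exact: pb_const.
by have [c Hc] := pb_mul H IH; exists c => X X2; rewrite expnS Hc.
Qed.

Lemma pb_hinv f g : polybounded f -> polybounded g -> polybounded (fun X => hinv (f X) (g X)).
Proof.
move=> Hf Hg; have H4 := pb_const 4.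
exact: pb_add (pb_add (pb_add (pb_mul (pb_mul H4 Hf) (pb_add Hf Hg)) (pb_mul H4 Hf)) Hg) (pb_const 3).
Qed.

Ltac pb := cbv beta zeta; repeat lazymatch goal with
  | |- polybounded (fun _ => ?k) => exact (pb_const k)
  | |- polybounded (fun x => x) => exact pb_id
  | |- polybounded (fun x => addn (@?f x) (@?g x)) => apply (@pb_add f g)
  | |- polybounded (fun x => muln (@?f x) (@?g x)) => apply (@pb_mul f g)
  | |- polybounded (fun x => hinv (@?f x) (@?g x)) => apply (@pb_hinv f g)
  | |- polybounded (fun x => expn (@?f x) ?k) => apply (@pb_exp f k)
  | |- polybounded (fun x => S (@?f x)) => apply (@pb_S f)
  | H : polybounded ?g |- polybounded ?g => exact H
  | |- polybounded (fun x => ?h x) => match goal with H : polybounded h |- _ => exact H end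
  end.

Lemma pb_base_height : polybounded base_height.
Proof.
have H : polybounded norm_height by rewrite /norm_height; pb.
by rewrite /base_height; pb.
Qed.

Lemma pb_term_height f g : polybounded f -> polybounded g ->
  polybounded (fun X => term_height (f X) (g X)).
Proof.
move=> Hf Hg.
have ho : polybounded (fun X => orbit_height (f X)) by rewrite /orbit_height; pb.
have ha h : polybounded h -> polybounded (fun X => amp_height (h X)) by move=> Hh; rewrite /amp_height; pb.
have hs : polybounded (fun X => spectral_height (f X)).
  by rewrite /spectral_height; apply: pb_add => //; apply: ha.
by rewrite /term_height; pb.
Qed.

Lemma pb_weight : polybounded weight.
Proof.
have hb := pb_base_height; have ht := pb_term_height hb pb_id.
have hc : polybounded coef_height by rewrite /coef_height; pb.
have d1 : polybounded dim1 by rewrite /dim1; pb.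
have d2 : polybounded dim2 by rewrite /dim2; pb.
have h1 : polybounded height1 by rewrite /height1; pb.
have h2 : polybounded height2 by rewrite /height2; pb.
have hp : polybounded pair_height by rewrite /pair_height; pb.
have hq : polybounded quot_height by rewrite /quot_height; pb.
by rewrite /weight /weight_of; pb.
Qed.

(** * The bound for one formula *)

Section Component.
Variables (R : realType) (M : 'M[rat]_3) (s : 'cV[rat]_3) (l : R[i]).
Hypothesis eig : eigenvalue (map_mx ratr M : 'M[R[i]]_3) l.
Hypothesis l_nonreal : l^* != l.
Let gam := l / `|l|.
Hypothesis gam_free : forall n, (0 < n)%N -> gam ^+ n <> 1.
Variables (m : nat) (T : 'I_m -> atom) (phi : ltl m).
Variable X : nat.
Hypotheses (X2 : (2 <= X)%N) (MX : (mx_bits M <= X)%N) (sX : (mx_bits s <= X)%N).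
Hypothesis dX : (depth phi <= X)%N.
Hypothesis TX : forall i, occurs i phi -> (atom_bits (T i) <= X)%N.

Lemma weight_ge : (700 <= weight X)%N /\ (X < weight X)%N.
Proof.
have [_ H _ lt] := weight_of_bounds (X + 1000) X (leqnn (dim2 X)) (leqnn (quot_height X)).
split; last by exact: lt.
apply: leq_trans H; have : (0 < dim2 X)%N by rewrite /dim2 /dim1 !muln_gt0 (leq_trans _ X2).
by move: (dim2 X) => n; lia.
Qed.

Lemma component_length J Ac L : is_Jset (Zset R M s T phi) gam J -> arc_component J Ac L ->
  (2 ^+ (2 ^ weight X ^ 3))^-1 <= L.
Proof.
move=> Js comp; have l0 : l != 0 by apply: contra_neq l_nonreal => ->; rewrite rmorph0.
have [I [e [e0 I18 ec rl0 rg0]]] := base_field eig l0.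
have rl : rep e (base_height X) l by apply: rep_mono rl0; exact: base_height_mono.
have rg : rep e (base_height X) gam by apply: rep_mono rg0; exact: base_height_mono.
have [theta _ gamE] := cis_surj (gam_norm l_nonreal).
have /choice [rs rsP] : forall ib : 'I_m * bool, exists rs : seq R[i], occurs ib.1 phi ->
    (forall z, z \in rs -> nm z = 1 /\ tame X e z) /\
    exists N : nat, forall n n' x y, (N <= n)%N -> (N <= n')%N -> odd n = ib.2 -> odd n' = ib.2 ->
    cis x = gam ^+ n -> cis y = gam ^+ n' ->
    (forall t, x <= t <= y \/ y <= t <= x -> cis t \notin rs) ->
    let g := fun n => poly_at (atom_poly (T ib.1)) (lds_orbit R M s n) in
    (0 < g n -> 0 < g n') /\ (0 <= g n -> 0 <= g n').
  move=> [i b] /=; have [oi|noi] := boolP (occurs i phi); last by exists [::].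
  have [rs H] := atom_zeros eig l_nonreal gam_free X2 MX sX e0 I18 ec rl rg gamE b (TX oi).
  by exists rs.
pose Z := 1 :: flatten [seq rs ib | ib <- enum {: 'I_m * bool} & occurs ib.1 phi].
have ZP z : z \in Z -> nm z = 1 /\ tame X e z.
  rewrite inE => /orP[/eqP ->|/flattenP [r /mapP [ib]]].
    by split; [exact: nm1 | exact: (tame1 eig l_nonreal X2 MX sX e I18)].
  by rewrite mem_filter => /andP[oi _] -> zr; have [H _] := rsP ib oi; apply: H.
have rsZ i b z : occurs i phi -> z \in rs (i, b) -> z \in Z.
  move=> oi zr; rewrite inE; apply/orP; right; apply/flattenP; exists (rs (i, b)) => //.
  by apply/mapP; exists (i, b) => //; rewrite mem_filter oi mem_enum.
pose A := (weight X ^ 320)%N; have [W700 XW] := weight_ge.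
have A0 : (0 < A)%N by rewrite expn_gt0; apply/orP; left; apply: leq_trans W700.
have Z1 : 1 \in Z by rewrite inE eqxx.
have sep q k z z' : (q <= (40 * A ^ 2) ^ (depth phi).+1)%N -> (k <= 2 ^ q)%N ->
    z \in Z -> z' \in Z -> gam ^+ k * z <> z' -> (2 ^+ (A * q.+1))^-1 <= nm (gam ^+ k * z - z').
  move=> ql kq /ZP [z1 az] /ZP [z1' az'] ne.
  exact: (tame_sep eig l_nonreal gam_free X2 MX sX e0 I18 rg dX ql kq az az' z1 z1' ne).
have at0 i : occurs i phi -> stable gam Z T (lds_orbit R M s) 0 (Prp i).
  move=> oi; have [_ [N0 H0]] := rsP (i, false) oi; have [_ [N1 H1]] := rsP (i, true) oi.
  exists (N0 + N1)%N => n n' le le' pn [x [y [xE yE fr]]].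
  have fr' b t : x <= t <= y \/ y <= t <= x -> cis t \notin rs (i, b).
    move=> /fr nc; apply/negP => zr; apply: nc; exists (cis t); first exact: rsZ zr.
    by exists 0%N => //; rewrite expr0 mul1r.
  have H : let g := fun n => poly_at (atom_poly (T i)) (lds_orbit R M s n) in
      (0 < g n -> 0 < g n') /\ (0 <= g n -> 0 <= g n').
    case pE: (odd n) pn => /esym pE'.
      by apply: (H1 n n' x y) => //=; [lia | lia | exact: fr'].
    by apply: (H0 n n' x y) => //=; [lia | lia | exact: fr'].
  rewrite /sem /= !addn0 !in_setE /atom_set /=.
  by case: (strict (T i)); case: H.
have := component_bound gamE gam_free Z1 A0 sep (leqnn (depth phi)) at0 Js comp.
apply: le_trans; rewrite lef_pV2 ?posrE ?exprn_gt0 // -!natrX ler_nat leq_exp2l //.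
exact: final_exponent W700 (leq_ltn_trans dX XW).
Qed.

End Component.

Lemma occurs_size m (T : 'I_m -> atom) phi i : occurs i phi -> (atom_bits (T i) <= ltl_size T phi)%N.
Proof.
elim: phi => [k|f IHf g IHg|f IHf g IHg|f IHf g IHg|f IHf g IHg|f IHf] /=.
- by move=> /eqP ->.
- by move=> /orP[/IHf|/IHg]; lia.
- by move=> /orP[/IHf|/IHg]; lia.
- by move=> /orP[/IHf|/IHg]; lia.
- by move=> /orP[/IHf|/IHg]; lia.
- by move=> /IHf; lia.
Qed.

Lemma depth_size m (T : 'I_m -> atom) phi : (depth phi <= ltl_size T phi)%N.
Proof. by elim: phi => [k|f IHf g IHg|f IHf g IHg|f IHf g IHg|f IHf g IHg|f IHf] //=; lia. Qed.

Theorem theorem10 (R : realType) :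
  exists c : nat,
  forall (M : 'M[rat]_3) (s : 'cV[rat]_3) (lambda : R[i]),
    eigenvalue (map_mx ratr M : 'M[R[i]]_3) lambda ->
    complex.Im lambda <> 0 ->
    let gamma : R[i] := lambda / `|lambda| in
    (forall n : nat, (0 < n)%N -> gamma ^+ n <> 1) ->
  forall (m : nat) (T : 'I_m -> atom) (phi : ltl m) (J : set R[i]),
    is_Jset (Zset R M s T phi) gamma J ->
    let Ib := (mx_bits M + mx_bits s + \sum_i atom_bits (T i))%N in
    let I := (mx_bits M + mx_bits s + ltl_size T phi)%N in
    ((1 / 2 ^+ (2 ^ ((Ib + depth phi) ^ c)))%:E <= min_arc_length J)%E /\
    ((1 / 2 ^+ (2 ^ (I ^ c)))%:E <= min_arc_length J)%E.
Proof.
(* The inner exponent is the cube of the weight, so its polynomial bound supplies c before M and s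
   are introduced. *)
have [c Hc] := pb_exp 3 pb_weight.
exists c => M s lambda eig Im0 gamma gam_free m T phi J Js Ib I.
have l_nonreal : lambda^* != lambda.
  apply/eqP; case: lambda eig Im0 gamma gam_free Js => a b /= _ b0 _ _ _ [] E; apply: b0; lra.
have M2 : (2 <= mx_bits M)%N.
  by apply: leq_trans (entry_bits M ord0 ord0); apply: leq_trans (rat_bits_ge _).
(* Both bounds are instances of one, for any X above the bit sizes of M and s, the depth and the
   size of each occurring atom. *)
have main X : (2 <= X)%N -> (mx_bits M <= X)%N -> (mx_bits s <= X)%N -> (depth phi <= X)%N ->
    (forall i, occurs i phi -> (atom_bits (T i) <= X)%N) ->
    ((1 / 2 ^+ (2 ^ (X ^ c)))%:E <= min_arc_length J)%E.
  move=> X2 MX sX dX TX; apply: le_ereal_inf_tmp => _ [L [Ac comp] <-]; rewrite lee_fin.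
  have := component_length eig l_nonreal gam_free X2 MX sX dX TX Js comp.
  apply: le_trans; rewrite div1r lef_pV2 ?posrE ?exprn_gt0 // -!natrX ler_nat.
  by rewrite !leq_exp2l // Hc.
split; apply: main; rewrite /Ib /I; try lia.
- move=> i _; rewrite (bigD1 i) //=; lia.
- by have := depth_size T phi; lia.
- by move=> i /(occurs_size T); lia.
Qed.
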